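(* Let $q\in\mathbb{R}$, $q\neq 0$, let $k\in\{0,1\}$, and let $\alpha_1,\alpha_2\in(0,1)$ with $\alpha_1+\alpha_2\ge 1$. Let $\mathcal{S}_A:=\mathcal{S}^{(\alpha_2,\alpha_1)}_{(\alpha_1,\alpha_2)}(2)$, let $\tau^{(k)}_q:\mathcal{S}_A\to C^\infty(\mathbb{R}^2)$ be the twisting transformation, let $E^{(k)}_{(\alpha_1,\alpha_2)}:=\tau^{(k)}_q(\mathcal{S}_A)$ be its range, let $T^{(k)}_q:E^{(k)}_{(\alpha_1,\alpha_2)}\to\mathcal{S}_A$ be the inverse linear isomorphism of $\tau^{(k)}_q$, and let $\star^W_q$ be the Weyl product (all as defined in the context). Then the formula $$u\star^{(k)}_q v:=\tau^{(k)}_q\left(T^{(k)}_q u\;\star^W_q\;T^{(k)}_q v\right)$$ defines an associative $\mathbb{R}$-algebra structure $\star^{(k)}_q$ on $E^{(k)}_{(\alpha_1,\alpha_2)}$.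
   Context: **Type $\mathcal{S}$ spaces.** For $m\ge 1$ and $\alpha,\beta\in\mathbb{R}^m$ with all components in $(0,1)$ and $\alpha_j+\beta_j\ge1$ for all $j$, $\mathcal{S}_\alpha^\beta(m)$ is the space of entire functions $\varphi$ on $\mathbb{C}^m$ for which there exist $C>0$ and $a,b\in\mathbb{R}^m$ with strictly positive components such that $$|\varphi(x+iy)|\le C\exp\Big(-\sum_{j}a_j|x_j|^{1/\alpha_j}+\sum_j b_j|y_j|^{1/(1-\beta_j)}\Big)\qquad(x,y\in\mathbb{R}^m).$$ An element is identified with its restriction to $\mathbb{R}^m$. One writes $\mathcal{S}_\alpha^\beta=\mathcal{S}_\alpha^\beta(1)$. **Weyl product on $\mathbb{R}^2$.** Let $\omega(x,y)=x\cdot Jy$ on $\mathbb{R}^2$, with $J=\begin{pmatrix}0&1\\-1&0\end{pmatrix}$. The symplectic Fourier transform is $SF(u)(y)=\int_{\mathbb{R}^2}e^{i\omega(x,y)}u(x)\,dx$. The twisted convolution is $(u\times_q v)(x)=\int_{\mathbb{R}^2}e^{iq\omega(x,y)}u(y)v(x-y)\,dy$. The Weyl product is $u\star^W_q v:=SF\left[SF(u)\times_q SF(v)\right]$. **Laplace transform.** $\mathcal{L}(u)(z)=\int_{\mathbb{R}}e^{-zx}u(x)\,dx$. For an open interval $I\subset\mathbb{R}$, $\mathcal{O}_I$ is the space of holomorphic functions $F$ on $I+i\mathbb{R}$ such that for every compact $K\subset I$, the restriction of $F(\xi+i\eta)$ to $K+i\mathbb{R}$ is bounded by a polynomial in $\eta$.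 $\mathcal{L}$ is a bijection from the space $\mathcal{S}'_I$ of distributions $T$ on $\mathbb{R}$ such that $e^{-\xi x}T_x$ is tempered for all $\xi\in I$ onto $\mathcal{O}_I$. Its inverse is $\mathcal{L}^{-1}F(x)=\frac{1}{2\pi i}\int_{c+i\mathbb{R}}e^{zx}F(z)\,dz$ for any $c\in I$, whenever the integral makes sense. **Twisting maps.** $\phi_{q,\theta}(z)=\frac{e^{i\theta}}{q}\sinh(iqz)$. On the strip $S_q=\{z\in\mathbb{C}:|\mathrm{Re}\,z|<\frac{\pi}{2|q|}\}$ the map $\phi_{q,0}$ is biholomorphic onto $\mathbb{C}\setminus\{\pm i t: t\ge 1/|q|\}$, and $\phi_{q,\pi/2}=i\phi_{q,0}$ is biholomorphic onto $\mathbb{C}\setminus\{\pm t:t\ge 1/|q|\}$. $\phi^{-1}_{q,\theta}$ denotes the inverse of the restriction to $S_q$, and $(\phi^{-1}_{q,\theta})^*F=F\circ\phi_{q,\theta}^{-1}$. **The map $\tau^{(k)}_q$.** For $\varphi\in\mathcal{S}_A$ and each $x_1\in\mathbb{R}$, the partial function $\varphi_{x_1}:x_2\mapsto\varphi(x_1,x_2)$ belongs to $\mathcal{S}_{\alpha_2}^{\alpha_1}$. Its Laplace transform is entire, and $(\phi^{-1}_{q,k\pi/2})^*\mathcal{L}(\varphi_{x_1})$ restricted to $I+i\mathbb{R}$ lies in $\mathcal{O}_I$. Here, for $k=0$, $I$ is an open interval contained in $(0,\infty)$ or in $(-\infty,0)$ (the choice of half-line being fixed once and for all), and for $k=1$,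 $I$ is an open interval contained in $(-1/|q|,1/|q|)$. Define $$\tau^{(k)}_q(\varphi)(x_1,x_2):=\Big(\mathcal{L}^{-1}\big((\phi^{-1}_{q,k\pi/2})^*\mathcal{L}(\varphi_{x_1})\big)\Big)(x_2),$$ i.e. $\tau_q^{(k)}=\mathrm{id}_{x_1}\otimes\big(\mathcal{L}^{-1}\circ(\phi^{-1}_{q,k\pi/2})^*\circ\mathcal{L}\big)_{x_2}$. This map is linear and injective into $C^\infty(\mathbb{R}^2)$. Its inverse on its range is $T^{(k)}_q=\mathrm{id}_{x_1}\otimes(\mathcal{L}^{-1}\circ\phi_{q,k\pi/2}^*\circ\mathcal{L})_{x_2}$. *)

(* Defs.v *)
(* MathComp-Analysis; the reals are an arbitrary R : realType, the complex
   numbers are R[i]. *)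
From HB Require Import structures.
From mathcomp Require Import all_boot all_order all_algebra.
From mathcomp Require Import complex.
From mathcomp Require Import all_classical all_reals all_analysis.

Set Implicit Arguments.
Unset Strict Implicit.
Unset Printing Implicit Defensive.

Import Order.TTheory GRing.Theory Num.Theory.
Import numFieldNormedType.Exports.

Local Open Scope classical_set_scope.
Local Open Scope ring_scope.
Local Open Scope complex_scope.

Section ComplexTools.
Context {R : realType}.

Definition cexp (z : R[i]) : R[i] :=
  (expR (complex.Re z))%:C * (cos (complex.Im z) +i* sin (complex.Im z)).

Definition csinh (z : R[i]) : R[i] := (cexp z - cexp (- z)) / 2.

Definition cintegral d (T : measurableType d) (mu : {measure set T -> \bar R})
    (f : T -> R[i]) : R[i] :=
  (\int[mu]_t complex.Re (f t)) +i* (\int[mu]_t complex.Im (f t)).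

Definition row2 (a b : R) : 'rV[R]_2 := \row_(j < 2) if j == 0 then a else b.

Definition integral1 (f : R -> R[i]) : R[i] :=
  cintegral (@lebesgue_measure R) f.

Definition integral2 (f : 'rV[R]_2 -> R[i]) : R[i] :=
  cintegral ((@lebesgue_measure R) \x (@lebesgue_measure R))%E
    (fun p => f (row2 p.1 p.2)).

End ComplexTools.

Section TypeS.
Context {R : realType}.

(* R[i]^o is R[i] as a normed module over itself, so differentiability below
   is complex (Frechet) differentiability on C^m. *)
Definition entire (m : nat) (F : 'rV[R[i]]_m -> R[i]^o) : Prop :=
  forall z, differentiable F z.

Definition cpoint (m : nat) (x y : 'rV[R]_m) : 'rV[R[i]]_m :=
  \row_(j < m) (x 0 j +i* y 0 j).

(* The elements are the restrictions to R^m of the entire functions F. *)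
Definition typeS (m : nat) (alpha beta : 'rV[R]_m) : set ('rV[R]_m -> R[i]) :=
  [set u | exists F : 'rV[R[i]]_m -> R[i]^o,
    [/\ entire F,
        forall x, u x = F (cpoint x 0) &
        exists (C : R) (a b : 'rV[R]_m),
          [/\ 0 < C, forall j, 0 < a 0 j, forall j, 0 < b 0 j &
            forall x y : 'rV[R]_m,
              `|F (cpoint x y)| <=
                (C * expR (- (\sum_j a 0 j * `|x 0 j| `^ (alpha 0 j)^-1)
                           + \sum_j b 0 j * `|y 0 j| `^ (1 - beta 0 j)^-1))%:C]]].

Definition SA (alpha1 alpha2 : R) : set ('rV[R]_2 -> R[i]) :=
  typeS (row2 alpha1 alpha2) (row2 alpha2 alpha1).

End TypeS.

Section Smooth.
Context {R : realType}.

Fixpoint Ck (m n : nat) (g : 'rV[R]_m -> R) : Prop :=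
  if n is n'.+1 then
    (forall x, differentiable g x) /\ (forall v, Ck n' (fun x => 'D_v g x))
  else continuous g.

Definition Cinfty (m : nat) : set ('rV[R]_m -> R[i]) :=
  [set u | forall n, Ck n (fun x => complex.Re (u x)) /\
                     Ck n (fun x => complex.Im (u x))].

End Smooth.

Section Weyl.
Context {R : realType}.
Implicit Types u v : 'rV[R]_2 -> R[i].

Definition J : 'M[R]_2 :=
  \matrix_(i, j) if (i == 0) && (j == 1) then 1
                 else if (i == 1) && (j == 0) then -1 else 0.

(* x . (J y), with row vectors *)
Definition omega (x y : 'rV[R]_2) : R := (x *m (J *m y^T)) 0 0.

Definition SF u (y : 'rV[R]_2) : R[i] :=
  integral2 (fun x => cexp ('i%C * (omega x y)%:C) * u x).

Definition twisted_conv (q : R) u v (x : 'rV[R]_2) : R[i] :=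
  integral2 (fun y => cexp ('i%C * (q * omega x y)%:C) * u y * v (x - y)).

Definition weyl (q : R) u v : 'rV[R]_2 -> R[i] :=
  SF (twisted_conv q (SF u) (SF v)).

End Weyl.

Section Twisting.
Context {R : realType}.

Definition laplace (u : R -> R[i]) (z : R[i]) : R[i] :=
  integral1 (fun x => cexp (- z * x%:C) * u x).

(* (2 i pi)^-1 times the integral of e^(zx) F(z) dz along c + iR, which is
   parametrised by z = c + i eta, dz = i d(eta). *)
Definition inv_laplace (c : R) (F : R[i] -> R[i]) (x : R) : R[i] :=
  (2 * pi%:C * 'i%C)^-1 *
  integral1 (fun eta => cexp ((c +i* eta) * x%:C) * F (c +i* eta) * 'i%C).

Definition phi (q theta : R) (z : R[i]) : R[i] :=
  cexp ('i%C * theta%:C) / q%:C * csinh ('i%C * q%:C * z).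

Definition strip (q : R) : set R[i] :=
  [set z | `|complex.Re z| < pi / (2 * `|q|)].

Definition phi_inv (q theta : R) : R[i] -> R[i] :=
  'pinv_(fun=> 0) (strip q) (phi q theta).

Definition admissible (q : R) (k : 'I_2) (I : set R) : Prop :=
  [/\ open I, is_interval I &
    if k == 0 then (I `<=` [set c | 0 < c]) \/ (I `<=` [set c | c < 0])
    else I `<=` [set c | - `|q|^-1 < c < `|q|^-1]].

(* c is the abscissa of the vertical line used for the inverse Laplace
   transform; it will be any point of an admissible interval. *)
Definition tau (q : R) (k : 'I_2) (c : R) (f : 'rV[R]_2 -> R[i]) :
    'rV[R]_2 -> R[i] :=
  fun x => inv_laplace c
    (laplace (fun x2 => f (row2 (x 0 0) x2)) \o phi_inv q (k%:R * (pi / 2)))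
    (x 0 1).

Definition rangeE (q : R) (k : 'I_2) (c alpha1 alpha2 : R) :
    set ('rV[R]_2 -> R[i]) :=
  tau q k c @` SA alpha1 alpha2.

Definition invT (q : R) (k : 'I_2) (c alpha1 alpha2 : R) :
    ('rV[R]_2 -> R[i]) -> 'rV[R]_2 -> R[i] :=
  'pinv_(fun=> fun=> 0) (SA alpha1 alpha2) (tau q k c).

Definition star (q : R) (k : 'I_2) (c alpha1 alpha2 : R)
    (u v : 'rV[R]_2 -> R[i]) : 'rV[R]_2 -> R[i] :=
  tau q k c (weyl q (invT q k c alpha1 alpha2 u) (invT q k c alpha1 alpha2 v)).

End Twisting.

(* E is a linear subspace of V on which mul is an associative, not necessarily
   unital, K-algebra product. *)
Definition assoc_algebra_on (K : pzRingType) (V : lmodType K) (E : set V)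
    (mul : V -> V -> V) : Prop :=
  [/\ E 0 /\ (forall a u v, E u -> E v -> E (a *: u + v)),
      forall u v, E u -> E v -> E (mul u v),
      forall a u v w, E u -> E v -> E w ->
        mul (a *: u + v) w = a *: mul u w + mul v w,
      forall a u v w, E u -> E v -> E w ->
        mul u (a *: v + w) = a *: mul u v + mul u w &
      forall u v w, E u -> E v -> E w -> mul (mul u v) w = mul u (mul v w)].

(* Main.v *)
(* The space S_A is stable under the symplectic Fourier transform and the twisted convolution: shifting
   contours in C^2 and optimizing the shift by Young's inequality trades the growth in imaginary
   directions against the decay of the Fourier transform, the exponents
   1/alpha_j and 1/(1 - alpha_j) being conjugate.  As SF o SF = (2 pi)^2 id, associativity of the Weyl product
   reduces to that of the twisted convolution, which is Fubini and a translation.  The algebra structure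
   is then transported along tau, which is linear, and injective as follows.  If tau f = 0, Fourier
   inversion along the line c + i R shows that for each x1 the entire Laplace transform of f (x1, .)
   vanishes on the curve phi^-1 (c + i R), hence identically, and f = 0.  Smoothness of tau f holds
   because its integrand decays faster than any power of eta: Im phi^-1 (c + i eta) grows
   logarithmically in eta, and the Laplace transform decays like exp (- a |Im z|^(1/alpha1)) with
   1/alpha1 > 1. *)
Require Import Defs.
From HB Require Import structures.
From mathcomp Require Import all_boot all_order all_algebra.
From mathcomp Require Import complex ring lra.
From mathcomp Require Import all_classical all_reals all_analysis.
From mathcomp Require Import measurable_realfun.

Set Implicit Arguments.
Unset Strict Implicit.
Unset Printing Implicit Defensive.

Import Order.TTheory GRing.Theory Num.Theory.
Import numFieldNormedType.Exports.
Local Open Scope classical_set_scope.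
Local Open Scope ring_scope.
Local Open Scope complex_scope.
#[local] Arguments ComplexField.Normc.normc : simpl never.

(** Type S is stated with Frechet differentiability on C^2, whereas contour shifts use holomorphy in
    each variable separately. The two meet in the exponential integrals [EI], whose second-order
    remainder is bounded explicitly ([quad_diff]). Fourier transforms are such integrals; a function
    F of type S becomes one through F = (2 pi)^-2 FT (FT F), valid at complex points too, and the
    twisted convolution becomes one by replacing its second factor by this double transform. The
    exponent p_j = 1/alpha_j rules the decay in x_j, and r_j the growth in y_j. The symplectic form
    pairs x1 with the second frequency, so p1 has to be conjugate to r2 and p2 to r1; the swapped
    superscript (alpha2, alpha1) of S_A provides this, as r1 = 1/(1 - alpha2) and r2 = 1/(1 -
    alpha1). In the definition of tau, x1 is a mere parameter, so smoothness in x1 is not visible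
    there. A Fourier transform in x1 turns tau f into an [EI] over R^2 in which x1 and x2 occur only
    in the exponent, with coefficients of bounded real part. *)

Notation cRe := (@complex.Re _).
Notation cIm := (@complex.Im _).
Notation nc := ComplexField.Normc.normc.

(* A locked copy of [cexp], which unification would otherwise unfold to cosines and sines. *)
HB.lock Definition cxp {R : realType} (z : R[i]) : R[i] := cexp z.

(** * The complex exponential *)

Section ComplexBasics.
Context {R : realType}.
Implicit Types (z w : R[i]) (x y t : R).

Lemma complex_eqP z w : cRe z = cRe w -> cIm z = cIm w -> z = w.
Proof. by case: z; case: w => ? ? ? ? /= -> ->. Qed.

Lemma cReD z w : cRe (z + w) = cRe z + cRe w. Proof. by case: z; case: w. Qed.
Lemma cImD z w : cIm (z + w) = cIm z + cIm w. Proof. by case: z; case: w. Qed.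
Lemma cReN z : cRe (- z) = - cRe z. Proof. by case: z. Qed.
Lemma cImN z : cIm (- z) = - cIm z. Proof. by case: z. Qed.
Lemma cReM z w : cRe (z * w) = cRe z * cRe w - cIm z * cIm w.
Proof. by case: z; case: w. Qed.
Lemma cImM z w : cIm (z * w) = cRe z * cIm w + cIm z * cRe w.
Proof. by case: z; case: w. Qed.

Definition cE := (cReD, cImD, cReN, cImN, cReM, cImM).

Lemma norm_nc z : `|z| = (nc z)%:C. Proof. by case: z. Qed.

Lemma nc_sqr z : nc z ^+ 2 = cRe z ^+ 2 + cIm z ^+ 2.
Proof. by case: z => a b; rewrite /ComplexField.Normc.normc/= sqr_sqrtr// addr_ge0// sqr_ge0. Qed.

Lemma nc_ge0 z : 0 <= nc z. Proof. by case: z => a b; exact: sqrtr_ge0. Qed.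

Lemma ncM z w : nc (z * w) = nc z * nc w.
Proof. exact: ComplexField.Normc.normcM. Qed.

Lemma ncD z w : nc (z + w) <= nc z + nc w.
Proof. by rewrite -lecR rmorphD/= -!norm_nc ler_normD. Qed.

Lemma nc0 : nc (0 : R[i]) = 0. Proof. exact: ComplexField.Normc.normc0. Qed.
Lemma nc1 : nc (1 : R[i]) = 1. Proof. exact: ComplexField.Normc.normc1. Qed.

Lemma ncN z : nc (- z) = nc z.
Proof. by apply: complexI; rewrite -!norm_nc normrN. Qed.

Lemma ncB z w : nc (z - w) <= nc z + nc w.
Proof. by rewrite -(ncN w) ncD. Qed.

Lemma nc_real x : nc x%:C = `|x|.
Proof. by rewrite /ComplexField.Normc.normc/= expr0n/= addr0 sqrtr_sqr. Qed.

Lemma nc_realM x z : nc (x%:C * z) = `|x| * nc z.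
Proof. by rewrite ncM nc_real. Qed.

Lemma nc_i : nc ('i : R[i]) = 1.
Proof. by rewrite /ComplexField.Normc.normc/= expr0n expr1n add0r sqrtr1. Qed.

Lemma nc_eq0 z : (nc z == 0) = (z == 0).
Proof.
by apply/eqP/eqP => [|->]; [exact: ComplexField.Normc.eq0_normc|exact: nc0].
Qed.

Lemma nc_gt0 z : (0 < nc z) = (z != 0).
Proof. by rewrite lt_neqAle nc_ge0 andbT eq_sym nc_eq0. Qed.

Lemma sqrn x : `|x| ^+ 2 = x ^+ 2. Proof. exact/real_normK/num_real. Qed.

Lemma nc_Re z : `|cRe z| <= nc z.
Proof.
by rewrite -ler_sqr ?nnegrE ?nc_ge0// nc_sqr sqrn lerDl sqr_ge0.
Qed.

Lemma nc_Im z : `|cIm z| <= nc z.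
Proof.
by rewrite -ler_sqr ?nnegrE ?nc_ge0// nc_sqr sqrn lerDr sqr_ge0.
Qed.

Lemma nc_le z : nc z <= `|cRe z| + `|cIm z|.
Proof.
rewrite -ler_sqr ?nnegrE ?nc_ge0 ?addr_ge0// nc_sqr sqrrD !sqrn.
by rewrite lerD2r lerDl mulrn_wge0// mulr_ge0.
Qed.

Lemma ncB_ge z w : nc z - nc w <= nc (z - w).
Proof. by rewrite lerBlDr -[z in nc z <= _](subrK w) ncD. Qed.

Lemma cxpE z : cxp z = cexp z. Proof. by rewrite unlock. Qed.

Lemma Re_cxp z : cRe (cxp z) = expR (cRe z) * cos (cIm z).
Proof. by rewrite cxpE /cexp cE/= mul0r subr0. Qed.

Lemma Im_cxp z : cIm (cxp z) = expR (cRe z) * sin (cIm z).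
Proof. by rewrite cxpE /cexp cE/= mul0r addr0. Qed.

Lemma cxpD z w : cxp (z + w) = cxp z * cxp w.
Proof.
apply: complex_eqP; rewrite !cE !(Re_cxp, Im_cxp) !cE.
  by rewrite expRD cosD; ring.
by rewrite expRD sinD; ring.
Qed.

Lemma cxp0 : cxp 0 = 1 :> R[i].
Proof.
by apply: complex_eqP; rewrite ?Re_cxp ?Im_cxp/= expR0 ?cos0 ?sin0 ?mulr1 ?mulr0.
Qed.

Lemma cxp_neq0 z : cxp z != 0.
Proof.
apply/eqP => h; have := cxpD z (- z); rewrite subrr cxp0 h mul0r => /eqP.
by rewrite oner_eq0.
Qed.

Lemma nc_cxp z : nc (cxp z) = expR (cRe z).
Proof.
apply/eqP; rewrite -(@eqrXn2 _ 2)// ?nc_ge0 ?expR_ge0//.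
by rewrite nc_sqr Re_cxp Im_cxp !exprMn -mulrDr cos2Dsin2 mulr1.
Qed.

Lemma cxp_real x : cxp x%:C = (expR x)%:C.
Proof. by apply: complex_eqP; rewrite ?Re_cxp ?Im_cxp/= ?cos0 ?sin0 ?mulr1 ?mulr0. Qed.

Lemma Re_realM x z : cRe (x%:C * z) = x * cRe z.
Proof. by rewrite cE/= mul0r subr0. Qed.

Lemma Im_realM x z : cIm (x%:C * z) = x * cIm z.
Proof. by rewrite cE/= mul0r addr0. Qed.

(** Replaces a modulus by a real part, which commutes with integration and differentiation; it
    yields [le_cI] and the Taylor estimate. *)
Lemma nc_rotate z : exists2 u : R[i], nc u = 1 & cRe (u * z) = nc z.
Proof.
have [->|z0] := eqVneq z 0; first by exists 1; rewrite ?nc1// mulr0 nc0.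
have nz0 : nc z != 0 by rewrite nc_eq0.
exists ((cRe z / nc z) +i* (- cIm z / nc z)).
  apply/eqP; rewrite -(@eqrXn2 _ 2)// ?nc_ge0// nc_sqr/= !exprMn sqrrN.
  by rewrite -mulrDl -nc_sqr expr1n exprVn mulfV// expf_neq0.
rewrite cE/=; apply: (mulfI nz0); rewrite -expr2 nc_sqr; field.
exact: nz0.
Qed.

Definition cxp_poly n z : R[i] := \sum_(k < n) (k`!%:R^-1)%:C * z ^+ k.

End ComplexBasics.

(** * Taylor remainders of the complex exponential *)

Section Taylor.
Context {R : realType}.
Implicit Types (z w u : R[i]) (x y t : R).

(** A rotated real part of the remainder along the segment from 0 to z: a real function of t, to
    which the mean value theorem applies. *)
Let part (u z : R[i]) n t := cRe (u * (cxp (t%:C * z) - cxp_poly n (t%:C * z))).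

Lemma Re_cxp_tz u z t :
  cRe (u * cxp (t%:C * z)) =
  expR (t * cRe z) * (cRe u * cos (t * cIm z) - cIm u * sin (t * cIm z)).
Proof. by rewrite cE Re_cxp Im_cxp Re_realM Im_realM; ring. Qed.

Lemma Re_poly_tz u z n t :
  cRe (u * cxp_poly n (t%:C * z)) = \sum_(k < n) (k`!%:R^-1 * cRe (u * z ^+ k)) * t ^+ k.
Proof.
elim: n => [|n IH]; first by rewrite /cxp_poly !big_ord0 mulr0.
rewrite /cxp_poly !big_ord_recr/= mulrDr cReD -[X in _ = X + _]IH; congr (_ + _).
rewrite exprMn -rmorphXn/= (_ : u * _ = (n`!%:R^-1 * t ^+ n)%:C * (u * z ^+ n)).
  by rewrite Re_realM; ring.
by rewrite rmorphM/=; ring.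
Qed.

Lemma is_derive_monomial (a : R) n t :
  is_derive t 1 (fun t => a * t ^+ n.+1) (a * (n.+1%:R * t ^+ n)).
Proof.
have h := is_deriveZ a (is_deriveX n.+1 (is_derive_id t 1)).
rewrite (_ : (fun t => _) = a \*: (id ^+ n.+1)); last first.
  by apply/funext => s; rewrite /= fctE.
by apply: is_derive_eq; rewrite /GRing.scale/= mulr1.
Qed.

(** Differentiation lowers the order of the remainder by one and absorbs the factor z into u, which
    is what the induction in [cxp_poly_bound] consumes. *)
Lemma is_derive_part u z n t :
  is_derive t 1 (part u z n.+1) (part (u * z) z n t).
Proof.
rewrite (_ : part u z n.+1 = fun t =>
  expR (t * cRe z) * (cRe u * cos (t * cIm z) - cIm u * sin (t * cIm z)) -
  \sum_(k < n.+1) (k`!%:R^-1 * cRe (u * z ^+ k)) * t ^+ k); last first.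
  by apply/funext => s; rewrite /part mulrBr cReD cReN Re_cxp_tz Re_poly_tz.
rewrite /part mulrBr cReD cReN Re_cxp_tz Re_poly_tz.
apply: is_deriveB.
  apply: is_derive_eq.
  rewrite /GRing.scale/= !cE; ring.
rewrite (_ : (fun _ => _) = \sum_(k < n.+1) (fun t =>(k`!%:R^-1 * cRe (u * z ^+ k)) * t ^+ k)); last first.
  by apply/funext => s; rewrite fct_sumE.
rewrite big_ord_recl/=.
rewrite [X in is_derive _ _ X _](_ : _ = cst (cRe u) + \sum_(i < n) (fun t0 => (((bump 0 i)`!)%:R^-1 * cRe (u * z ^+ bump 0 i)) * t0 ^+ bump 0 i)); last first.
  by congr (_ + _); apply/funext => s; rewrite /= !expr0 !mulr1 fact0 invr1 mul1r.
rewrite -[X in is_derive _ _ _ X]add0r.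
apply: is_deriveD.
apply: is_derive_sum => i.
rewrite /bump/= add1n.
have n0 : (i.+1%:R : R) != 0 by rewrite pnatr_eq0.
have f0 : (i`!%:R : R) != 0 by rewrite pnatr_eq0 -lt0n fact_gt0.
rewrite (_ : u * z ^+ i.+1 = u * z * z ^+ i); last by rewrite exprS mulrA.
rewrite factS natrM; set A := cRe _.
apply: is_derive_eq (is_derive_monomial _ _ _) _.
by move: (i.+1%:R : R) n0 => N n0; field; rewrite n0 f0.
Qed.

(** Monotonicity in t: the bound minus the remainder vanishes at 0 and, by induction on n, has
    nonnegative derivative. Having |Re z| and not |z| in the exponential matters: the factor is 1 on
    the imaginary axis, and [EI_quad] controls only real parts. *)
Lemma cxp_poly_bound n z :
  nc (cxp z - cxp_poly n z) <= nc z ^+ n / n`!%:R * expR `|cRe z|.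
Proof.
suff H : forall u t, nc u = 1 -> 0 <= t ->
    part u z n t <= (nc z * t) ^+ n / n`!%:R * expR (`|cRe z| * t).
  have [u u1 <-] := nc_rotate (cxp z - cxp_poly n z).
  by have := H u 1 u1 ler01; rewrite /part mul1r !mulr1.
elim: n => [|n IH] u t u1 t0.
  rewrite /part /cxp_poly big_ord0 subr0 expr0 fact0 mul1r invr1 mul1r.
  apply: le_trans (ler_norm _) _; apply: le_trans (nc_Re _) _.
  rewrite ncM u1 mul1r nc_cxp Re_realM ler_expR mulrC.
  by rewrite ler_wpM2r// ler_norm.
have part0 : part u z n.+1 0 = 0.
  rewrite /part mul0r cxp0 /cxp_poly big_ord_recl expr0 mulr1 fact0 invr1.
  rewrite big1 ?addr0 ?subrr ?mulr0//.
  by move=> i _; rewrite /= /bump/= add1n exprS mul0r mulr0.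
have [->|z0] := eqVneq z 0.
  rewrite /part !mulr0 cxp0 /cxp_poly big_ord_recl expr0 mulr1 fact0 invr1.
  rewrite big1 ?addr0 ?subrr ?mulr0/=; last first.
    by move=> i _; rewrite /= /bump/= add1n exprS mul0r mulr0.
  by rewrite nc0 mul0r exprS !mul0r.
have nz0 : 0 < nc z by rewrite nc_gt0.
(* The claimed bound as a function of t. In [dv] the first summand is the one dominated by the
   induction hypothesis; the second is nonnegative. *)
pose v (t : R) : R := (nc z * t) ^+ n.+1 / n.+1`!%:R * expR (`|cRe z| * t).
pose dv (t : R) : R := nc z * ((nc z * t) ^+ n / n`!%:R * expR (`|cRe z| * t)) + `|cRe z| * v t.
have dvP (s : R) : is_derive s 1 v (dv s).
  have n0 : (n.+1%:R : R) != 0 by rewrite pnatr_eq0.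
  have f0 : (n`!%:R : R) != 0 by rewrite pnatr_eq0 -lt0n fact_gt0.
  pose A : R := nc z ^+ n.+1 / n.+1`!%:R.
  have -> : v = (fun t => A * t ^+ n.+1) * (fun t => expR (`|cRe z| * t)).
    by apply/funext => x; rewrite /v /A exprMn fctE; ring.
  have h := is_derive_monomial A n s.
  apply: is_derive_eq.
  rewrite /GRing.scale/= /dv /v /A factS natrM !exprMn !exprS.
  by move: (n.+1%:R : R) n0 => N n0; field; rewrite n0 f0.
pose g (t : R) : R := v t - part u z n.+1 t.
have dgP (s : R) : is_derive s 1 g (dv s - part (u * z) z n s).
  by apply: is_deriveB; exact: is_derive_part.
move: t0; rewrite le_eqVlt => /orP[/eqP <-|t0].
  by rewrite part0 mulr_ge0 ?expR_ge0// mulr_ge0 ?invr_ge0 ?ler0n// mulr0 exprn_ge0.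
rewrite -subr_ge0.
have cg (x : R) : {for x, continuous g}.
  apply/differentiable_continuous/derivable1_diffP.
  by apply: ex_derive; exact: dgP.
have [s|s]//= := @MVT R g (fun s => dv s - part (u * z) z n s) 0 t t0.
  by apply: continuous_in_subspaceT => x _; exact: cg.
rewrite in_itv/= => /andP[s0 st]; rewrite subr0.
have -> : g 0 = 0 by rewrite /g /v part0 mulr0 exprS !mul0r subr0.
rewrite subr0 /g /v => ->; apply: mulr_ge0; last exact: ltW.
(* The induction hypothesis wants a unimodular factor, so u z is normalised and |z| taken out. *)
pose u' := u * z * (nc z)^-1%:C.
have u'1 : nc u' = 1.
  by rewrite /u' !ncM u1 mul1r nc_real ger0_norm ?invr_ge0 ?nc_ge0// mulfV ?gt_eqF.
have e : part (u * z) z n s = nc z * part u' z n s.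
  rewrite /part /u' -Re_realM; congr cRe.
  rewrite !mulrA [_%:C * u]mulrC -!mulrA; congr (u * _).
  rewrite mulrCA; congr (z * _); rewrite mulrA -rmorphM/= mulfV ?mul1r//.
  by rewrite gt_eqF.
rewrite subr_ge0 e /dv; apply: (@le_trans _ _ (nc z * ((nc z * s) ^+ n / n`!%:R * expR (`|cRe z| * s)))).
  by rewrite ler_pM2l// IH// ltW.
rewrite lerDl mulr_ge0// /v mulr_ge0 ?expR_ge0//.
by rewrite mulr_ge0 ?invr_ge0 ?ler0n// exprn_ge0// mulr_ge0// ltW.
Qed.

End Taylor.

(** * Integration of complex functions *)

Section Caratheodory.
Context d (T : measurableType d) (R : realType).

(** The function does not depend on x within a strip m/N <= x < (m+1)/N, so preimages are countable
    unions of rectangles, indexed here by the pickled integer m. *)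
Lemma measurable_fun_floor_step (f : R -> T -> R) (N : R) :
  0 < N -> (forall x, measurable_fun setT (f x)) ->
  measurable_fun setT
    (fun p : R * T => f ((Num.floor (p.1 * N))%:~R / N) p.2).
Proof.
move=> N0 mf _ /= B mB; rewrite setTI.
have -> : (fun p : R * T => f ((Num.floor (p.1 * N))%:~R / N) p.2) @^-1` B =
  \bigcup_n (if (unpickle n : option int) is Some m then
    [set x : R | m%:~R / N <= x < (m + 1)%:~R / N] `*` (f (m%:~R / N) @^-1` B)
    else set0).
  apply/seteqP; split => [[x y] /= Bxy|[x y] [n _]].
    exists (pickle (Num.floor (x * N))); first by [].
    rewrite pickleK; split; last exact: Bxy.
    by rewrite /= ler_pdivrMr// ltr_pdivlMr// floor_le_tmp floorD1_gt.
  case: unpickle => // m [/= /andP[]].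
  rewrite ler_pdivrMr// ltr_pdivlMr// => h1 h2 h3.
  by rewrite (@floor_def _ _ m)// h1 h2.
apply: bigcupT_measurable => n; case: unpickle => // m.
apply: measurableX.
  rewrite (_ : [set _ | _] = `[m%:~R / N, (m + 1)%:~R / N[%classic).
    exact: measurable_itv.
  by apply/seteqP; split => x /=; rewrite in_itv.
by rewrite -[X in measurable X]setTI; exact: mf.
Qed.

(** By continuity in x, the function is the pointwise limit of its step versions as the mesh 1/(n+1)
    shrinks. Joint measurability on the plane thus follows from separate continuity. *)
Lemma Caratheodory_measurable (f : R -> T -> R) :
  (forall y, continuous (f ^~ y)) -> (forall x, measurable_fun setT (f x)) ->
  measurable_fun setT (fun p : R * T => f p.1 p.2).
Proof.
move=> cf mf.
apply: (@measurable_fun_cvg _ (R * T)%type R setT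
  (fun n (p : R * T) => f ((Num.floor (p.1 * n.+1%:R))%:~R / n.+1%:R) p.2)).
  by move=> n; apply: measurable_fun_floor_step.
move=> [x y] _ /=.
apply: (@continuous_cvg _ _ _ (nbhs \oo) _ _ (f ^~ y) x); first exact: cf.
apply/cvgrPdist_le => e e0.
apply: filterS (near_infty_natSinv_lt (PosNum e0)) => n /ltW h3.
have n0 : (0 : R) < n.+1%:R by [].
have h1 : (Num.floor (x * n.+1%:R))%:~R <= x * n.+1%:R by exact: floor_le_tmp.
have h2 : x * n.+1%:R < (Num.floor (x * n.+1%:R) + 1)%:~R by exact: floorD1_gt.
set m := Num.floor _ in h1 h2 *.
rewrite ger0_norm; last by rewrite subr_ge0 ler_pdivrMr.
apply: le_trans h3; rewrite lerBlDl -[X in _ + X]mul1r -mulrDl.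
by rewrite ler_pdivlMr// ltW// (lt_le_trans h2)// intrD.
Qed.

End Caratheodory.

Section ComplexIntegral.
Context d (T : measurableType d) (R : realType).
Variable mu : {measure set T -> \bar R}.
Implicit Types (D : set T) (f g : T -> R[i]) (G : T -> R).

Definition rint D G := mu.-integrable D (EFin \o G).

Definition cmeas D f :=
  measurable_fun D (cRe \o f) /\ measurable_fun D (cIm \o f).

Definition cint D f := rint D (cRe \o f) /\ rint D (cIm \o f).

(** On [setT] this is convertible to [cintegral], so [eq_cI] applies directly to [SF],
    [twisted_conv] and [laplace]; the domain D serves for segments. *)
Definition cI D f : R[i] :=
  (\int[mu]_(t in D) cRe (f t)) +i* (\int[mu]_(t in D) cIm (f t)).

Lemma cmeas_cst D (z : R[i]) : cmeas D (fun=> z).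
Proof. by split; exact: measurable_cst. Qed.

Lemma cmeasD D f g : cmeas D f -> cmeas D g -> cmeas D (fun t => f t + g t).
Proof.
move=> [fr fi] [gr gi]; split.
  rewrite (_ : _ \o _ = (cRe \o f) \+ (cRe \o g)); last first.
    by apply/funext => t /=; rewrite cReD.
  exact: measurable_funD.
rewrite (_ : _ \o _ = (cIm \o f) \+ (cIm \o g)); last first.
  by apply/funext => t /=; rewrite cImD.
exact: measurable_funD.
Qed.

Lemma cmeasM D f g : cmeas D f -> cmeas D g -> cmeas D (fun t => f t * g t).
Proof.
move=> [fr fi] [gr gi]; split.
  rewrite (_ : _ \o _ = ((cRe \o f) \* (cRe \o g)) \- ((cIm \o f) \* (cIm \o g))).
    by apply: measurable_funB; apply: measurable_funM.
  by apply/funext => t /=; rewrite cReM.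
rewrite (_ : _ \o _ = ((cRe \o f) \* (cIm \o g)) \+ ((cIm \o f) \* (cRe \o g))).
  by apply: measurable_funD; apply: measurable_funM.
by apply/funext => t /=; rewrite cImM.
Qed.

Lemma cmeasN D f : cmeas D f -> cmeas D (fun t => - f t).
Proof.
move=> /(cmeasM (cmeas_cst D (-1))).
by under eq_fun do rewrite mulN1r.
Qed.

Lemma cmeas_real D G : measurable_fun D G -> cmeas D (fun t => (G t)%:C).
Proof. by move=> mG; split => //; exact: measurable_cst. Qed.

Lemma cmeas_cxp D f : cmeas D f -> cmeas D (fun t => cxp (f t)).
Proof.
move=> [fr fi]; split.
  rewrite (_ : _ \o _ = (expR \o (cRe \o f)) \* (cos \o (cIm \o f))).
    apply: measurable_funM; apply: measurableT_comp => //.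
    by apply: continuous_measurable_fun; exact: continuous_cos.
  by apply/funext => t; exact: Re_cxp.
rewrite (_ : _ \o _ = (expR \o (cRe \o f)) \* (sin \o (cIm \o f))).
  apply: measurable_funM; apply: measurableT_comp => //.
  by apply: continuous_measurable_fun; exact: continuous_sin.
by apply/funext => t; exact: Im_cxp.
Qed.

Lemma cmeas_nc D f : cmeas D f -> measurable_fun D (fun t => nc (f t)).
Proof.
move=> [fr fi].
rewrite (_ : (fun t => _) = Num.sqrt \o
  ((cRe \o f) \* (cRe \o f) \+ (cIm \o f) \* (cIm \o f))); last first.
  by apply/funext => t /=; case: (f t) => a b; rewrite /ComplexField.Normc.normc !expr2.
apply: measurableT_comp.
  by apply: continuous_measurable_fun; exact: sqrt_continuous.
by apply: measurable_funD; apply: measurable_funM.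
Qed.

Lemma cint_meas D f : cint D f -> cmeas D f.
Proof.
by move=> [fr fi]; split; apply/measurable_EFinP;
  [exact: measurable_int fr|exact: measurable_int fi].
Qed.

Section OnD.
Variable D : set T.
Hypothesis mD : measurable D.

Lemma rint_dom (G H : T -> R) : measurable_fun D G -> rint D H ->
  (forall t, D t -> `|G t| <= H t) -> rint D G.
Proof.
move=> mG iH GH; apply: (@le_integrable _ _ _ mu D mD _ (EFin \o H)) => //.
  exact/measurable_EFinP.
by move=> t Dt /=; rewrite lee_fin (le_trans (GH _ Dt))// ler_norm.
Qed.

Lemma rintZ G (a : R) : rint D G -> rint D (fun t => a * G t).
Proof.
move=> iG; rewrite /rint (_ : _ \o _ = fun t => (a%:E * (EFin \o G) t)%E)//.
exact: integrableZl.
Qed.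

Lemma rintD G H : rint D G -> rint D H -> rint D (fun t => G t + H t).
Proof. by move=> iG iH; exact: (integrableD mD iG iH). Qed.

Lemma cint_dom f G : cmeas D f -> rint D G ->
  (forall t, D t -> nc (f t) <= G t) -> cint D f.
Proof.
move=> [fr fi] iG fG; split; apply: (@rint_dom _ G) => //= t Dt.
  exact: le_trans (nc_Re _) (fG _ Dt).
exact: le_trans (nc_Im _) (fG _ Dt).
Qed.

Lemma cint_nc f : cint D f -> rint D (fun t => nc (f t)).
Proof.
move=> cf; apply: (@rint_dom _ (fun t => `|cRe (f t)| + `|cIm (f t)|)).
- exact/cmeas_nc/cint_meas.
- by case: cf => fr fi; apply: rintD; exact: integrable_norm.
- by move=> t Dt; rewrite ger0_norm ?nc_ge0//; exact: nc_le.
Qed.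

Lemma cintZ (z : R[i]) f : cint D f -> cint D (fun t => z * f t).
Proof.
move=> cf; apply: (@cint_dom _ (fun t => nc z * nc (f t))).
- by apply: cmeasM; [exact: cmeas_cst|exact: cint_meas].
- by apply: rintZ; exact: cint_nc.
- by move=> t _; rewrite ncM.
Qed.

Lemma cintD f g : cint D f -> cint D g -> cint D (fun t => f t + g t).
Proof.
move=> cf cg; apply: (@cint_dom _ (fun t => nc (f t) + nc (g t))).
- by apply: cmeasD; exact: cint_meas.
- by apply: rintD; exact: cint_nc.
- by move=> t _; rewrite ncD.
Qed.

Lemma cintN f : cint D f -> cint D (fun t => - f t).
Proof. by move=> /(cintZ (-1)); under eq_fun do rewrite mulN1r. Qed.

Lemma cintB f g : cint D f -> cint D g -> cint D (fun t => f t - g t).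
Proof. by move=> cf /cintN; exact: cintD. Qed.

Lemma eq_cI f g : (forall t, D t -> f t = g t) -> cI D f = cI D g.
Proof.
by move=> fg; rewrite /cI; congr (_ +i* _);
  apply: eq_Rintegral => t /set_mem Dt; rewrite fg.
Qed.

Lemma cID f g : cint D f -> cint D g ->
  cI D (fun t => f t + g t) = cI D f + cI D g.
Proof.
move=> [fr fi] [gr gi]; apply: complex_eqP; rewrite cE/=.
  by rewrite -RintegralD//; apply: eq_Rintegral => t _; rewrite cE.
by rewrite -RintegralD//; apply: eq_Rintegral => t _; rewrite cE.
Qed.

Lemma cIZ (z : R[i]) f : cint D f -> cI D (fun t => z * f t) = z * cI D f.
Proof.
move=> [fr fi]; apply: complex_eqP; rewrite cE/=.
  rewrite -!RintegralZl// -RintegralB//; [|exact: rintZ|exact: rintZ].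
  by apply: eq_Rintegral => t _; rewrite cE.
rewrite -!RintegralZl// -RintegralD//; [|exact: rintZ|exact: rintZ].
by apply: eq_Rintegral => t _; rewrite cE.
Qed.

Lemma cIZr (z : R[i]) f : cint D f -> cI D (fun t => f t * z) = cI D f * z.
Proof.
move=> cf; rewrite mulrC -cIZ//; apply: eq_cI => t _; exact: mulrC.
Qed.

Lemma cIN f : cint D f -> cI D (fun t => - f t) = - cI D f.
Proof.
by move=> cf; rewrite -mulN1r -cIZ//; apply: eq_cI => t _; rewrite mulN1r.
Qed.

Lemma cIB f g : cint D f -> cint D g ->
  cI D (fun t => f t - g t) = cI D f - cI D g.
Proof. by move=> cf cg; rewrite cID ?cIN//; exact: cintN. Qed.

Lemma cI_real G : rint D G ->
  cI D (fun t => (G t)%:C) = (\int[mu]_(t in D) G t)%:C.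
Proof.
by move=> iG; apply: complex_eqP => //=; rewrite /Rintegral integral0.
Qed.

(** After rotating the value of the integral onto the positive axis, only a real integral has to be
    compared with that of G. *)
Lemma le_cI f G : cint D f -> rint D G -> (forall t, D t -> nc (f t) <= G t) ->
  nc (cI D f) <= \int[mu]_(t in D) G t.
Proof.
move=> cf iG fG; have [u u1 <-] := nc_rotate (cI D f).
rewrite -cIZ//=; apply: le_Rintegral => //; first by case: (cintZ u cf).
move=> t Dt; apply: le_trans (fG _ Dt); apply: le_trans (ler_norm _) _.
by apply: le_trans (nc_Re _) _; rewrite ncM u1 mul1r.
Qed.

End OnD.

Definition ccvg (u : nat -> R[i]) (l : R[i]) :=
  (fun n => cRe (u n)) @ \oo --> cRe l /\ (fun n => cIm (u n)) @ \oo --> cIm l.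

Lemma cDCT D (f_ : nat -> T -> R[i]) f G : measurable D ->
  (forall n, cmeas D (f_ n)) -> cmeas D f ->
  (forall t, D t -> ccvg (f_ ^~ t) (f t)) ->
  rint D G -> (forall n t, D t -> nc (f_ n t) <= G t) ->
  cint D f /\ ccvg (fun n => cI D (f_ n)) (cI D f).
Proof.
move=> mD mf_ mf f_f iG f_G.
have H (p : R[i] -> R) : (forall n, measurable_fun D (p \o f_ n)) ->
    measurable_fun D (p \o f) ->
    (forall t, D t -> (fun n => p (f_ n t)) @ \oo --> p (f t)) ->
    (forall z, `|p z| <= nc z) ->
    rint D (p \o f) /\
    (fun n => \int[mu]_(t in D) p (f_ n t)) @ \oo --> \int[mu]_(t in D) p (f t).
  move=> mp_ mp pf pnc.
  have [] := @dominated_convergence _ _ _ mu D mD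
    (fun n t => (p (f_ n t))%:E) (EFin \o (p \o f)) (EFin \o G).
  - by move=> n; apply/measurable_EFinP; exact: mp_.
  - exact/measurable_EFinP.
  - apply: aeW => t Dt; apply/fine_cvgP; split; last exact: pf.
    exact: nearW.
  - exact: iG.
  - by apply: aeW => t n Dt; rewrite lee_fin (le_trans (pnc _))// f_G.
  move=> i _ c.
  split=> //.
  apply: (@fine_cvg _ _ _ _ (fun n => (\int[mu]_(t in D) (p (f_ n t))%:E)%E)).
  rewrite /Rintegral fineK//; exact: integrable_fin_num.
have [ir cr] := H cRe (fun n => (mf_ n).1) mf.1 (fun t Dt => (f_f t Dt).1) (@nc_Re R).
have [ii ci] := H cIm (fun n => (mf_ n).2) mf.2 (fun t Dt => (f_f t Dt).2) (@nc_Im R).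
by split; split.
Qed.

End ComplexIntegral.

(** * Fubini's theorem for complex functions *)

Section ComplexFubini.
Context d1 d2 (T1 : measurableType d1) (T2 : measurableType d2) (R : realType).
Variable m1 : {sigma_finite_measure set T1 -> \bar R}.
Variable m2 : {sigma_finite_measure set T2 -> \bar R}.
Implicit Type f : T1 * T2 -> R[i].

(** Every section is assumed integrable, not just almost every one, so the real-valued inner
    integral agrees with the extended-valued one at each point. *)
Let Rint_fubini1 (G : T1 * T2 -> R) : rint (m1 \x m2)%E setT G ->
  (forall x, rint m2 setT (fun y => G (x, y))) ->
  rint m1 setT (fun x => \int[m2]_y G (x, y)) /\
  \int[(m1 \x m2)%E]_p G p = \int[m1]_x \int[m2]_y G (x, y).
Proof.
move=> iG iG1.
have e : EFin \o (fun x => \int[m2]_y G (x, y)) = fubini_F m2 (EFin \o G).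
  apply/funext => x; rewrite /= /fubini_F /Rintegral fineK//.
  exact: integrable_fin_num (iG1 x).
split; first by rewrite /rint e; exact: integrable_fubini_F.
rewrite /Rintegral -(integral12_prod_meas1 iG); congr fine.
by apply: eq_integral => x _; rewrite -e.
Qed.

Let Rint_fubini2 (G : T1 * T2 -> R) : rint (m1 \x m2)%E setT G ->
  (forall y, rint m1 setT (fun x => G (x, y))) ->
  \int[(m1 \x m2)%E]_p G p = \int[m2]_y \int[m1]_x G (x, y).
Proof.
move=> iG iG1.
have e : EFin \o (fun y => \int[m1]_x G (x, y)) = fubini_G m1 (EFin \o G).
  apply/funext => x; rewrite /= /fubini_G /Rintegral fineK//.
  exact: integrable_fin_num (iG1 x).
rewrite /Rintegral -(integral21_prod_meas1 iG); congr fine.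
by apply: eq_integral => x _; rewrite -e.
Qed.

Lemma cFubini1 f : cint (m1 \x m2)%E setT f ->
  (forall x, cint m2 setT (fun y => f (x, y))) ->
  cI (m1 \x m2)%E setT f = cI m1 setT (fun x => cI m2 setT (fun y => f (x, y))).
Proof.
move=> [fr fi] f2; apply: complex_eqP => /=.
  by have [] := Rint_fubini1 fr (fun x => (f2 x).1).
by have [] := Rint_fubini1 fi (fun x => (f2 x).2).
Qed.

Lemma cFubini2 f : cint (m1 \x m2)%E setT f ->
  (forall y, cint m1 setT (fun x => f (x, y))) ->
  cI (m1 \x m2)%E setT f = cI m2 setT (fun y => cI m1 setT (fun x => f (x, y))).
Proof.
move=> [fr fi] f2; apply: complex_eqP => /=.
  exact: Rint_fubini2 fr (fun x => (f2 x).1).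
exact: Rint_fubini2 fi (fun x => (f2 x).2).
Qed.

Lemma cint_Fubini1 f : cint (m1 \x m2)%E setT f ->
  (forall x, cint m2 setT (fun y => f (x, y))) ->
  cint m1 setT (fun x => cI m2 setT (fun y => f (x, y))).
Proof.
move=> [fr fi] f2; split.
  by have [] := Rint_fubini1 fr (fun x => (f2 x).1).
by have [] := Rint_fubini1 fi (fun x => (f2 x).2).
Qed.

Lemma rint_prod (g1 : T1 -> R) (g2 : T2 -> R) :
  (forall x, 0 <= g1 x) -> (forall y, 0 <= g2 y) ->
  rint m1 setT g1 -> rint m2 setT g2 ->
  rint (m1 \x m2)%E setT (fun p => g1 p.1 * g2 p.2).
Proof.
move=> g10 g20 i1 i2; apply/integrable12ltyP => /=.
  apply/measurable_EFinP; apply: measurable_funM.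
    by apply: measurableT_comp => //; apply/measurable_EFinP; exact: measurable_int i1.
  by apply: measurableT_comp => //; apply/measurable_EFinP; exact: measurable_int i2.
under eq_integral => x _.
  under eq_integral => y _.
    rewrite ger0_norm ?mulr_ge0// EFinM; over.
  rewrite integralZl//=; over.
have e2 : (\int[m2]_y (g2 y)%:E)%E = (\int[m2]_y g2 y)%:E.
  by rewrite fineK//; exact: integrable_fin_num i2.
have e1 : (\int[m1]_y (g1 y)%:E)%E = (\int[m1]_y g1 y)%:E.
  by rewrite fineK//; exact: integrable_fin_num i1.
under eq_integral do rewrite e2.
by rewrite integralZr//= e1 -EFinM ltry.
Qed.

End ComplexFubini.

(** * Complex functions on the real line *)

Section RealLine.
Context {R : realType}.
Notation mu := (@lebesgue_measure R).
Implicit Types (f g : R -> R[i]) (G : R -> R).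

(** The Cauchy weight is the common majorant on the line: it is integrable, at most 1, stable under
    translation up to a factor ([ker_shift]), and a multiple of it dominates Gaussians and the decay
    of type S. *)
Definition ker (x : R) : R := (1 + x ^+ 2)^-1.

Lemma oneDsq_gt0 (x : R) : 0 < 1 + x ^+ 2.
Proof. by rewrite ltr_pwDl// sqr_ge0. Qed.

Lemma ker_gt0 x : 0 < ker x.
Proof. by rewrite invr_gt0 oneDsq_gt0. Qed.

Lemma ker_ge0 x : 0 <= ker x. Proof. exact/ltW/ker_gt0. Qed.

Lemma ker_le1 x : ker x <= 1.
Proof. by rewrite invf_le1 ?oneDsq_gt0// lerDl sqr_ge0. Qed.

Lemma continuous_ker : continuous ker.
Proof. exact: continuous_oneDsqrV. Qed.

Lemma rint_ker : rint mu setT ker.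
Proof.
apply/integrableP; split.
  by apply/measurable_EFinP; apply: continuous_measurable_fun; exact: continuous_ker.
under eq_integral do rewrite /= ger0_norm ?ker_ge0//.
rewrite ge0_symfun_integralT; first last.
- by move=> x; rewrite /ker/= sqrrN.
- exact: continuous_ker.
- exact: ker_ge0.
by rewrite -set_itvcy integral0y_oneDsqr -EFinM ltry.
Qed.

Lemma ge0_integral_affine G (a b : R) : 0 < a -> continuous G ->
  (forall x, 0 <= G x) ->
  (\int[mu]_x (G x)%:E = \int[mu]_x (a * G (a * x + b))%:E)%E.
Proof.
move=> a0 cG G0.
pose F (x : R) := a * x + b.
have dF (x : R) : is_derive x 1 F a.
  by apply: is_derive_eq; rewrite /GRing.scale/= mulr1 addr0.
have F'E : derive1 F = cst a by apply/funext => x; rewrite derive1E derive_val.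
rewrite (@increasing_ge0_integration_by_substitutionT _ F G)//.
- by apply: eq_integral => x _; rewrite F'E fctE mulrC.
- by move=> x y xy; rewrite /F ltrD2r ltr_pM2l.
- by rewrite F'E => x; exact: cvg_cst.
- by rewrite F'E; exact: is_cvg_cst.
- by rewrite F'E; exact: is_cvg_cst.
- apply/cvgrNyPle => A; apply: filterS (nbhs_ninfty_le (num_real ((A - b) / a))) => x.
  by rewrite ler_pdivlMr// /F -lerBrDr mulrC.
- apply/cvgryPge => A; apply: filterS (nbhs_pinfty_ge (num_real ((A - b) / a))) => x.
  by rewrite ler_pdivrMr// /F -lerBlDr mulrC.
Qed.

Let ge0_Rint_affine G (a b : R) : 0 < a -> continuous G ->
  (forall x, 0 <= G x) -> rint mu setT G ->
  rint mu setT (fun x => a * G (a * x + b)) /\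
  \int[mu]_x (a * G (a * x + b)) = \int[mu]_x G x.
Proof.
move=> a0 cG G0 iG; split; last by rewrite /Rintegral -ge0_integral_affine.
have cGa : continuous (fun x => a * G (a * x + b)).
  move=> x; apply: cvgM; first exact: cvg_cst.
  apply: (@continuous_comp _ _ _ (fun x => a * x + b)); last exact: cG.
  by apply: cvgD; [apply: cvgM => //; exact: cvg_cst|exact: cvg_cst].
apply/integrableP; split.
  by apply/measurable_EFinP; exact: continuous_measurable_fun.
have -> : (\int[mu]_x `|(EFin \o (fun x => (a * G (a * x + b))%R)) x| = \int[mu]_x (G x)%:E)%E.
  rewrite [RHS](ge0_integral_affine b a0)//; apply: eq_integral => x _ /=.
  by rewrite ger0_norm// mulr_ge0// ltW.
have f1 := integrable_fin_num measurableT iG.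
by rewrite -(fineK f1) ltry.
Qed.

Let Rint_affine G (a b : R) : 0 < a -> continuous G -> rint mu setT G ->
  rint mu setT (fun x => a * G (a * x + b)) /\
  \int[mu]_x (a * G (a * x + b)) = \int[mu]_x G x.
Proof.
move=> a0 cG iG.
(* G = (|G| + G) - |G| has both parts nonnegative and continuous, as the nonnegative case
   requires. *)
pose G1 x := `|G x| + G x; pose G2 x := `|G x|.
have cn : continuous G2 by move=> x; apply: cvg_norm; exact: cG.
have i2 : rint mu setT G2 by exact: integrable_norm.
have i1 : rint mu setT G1 by exact: rintD.
have [j1 e1] : rint mu setT (fun x => a * G1 (a * x + b)) /\
    \int[mu]_x (a * G1 (a * x + b)) = \int[mu]_x G1 x.
  apply: ge0_Rint_affine => //.
    by move=> x; apply: cvgD; [exact: cn|exact: cG].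
  by move=> x; rewrite /G1 -lerBlDr sub0r -normrN ler_norm.
have [j2 e2] : rint mu setT (fun x => a * G2 (a * x + b)) /\
    \int[mu]_x (a * G2 (a * x + b)) = \int[mu]_x G2 x.
  by apply: ge0_Rint_affine => // x; rewrite /G2.
have eG x : G x = G1 x - G2 x by rewrite /G1 /G2 addrAC subrr add0r.
have eGa : (fun x => a * G (a * x + b)) =
    fun x => a * G1 (a * x + b) - a * G2 (a * x + b).
  by apply/funext => x; rewrite [in LHS]eG mulrBr.
rewrite eGa; split; first exact: (integrableB measurableT j1 j2).
rewrite RintegralB// e1 e2 -RintegralB//.
by apply: eq_Rintegral => x _; rewrite eG.
Qed.

Definition ccont f := continuous (cRe \o f) /\ continuous (cIm \o f).

Lemma ccont_meas f : ccont f -> cmeas setT f.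
Proof. by move=> [fr fi]; split; exact: continuous_measurable_fun. Qed.

Lemma ccont_cst (z : R[i]) : ccont (fun=> z).
Proof. by split=> x; exact: cvg_cst. Qed.

Lemma ccont_real G : continuous G -> ccont (fun x => (G x)%:C).
Proof. by move=> cG; split=> [|x]; [exact: cG|exact: cvg_cst]. Qed.

Lemma ccont_id : ccont (fun x => x%:C).
Proof. by apply: ccont_real => x; exact: cvg_id. Qed.

Lemma ccontD f g : ccont f -> ccont g -> ccont (fun x => f x + g x).
Proof.
move=> [f1 f2] [g1 g2]; split.
  rewrite (_ : _ \o _ = (cRe \o f) \+ (cRe \o g)); last first.
    by apply/funext => t /=; rewrite cReD.
  by move=> x; apply: cvgD; [exact: f1|exact: g1].
rewrite (_ : _ \o _ = (cIm \o f) \+ (cIm \o g)); last first.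
  by apply/funext => t /=; rewrite cImD.
by move=> x; apply: cvgD; [exact: f2|exact: g2].
Qed.

Lemma ccontM f g : ccont f -> ccont g -> ccont (fun x => f x * g x).
Proof.
move=> [f1 f2] [g1 g2]; split.
  rewrite (_ : _ \o _ = (cRe \o f) \* (cRe \o g) \- (cIm \o f) \* (cIm \o g)); last first.
    by apply/funext => t /=; rewrite cReM.
  move=> x; apply: cvgB; apply: cvgM;
    by [exact: f1|exact: g1|exact: f2|exact: g2].
rewrite (_ : _ \o _ = (cRe \o f) \* (cIm \o g) \+ (cIm \o f) \* (cRe \o g)); last first.
  by apply/funext => t /=; rewrite cImM.
move=> x; apply: cvgD; apply: cvgM;
  by [exact: f1|exact: g1|exact: f2|exact: g2].
Qed.

Lemma ccontN f : ccont f -> ccont (fun x => - f x).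
Proof. by move=> /(ccontM (ccont_cst (-1))); under eq_fun do rewrite mulN1r. Qed.

Lemma ccont_cxp f : ccont f -> ccont (fun x => cxp (f x)).
Proof.
move=> [f1 f2]; split.
  rewrite (_ : _ \o _ = (expR \o (cRe \o f)) \* (cos \o (cIm \o f))).
    move=> x; apply: cvgM; apply: continuous_comp;
    by [exact: f1|exact: continuous_expR|exact: f2|exact: continuous_cos].
  by apply/funext => t; exact: Re_cxp.
rewrite (_ : _ \o _ = (expR \o (cRe \o f)) \* (sin \o (cIm \o f))).
  move=> x; apply: cvgM; apply: continuous_comp;
    by [exact: f1|exact: continuous_expR|exact: f2|exact: continuous_sin].
by apply/funext => t; exact: Im_cxp.
Qed.

Lemma cint_affine f (a b : R) : 0 < a -> ccont f -> cint mu setT f ->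
  cint mu setT (fun x => a%:C * f (a * x + b)) /\
  cI mu setT (fun x => a%:C * f (a * x + b)) = cI mu setT f.
Proof.
move=> a0 [cr ci] [ir ii].
have [j1 e1] := Rint_affine b a0 cr ir; have [j2 e2] := Rint_affine b a0 ci ii.
split.
  split.
    by rewrite (_ : _ \o _ = fun x => a * (cRe \o f) (a * x + b))//;
      apply/funext => x; exact: Re_realM.
  by rewrite (_ : _ \o _ = fun x => a * (cIm \o f) (a * x + b))//;
    apply/funext => x; exact: Im_realM.
apply: complex_eqP => /=.
  by rewrite -e1; apply: eq_Rintegral => x _; exact: Re_realM.
by rewrite -e2; apply: eq_Rintegral => x _; exact: Im_realM.
Qed.

Lemma cI_shift f (b : R) : ccont f -> cint mu setT f ->
  cI mu setT (fun x => f (x + b)) = cI mu setT f.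
Proof.
move=> cf jf; have [_ <-] := cint_affine b ltr01 cf jf.
by apply: eq_cI => x _; rewrite !mul1r.
Qed.

Lemma ccont_cI d (T : measurableType d) (m : {measure set T -> \bar R})
    (f : R -> T -> R[i]) (G : T -> R) :
  (forall x, cmeas setT (f x)) -> (forall t, ccont (f ^~ t)) ->
  rint m setT G -> (forall x t, nc (f x t) <= G t) ->
  ccont (fun x => cI m setT (f x)).
Proof.
move=> mf cf iG fG.
have jf x : cint m setT (f x).
  by apply: (@cint_dom _ _ _ _ _ _ _ G) => // t _; exact: fG.
have inT (x : R) : x \in `](x - 1), (x + 1)[%classic.
  by rewrite inE/= in_itv/= ltrBlDr ltrDl ltr01.
split=> x.
  apply: (@continuity_under_integral _ _ _ _ (fun x t => cRe (f x t)) setT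
    measurableT (x - 1) (x + 1) _ _ G) => //.
  - by move=> y _; case: (jf y).
  - by apply: aeW => t _ y _; exact: (cf t).1.
  - by move=> y _; apply: aeW => t _; exact: le_trans (nc_Re _) (fG _ _).
apply: (@continuity_under_integral _ _ _ _ (fun x t => cIm (f x t)) setT
    measurableT (x - 1) (x + 1) _ _ G) => //.
- by move=> y _; case: (jf y).
- by apply: aeW => t _ y _; exact: (cf t).2.
- by move=> y _; apply: aeW => t _; exact: le_trans (nc_Im _) (fG _ _).
Qed.

Lemma cCaratheodory d (T : measurableType d) (f : R -> T -> R[i]) :
  (forall t, ccont (f ^~ t)) -> (forall x, cmeas setT (f x)) ->
  cmeas setT (fun p : R * T => f p.1 p.2).
Proof.
move=> cf mf; split.
  apply: (@Caratheodory_measurable _ _ _ (fun x t => cRe (f x t))).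
    by move=> t; exact: (cf t).1.
  by move=> x; exact: (mf x).1.
apply: (@Caratheodory_measurable _ _ _ (fun x t => cIm (f x t))).
  by move=> t; exact: (cf t).2.
by move=> x; exact: (mf x).2.
Qed.

End RealLine.

Lemma nested_intervals (R : realType) (u v : nat -> R) :
  (forall n, u n <= u n.+1) -> (forall n, v n.+1 <= v n) ->
  (forall n, u n <= v n) -> exists x, forall n, u n <= x <= v n.
Proof.
move=> /nondecreasing_seqP un /nonincreasing_seqP vn uv.
have uvmn m n : u m <= v n.
  apply: le_trans (un _ _ (leq_maxl m n)) _; apply: le_trans (uv _) _.
  by apply: vn; exact: leq_maxr.
have ne : (range u) !=set0 by exists (u 0%N), 0%N.
have ub : has_ubound (range u) by exists (v 0%N) => _ [m _ <-].
exists (sup (range u)) => n; apply/andP; split.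
  by apply: ub_le_sup => //; exists n.
by apply: ge_sup => // _ [m _ <-].
Qed.

(** * Goursat's theorem and contour shifts *)

Section Goursat.
Context {R : realType}.
Notation mu := (@lebesgue_measure R).
Implicit Types (f g : R[i] -> R[i]) (z w : R[i]) (a b c d x y m : R).

(** Complex differentiability phrased with real-valued moduli, so that all estimates are
    inequalities in R. *)
Definition cdiff f z := exists l : R[i], forall e : R, 0 < e ->
  exists2 r : R, 0 < r & forall h, nc h < r -> nc (f (z + h) - f z - l * h) <= e * nc h.

Lemma cdiff_continuous f z : cdiff f z -> forall e : R, 0 < e ->
  exists2 r : R, 0 < r & forall h, nc h < r -> nc (f (z + h) - f z) < e.
Proof.
move=> [l fl] e e0; have [r r0 hr] := fl 1 ltr01.
have s0 : 0 < e / (nc l + 2) by rewrite divr_gt0// ltr_wpDl// nc_ge0.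
exists (Num.min r (e / (nc l + 2))); first by rewrite lt_min r0.
move=> h; rewrite lt_min => /andP[/hr hr1].
rewrite ltr_pdivlMr ?ltr_wpDl ?nc_ge0// => he.
rewrite -[f _ - _](subrK (l * h)); apply: le_lt_trans (ncD _ _) _.
rewrite ncM; have := nc_ge0 h; have := nc_ge0 l; nra.
Qed.

Lemma ccont_line f z w : (forall z, cdiff f z) -> ccont (fun t => f (z + t%:C * w)).
Proof.
move=> df.
have H (t : R) (e : R) : 0 < e -> \forall s \near t, nc (f (z + t%:C * w) - f (z + s%:C * w)) < e.
  move=> e0; have [r r0 hr] := cdiff_continuous (df (z + t%:C * w)) e0.
  have r'0 : 0 < r / (nc w + 1) by rewrite divr_gt0// ltr_wpDl// nc_ge0.
  near=> s.
  rewrite -ncN opprB (_ : z + s%:C * w = z + t%:C * w + (s - t)%:C * w); last first.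
    by rewrite rmorphB/=; ring.
  apply: hr; rewrite ncM nc_real.
  have : `|s - t| < r / (nc w + 1).
    by near: s; have := @nbhsx_ballx R R t _ r'0;
      apply: filterS => u; rewrite /ball/= distrC.
  rewrite ltr_pdivlMr ?ltr_wpDl ?nc_ge0//; have := nc_ge0 w; have := normr_ge0 (s - t); nra.
split=> t; apply/cvgrPdist_lt => e e0; apply: filterS (H t e e0) => s.
  by apply: le_lt_trans; rewrite -cReN -cReD; exact: nc_Re.
by apply: le_lt_trans; rewrite -cImN -cImD; exact: nc_Im.
Unshelve. all: by end_near. Qed.

Lemma ccont_hor f y : (forall z, cdiff f z) -> ccont (fun x => f (x +i* y)).
Proof.
move=> /(ccont_line (0 +i* y) 1); congr ccont; apply/funext => x; congr f.
by apply: complex_eqP; rewrite !cE/=; ring.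
Qed.

Lemma ccont_ver f x : (forall z, cdiff f z) -> ccont (fun y => f (x +i* y)).
Proof.
move=> /(ccont_line (x +i* 0) 'i); congr ccont; apply/funext => y; congr f.
by apply: complex_eqP; rewrite !cE/=; ring.
Qed.

Definition Iseg (h : R -> R[i]) a b := cI mu `[a, b]%classic h.

Lemma cint_itv (h : R -> R[i]) a b : ccont h -> cint mu `[a, b]%classic h.
Proof.
move=> [hr hi]; split; apply: continuous_compact_integrable;
  by [exact: segment_compact|exact: continuous_subspaceT].
Qed.

Lemma Iseg_split (h : R -> R[i]) a m b : ccont h -> a <= m -> m <= b ->
  Iseg h a b = Iseg h a m + Iseg h m b.
Proof.
move=> ch am mb; have [hr hi] := cint_itv a b ch.
have H (G : R -> R) : rint mu `[a, b]%classic G ->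
    \int[mu]_(t in `[a, b]%classic) G t =
    \int[mu]_(t in `[a, m]%classic) G t + \int[mu]_(t in `[m, b]%classic) G t.
  move=> iG; have := Rintegral_itvB iG (_ : BLeft a <= BRight m)%O (_ : BRight m <= BRight b)%O.
  rewrite !bnd_simp => /(_ am mb) e.
  rewrite -(@Rintegral_itv_obnd_cbnd _ m (BRight b)).
    by rewrite -e addrC subrK.
  apply: integrableS iG => //; exact: subset_itvScc.
by rewrite /Iseg /cI !H.
Qed.

Lemma Iseg_le (h : R -> R[i]) a b (M : R) : ccont h -> a <= b ->
  (forall x, a <= x <= b -> nc (h x) <= M) -> nc (Iseg h a b) <= M * (b - a).
Proof.
move=> ch ab hM.
have -> : M * (b - a) = \int[mu]_(x in `[a, b]%classic) M.
  rewrite -[b - a]/(fine (b - a)%:E).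
  rewrite Rintegral_cst//; congr (_ * fine _); rewrite [RHS]lebesgue_measure_itv/= lte_fin.
  by case: ltgtP ab => //= ->; rewrite subrr.
apply: le_cI => //.
- exact: cint_itv.
- apply: (@continuous_compact_integrable _ (fun=> M)); first exact: segment_compact.
  by apply: continuous_subspaceT => x; exact: cvg_cst.
Qed.

Lemma ccont_affine (u v : R[i]) : ccont (fun t => u + v * t%:C).
Proof.
apply: ccontD; first exact: ccont_cst.
by apply: ccontM; [exact: ccont_cst|exact: ccont_id].
Qed.

Lemma Iseg_affine (u v : R[i]) a b : a <= b ->
  Iseg (fun t => u + v * t%:C) a b = (u + v * ((a + b) / 2)%:C) * (b - a)%:C.
Proof.
rewrite le_eqVlt => /orP[/eqP <-|ab].
  by rewrite subrr mulr0 /Iseg set_itv1 /cI !Rintegral_set1.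
have H (r s : R) : \int[mu]_(t in `[a, b]%classic) (r + s * t) =
    (r + s * ((a + b) / 2)) * (b - a).
  rewrite /Rintegral (@continuous_FTC2 _ _ (fun t => r * t + s / 2 * t ^+ 2))//=.
  - by field.
  - apply: continuous_subspaceT => t.
    by apply: cvgD; [exact: cvg_cst|apply: cvgM => //; exact: cvg_cst].
  - have cF : continuous (fun t : R => r * t + s / 2 * t ^+ 2).
      move=> t; apply: cvgD; apply: cvgM; try exact: cvg_cst; first exact: cvg_id.
      exact: exprn_continuous.
    split; [by move=> x _; apply: ex_derive| |].
      by apply: cvg_at_right_filter; exact: cF.
    by apply: cvg_at_left_filter; exact: cF.
  - move=> x _; rewrite derive1E derive_val /GRing.scale/=; field.
  by [].
apply: complex_eqP; rewrite !cE/=.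
  rewrite -[RHS]/((cRe u + (cRe v * ((a + b) / 2) - cIm v * 0)) * (b - a) - _).
  rewrite !mulr0 !subr0 -H; apply: eq_Rintegral => t _.
  by rewrite !cE/= mulr0 subr0.
rewrite !mulr0 !add0r -H; apply: eq_Rintegral => t _.
by rewrite !cE/= mulr0 add0r.
Qed.

Section Rectangle.
Variable f : R[i] -> R[i].
Hypothesis df : forall z, cdiff f z.

Let Hor (y a b : R) := Iseg (fun x => f (x +i* y)) a b.
Let Ver (x c d : R) := Iseg (fun y => f (x +i* y)) c d.
(** The counterclockwise contour integral along the rectangle [a, b] x [c, d], encoded as ((a, b),
    (c, d)): bottom minus top, plus i times right minus left. *)
Definition boundary_integral (r : (R * R) * (R * R)) : R[i] :=
  Hor r.2.1 r.1.1 r.1.2 - Hor r.2.2 r.1.1 r.1.2 +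
  'i * (Ver r.1.2 r.2.1 r.2.2 - Ver r.1.1 r.2.1 r.2.2).
Let B a b c d := boundary_integral ((a, b), (c, d)).

Let B_split1 a m b c d : a <= m -> m <= b -> B a b c d = B a m c d + B m b c d.
Proof.
move=> am mb; rewrite /B /boundary_integral/= /Hor !(Iseg_split _ am mb); first by ring.
  exact: ccont_hor.
exact: ccont_hor.
Qed.

Let B_split2 a b c m d : c <= m -> m <= d -> B a b c d = B a b c m + B a b m d.
Proof.
move=> am mb; rewrite /B /boundary_integral/= /Ver !(Iseg_split _ am mb); first by ring.
  exact: ccont_ver.
exact: ccont_ver.
Qed.

(** Affine functions have zero boundary integral, so only the deviation of f from u + v z counts;
    the bound is M times the perimeter. *)
Let B_bound a b c d (u v : R[i]) M : a <= b -> c <= d ->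
  (forall x y, a <= x <= b -> c <= y <= d ->
     nc (f (x +i* y) - (u + v * (x +i* y))) <= M) ->
  nc (B a b c d) <= 2 * M * ((b - a) + (d - c)).
Proof.
move=> ab cd fM.
pose eH y x := f (x +i* y) - ((u + v * (0 +i* y)) + v * x%:C).
pose eV x y := f (x +i* y) - ((u + v * x%:C) + (v * 'i) * y%:C).
have ceH y : ccont (eH y).
  by apply: ccontD; [exact: ccont_hor|apply: ccontN; exact: ccont_affine].
have ceV x : ccont (eV x).
  by apply: ccontD; [exact: ccont_ver|apply: ccontN; exact: ccont_affine].
have HE y : Hor y a b = Iseg (eH y) a b +
    (u + v * (0 +i* y) + v * ((a + b) / 2)%:C) * (b - a)%:C.
  rewrite -Iseg_affine// -cID//; [|exact: cint_itv|exact/cint_itv/ccont_affine].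
  by apply: eq_cI => x _; rewrite /eH subrK.
have VE x : Ver x c d = Iseg (eV x) c d +
    (u + v * x%:C + v * 'i * ((c + d) / 2)%:C) * (d - c)%:C.
  rewrite -Iseg_affine// -cID//; [|exact: cint_itv|exact/cint_itv/ccont_affine].
  by apply: eq_cI => y _; rewrite /eV subrK.
have -> : B a b c d = Iseg (eH c) a b - Iseg (eH d) a b +
    'i * (Iseg (eV b) c d - Iseg (eV a) c d).
  rewrite /B /boundary_integral/= !HE !VE; apply/eqP; rewrite -subr_eq0; apply/eqP.
  transitivity ((v * (0 +i* c) - v * (0 +i* d)) * (b - a)%:C +
     'i * (v * b%:C - v * a%:C) * (d - c)%:C); first by ring.
  by apply: complex_eqP; rewrite !cE/=; ring.
have Hb y : c <= y <= d -> nc (Iseg (eH y) a b) <= M * (b - a).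
  move=> yc; apply: Iseg_le => // x xab; rewrite /eH.
  rewrite (_ : _ + _ + _ = u + v * (x +i* y)); first exact: fM.
  by apply: complex_eqP; rewrite !cE/=; ring.
have Vb x : a <= x <= b -> nc (Iseg (eV x) c d) <= M * (d - c).
  move=> yc; apply: Iseg_le => // y xab; rewrite /eV.
  rewrite (_ : _ + _ + _ = u + v * (x +i* y)); first exact: fM.
  by apply: complex_eqP; rewrite !cE/=; ring.
have h1 : nc (Iseg (eH c) a b) <= M * (b - a) by apply: Hb; rewrite lexx.
have h2 : nc (Iseg (eH d) a b) <= M * (b - a) by apply: Hb; rewrite lexx cd.
have h3 : nc (Iseg (eV b) c d) <= M * (d - c) by apply: Vb; rewrite lexx ab.
have h4 : nc (Iseg (eV a) c d) <= M * (d - c) by apply: Vb; rewrite lexx ab.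
apply: le_trans (ncD _ _) _; rewrite ncM nc_i mul1r.
have := ncB (Iseg (eH c) a b) (Iseg (eH d) a b).
have := ncB (Iseg (eV b) c d) (Iseg (eV a) c d).
lra.
Qed.

Let quarter (r : (R * R) * (R * R)) (s : bool * bool) : (R * R) * (R * R) :=
  let: ((a, b), (c, d)) := r in
  ((if s.1 then ((a + b) / 2, b) else (a, (a + b) / 2)),
   (if s.2 then ((c + d) / 2, d) else (c, (c + d) / 2))).

Let rect_ok (r : (R * R) * (R * R)) := (r.1.1 <= r.1.2) && (r.2.1 <= r.2.2).

(** The boundary integrals of the four quarters add up to that of the rectangle, so they cannot all
    be smaller than a fourth of it. *)
Let quarterP r : rect_ok r -> exists s,
  nc (boundary_integral r) <= 4 * nc (boundary_integral (quarter r s)).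
Proof.
case: r => -[a b] [c d]; rewrite /rect_ok/= => /andP[ab cd].
apply: contrapT => /forallNP N.
have {}N s : 4 * nc (boundary_integral (quarter (a, b, (c, d)) s)) < nc (B a b c d).
  by rewrite ltNge; apply/negP; exact: N.
have := N (false, false); have := N (false, true).
have := N (true, false); have := N (true, true).
rewrite /quarter/= -/(B _ _ _ _) -/(B _ _ _ _) -/(B _ _ _ _) -/(B _ _ _ _).
have h1 : a <= (a + b) / 2 by lra.
have h2 : (a + b) / 2 <= b by lra.
have h3 : c <= (c + d) / 2 by lra.
have h4 : (c + d) / 2 <= d by lra.
have := B_split1 c d h1 h2.
rewrite (B_split2 a ((a + b) / 2) h3 h4) (B_split2 ((a + b) / 2) b h3 h4) => ->.
set B1 := B _ _ _ _; set B2 := B _ _ _ _; set B3 := B _ _ _ _; set B4 := B _ _ _ _.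
have := ncD (B2 + B3) (B4 + B1); have := ncD B2 B3; have := ncD B4 B1.
lra.
Qed.

Lemma Goursat a b c d : a <= b -> c <= d -> boundary_integral ((a, b), (c, d)) = 0.
Proof.
move=> ab cd.
(* The guard sits inside the existential so that [choice] returns a quarter for every pair of
   intervals; (true, true) is a filler where [rect_ok] fails. *)
have next (r : (R * R) * (R * R)) : exists s, rect_ok r ->
    nc (boundary_integral r) <= 4 * nc (boundary_integral (quarter r s)).
  by have [/quarterP[s hs]|] := boolP (rect_ok r); [exists s|exists (true, true)].
have qok r s : rect_ok r -> rect_ok (quarter r s).
  case: r => -[a' b'] [c' d']; rewrite /rect_ok/= => /andP[h1 h2].
  by case: s => -[] []/=; apply/andP; split; lra.
have [F FP] := choice next.
pose r n := iter n (fun r => quarter r (F r)) ((a, b), (c, d)).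
have rS n : r n.+1 = quarter (r n) (F (r n)) by [].
have okr n : rect_ok (r n).
  by elim: n => [|n IH]; [rewrite /rect_ok/= ab cd|rewrite rS; exact: qok].
have rB n : nc (boundary_integral (r n)) <= 4 * nc (boundary_integral (r n.+1)).
  by rewrite rS; exact: FP.
have rok n : (r n).1.1 <= (r n).1.2 /\ (r n).2.1 <= (r n).2.2.
  by apply/andP; exact: okr.
have [x xP] : exists x, forall n, (r n).1.1 <= x <= (r n).1.2.
  apply: nested_intervals => n; last exact: (rok n).1.
    rewrite rS; have := (rok n).1; case: (r n) (F _) => -[a' b'] [c' d'] [[] []]/=; lra.
  rewrite rS; have := (rok n).1; case: (r n) (F _) => -[a' b'] [c' d'] [[] []]/=; lra.
have [y yP] : exists y, forall n, (r n).2.1 <= y <= (r n).2.2.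
  apply: nested_intervals => n; last exact: (rok n).2.
    rewrite rS; have := (rok n).2; case: (r n) (F _) => -[a' b'] [c' d'] [[] []]/=; lra.
  rewrite rS; have := (rok n).2; case: (r n) (F _) => -[a' b'] [c' d'] [[] []]/=; lra.
pose D := (b - a) + (d - c).
have D0 : 0 <= D by rewrite /D; lra.
have rD n : ((r n).1.2 - (r n).1.1) + ((r n).2.2 - (r n).2.1) = D / 2 ^+ n.
  elim: n => [|n IH]; first by rewrite expr0 divr1.
  rewrite exprS invfM mulrCA -IH rS; case: (r n) (F _) => -[a' b'] [c' d'] [[] []]/=; by field.
have rBn n : nc (B a b c d) <= 4 ^+ n * nc (boundary_integral (r n)).
  elim: n => [|n IH]; first by rewrite expr0 mul1r.
  apply: le_trans IH _; rewrite exprSr -mulrA ler_pM2l ?exprn_gt0//.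
have [l lP] := df (x +i* y).
apply/eqP; rewrite -nc_eq0 eq_le nc_ge0 andbT.
apply/ler_addgt0Pr => e e0; rewrite add0r.
(* The factor 4^n lost in n subdivisions cancels the square of the size D / 2^n, so 2 D^2 e' <= e is
   enough at every depth; the added 1 covers D = 0. *)
pose e' := e / (2 * D ^+ 2 + 1).
have e'0 : 0 < e' by rewrite divr_gt0// ltr_wpDl// mulr_ge0// sqr_ge0.
have [dl dl0 hdl] := lP e' e'0.
have [n nP] : exists n, D / 2 ^+ n < dl.
  have /cvgrPdist_lt/(_ _ dl0)[n _ /(_ n (leqnn n))] : (fun n => D * (2^-1) ^+ n) @ \oo --> (0 : R).
    by apply: cvg_geometric; rewrite ger0_norm; lra.
  rewrite sub0r normrN => h; exists n; apply: le_lt_trans h.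
  by rewrite exprVn ler_norm.
set Dn := D / 2 ^+ n in nP.
(* On the n-th rectangle f differs from its affine approximation at the limit point by at most e'
   times the half-perimeter Dn. *)
have bnd : nc (boundary_integral (r n)) <= 2 * (e' * Dn) * Dn.
  have {}rD := rD n; rewrite -/Dn in rD.
  have := xP n; have := yP n; have := rok n; move: rD.
  case: (r n) => -[a' b'] [c' d']/= rD [h1 h2] /andP[h3 h4] /andP[h5 h6].
  rewrite -[X in _ <= _ * X]rD; apply: (@B_bound _ _ _ _ (f (x +i* y) - l * (x +i* y)) l) => // x' y' /andP[h7 h8] /andP[h9 h10].
  have -> : f (x' +i* y') - (f (x +i* y) - l * (x +i* y) + l * (x' +i* y')) =
     f (x +i* y + ((x' - x) +i* (y' - y))) - f (x +i* y) - l * ((x' - x) +i* (y' - y)).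
    rewrite (_ : x +i* y + ((x' - x) +i* (y' - y)) = x' +i* y'); last first.
      by apply: complex_eqP; rewrite !cE/=; ring.
    rewrite (_ : (x' - x) +i* (y' - y) = (x' +i* y') - (x +i* y)); last first.
      by apply: complex_eqP; rewrite !cE.
    by ring.
  have hle : nc ((x' - x) +i* (y' - y)) <= b' - a' + (d' - c').
    by apply: le_trans (nc_le _) _; rewrite /= lerD// ler_distl; apply/andP; split; lra.
  apply: le_trans (hdl _ _) _.
    by apply: le_lt_trans hle _; rewrite rD.
  by rewrite ler_pM2l// -rD.
apply: le_trans (rBn n) _; apply: le_trans (_ : 4 ^+ n * (2 * (e' * Dn) * Dn) <= e).
  by rewrite ler_pM2l// exprn_gt0.
have -> : 4 ^+ n * (2 * (e' * Dn) * Dn) = 2 * D ^+ 2 * e'.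
  rewrite /Dn (_ : 4 = 2 ^+ 2 :> R); last by ring.
  rewrite -exprM mulnC exprM; have : (2 ^+ n : R) != 0 by rewrite expf_neq0.
  by move: (2 ^+ n : R) => N N0; field.
rewrite /e' mulrCA -[leRHS]mulr1 ler_pM2l// ler_pdivrMr ?ltr_wpDl ?mulr_ge0 ?sqr_ge0//.
by rewrite mul1r lerDl.
Qed.

End Rectangle.
End Goursat.

Section CDiff.
Context {R : realType}.
Implicit Types (f g : R[i] -> R[i]) (z w h l m u v : R[i]) (e r : R).

Lemma cdiff_affine u v z : cdiff (fun z => u + v * z) z.
Proof.
exists v => e e0; exists 1 => // h _.
rewrite (_ : _ - _ - _ = 0); last by ring.
by rewrite nc0 mulr_ge0 ?nc_ge0// ltW.
Qed.

Lemma cxp_quad h : nc (cxp h - 1 - h) <= nc h ^+ 2 * expR `|cRe h|.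
Proof.
have := cxp_poly_bound 2 h.
rewrite /cxp_poly !big_ord_recl big_ord0 /bump/= fact0 invr1 expr0 expr1 addr0.
rewrite mul1r mul1r opprD addrA => /le_trans; apply.
rewrite ler_wpM2r ?expR_ge0// ler_pdivrMr// ler_peMr ?exprn_ge0 ?nc_ge0//.
by rewrite (_ : 2`! = 2)// ler1n.
Qed.

Lemma cdiff_cxp z : cdiff cxp z.
Proof.
exists (cxp z) => e e0.
have p0 : 0 < expR 1 * nc (cxp z) :> R by rewrite mulr_gt0 ?expR_gt0// nc_gt0 cxp_neq0.
exists (Num.min 1 (e / (expR 1 * nc (cxp z)))); first by rewrite lt_min ltr01 divr_gt0.
move=> h; rewrite lt_min => /andP[h1]; rewrite ltr_pdivlMr// => h2.
rewrite cxpD (_ : _ - _ - _ = cxp z * (cxp h - 1 - h)); last by ring.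
rewrite ncM; apply: (@le_trans _ _ (nc (cxp z) * (nc h ^+ 2 * expR 1))).
  rewrite ler_wpM2l ?nc_ge0//; apply: le_trans (cxp_quad h) _.
  rewrite ler_wpM2l ?exprn_ge0 ?nc_ge0// ler_expR.
  exact: le_trans (nc_Re _) (ltW h1).
rewrite (_ : _ * _ = nc h * (expR 1 * nc (cxp z)) * nc h); last by ring.
by rewrite ler_wpM2r ?nc_ge0// ltW.
Qed.

Lemma cdiffM f g z : cdiff f z -> cdiff g z -> cdiff (fun z => f z * g z) z.
Proof.
move=> df dg; have cg := cdiff_continuous dg; move: df dg => [l fl] [m gm].
exists (l * g z + f z * m) => e e0.
pose A := nc (g z) + 1 + nc l + nc (f z).
have := nc_ge0 (g z); have := nc_ge0 l; have := nc_ge0 (f z) => Pf Pl Pg.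
have A0 : 0 < A by rewrite /A; lra.
have eA : 0 < e / A by rewrite divr_gt0.
have m0 : 0 < Num.min 1 (e / A) by rewrite lt_min ltr01.
have [r1 r10 H1] := fl _ eA; have [r2 r20 H2] := gm _ eA; have [r3 r30 H3] := cg _ m0.
exists (Num.min r1 (Num.min r2 r3)); first by rewrite !lt_min r10 r20.
move=> h; rewrite !lt_min => /and3P[/H1{}H1 /H2{}H2 /H3{}H3].
move: H3; rewrite lt_min => /andP[H3 H4].
have -> : f (z + h) * g (z + h) - f z * g z - (l * g z + f z * m) * h =
  (f (z + h) - f z - l * h) * g (z + h) + (l * h) * (g (z + h) - g z) +
  f z * (g (z + h) - g z - m * h) by ring.
apply: le_trans (ncD _ _) _; apply: le_trans (lerD (ncD _ _) (lexx _)) _; rewrite !ncM.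
have Hg : nc (g (z + h)) <= nc (g z) + 1.
  by have := ncB_ge (g (z + h)) (g z); lra.
rewrite -[in leRHS](divfK (lt0r_neq0 A0) e).
set c := e / A in eA H1 H2 H4 *.
have h0 := nc_ge0 h.
have t1 : nc (f (z + h) - f z - l * h) * nc (g (z + h)) <= c * nc h * (nc (g z) + 1).
  by apply: ler_pM; rewrite ?nc_ge0.
have t2 : nc l * nc h * nc (g (z + h) - g z) <= nc l * nc h * c.
  by rewrite ler_wpM2l ?mulr_ge0// ltW.
have t3 : nc (f z) * nc (g (z + h) - g z - m * h) <= nc (f z) * (c * nc h).
  by rewrite ler_wpM2l.
rewrite /A; lra.
Qed.

Lemma cdiff_comp f g z : cdiff f (g z) -> cdiff g z -> cdiff (fun z => f (g z)) z.
Proof.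
move=> [l fl] [m gm]; exists (l * m) => e e0.
have Pl := nc_ge0 l; have Pm := nc_ge0 m.
pose e2 := Num.min 1 (e / (2 * (nc l + 1))).
have e20 : 0 < e2 by rewrite lt_min ltr01 divr_gt0// mulr_gt0// ltr_wpDl.
pose e1 := e / (2 * (nc m + 1)).
have e10 : 0 < e1 by rewrite divr_gt0// mulr_gt0// ltr_wpDl.
have [r1 r10 H1] := fl _ e10; have [r2 r20 H2] := gm _ e20.
exists (Num.min r2 (r1 / (nc m + 1))); first by rewrite lt_min r20 divr_gt0// ltr_wpDl.
move=> h; rewrite lt_min => /andP[/H2{}H2]; rewrite ltr_pdivlMr ?ltr_wpDl// => hr.
have h0 := nc_ge0 h.
set k := g (z + h) - g z in H2.
have kE : g (z + h) = g z + k by rewrite /k; ring.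
have e21 : e2 <= 1 by rewrite ge_min lexx.
have kle : nc k <= (nc m + 1) * nc h.
  by have := ncB_ge k (m * h); rewrite ncM; nra.
have {H1}H1 : nc (f (g z + k) - f (g z) - l * k) <= e1 * nc k.
  by apply: H1; apply: le_lt_trans kle _; rewrite mulrC.
rewrite kE (_ : _ - _ - _ = (f (g z + k) - f (g z) - l * k) + l * (k - m * h)); last by ring.
apply: le_trans (ncD _ _) _; rewrite ncM.
have t1 : nc (f (g z + k) - f (g z) - l * k) <= e / 2 * nc h.
  apply: le_trans H1 _; apply: le_trans (ler_wpM2l (ltW e10) kle) _.
  by rewrite /e1 invfM mulrA mulrA [e / 2 / _ * _]mulfVK ?gt_eqF// ltr_wpDl.
have t2 : nc l * nc (k - m * h) <= e / 2 * nc h.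
  have H3 : e2 * (2 * (nc l + 1)) <= e.
    by rewrite -ler_pdivlMr ?mulr_gt0 ?ltr_wpDl// ge_min lexx orbT.
  have := ler_wpM2l Pl H2; have : 0 <= e2 * nc h by rewrite mulr_ge0// ltW.
  have := ler_wpM2r h0 H3; nra.
lra.
Qed.

End CDiff.

Section Contour.
Context {R : realType}.
Notation mu := (@lebesgue_measure R).
Implicit Types (f : R[i] -> R[i]) (K Y x y : R).

Lemma ccvg_unique_close (u v : nat -> R[i]) l m (e : nat -> R) :
  ccvg u l -> ccvg v m -> (forall n, nc (u n - v n) <= e n) ->
  e @ \oo --> 0 -> l = m.
Proof.
move=> [u1 u2] [v1 v2] uv e0; apply: complex_eqP; apply/eqP; rewrite -subr_eq0; apply/eqP.
  have c1 : (fun n => cRe (u n) - cRe (v n)) @ \oo --> (0 : R).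
    apply/norm_cvg0P; apply: squeeze_cvgr (cvg_cst 0) e0.
    by apply: nearW => n; rewrite normr_ge0 -cReN -cReD (le_trans (nc_Re _)).
  exact: (cvg_unique (@norm_hausdorff _ _) (cvgB u1 v1) c1).
have c1 : (fun n => cIm (u n) - cIm (v n)) @ \oo --> (0 : R).
  apply/norm_cvg0P; apply: squeeze_cvgr (cvg_cst 0) e0.
  by apply: nearW => n; rewrite normr_ge0 -cImN -cImD (le_trans (nc_Im _)).
exact: (cvg_unique (@norm_hausdorff _ _) (cvgB u2 v2) c1).
Qed.

Lemma Iseg_cvg (h : R -> R[i]) : ccont h -> cint mu setT h ->
  ccvg (fun n => Iseg h (- n%:R) n%:R) (cI mu setT h).
Proof.
move=> ch ih.
pose f_ n x := (\1_(`[- (n%:R : R), n%:R]%classic) x)%:C * h x.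
have e n : Iseg h (- n%:R) n%:R = cI mu setT (f_ n).
  have H (p : R[i] -> R) : (forall (a : R) z, p (a%:C * z) = a * p z) ->
      \int[mu]_(x in `[- (n%:R : R), n%:R]%classic) p (h x) = \int[mu]_x p (f_ n x).
    move=> pM; rewrite Rintegral_mkcond; apply: eq_Rintegral => x _.
    rewrite /f_ pM /patch indicE; case: ifPn => _; first by rewrite mul1r.
    by rewrite mul0r.
  by rewrite /Iseg /cI; congr (_ +i* _); apply: H => a z; [exact: Re_realM|exact: Im_realM].
under eq_fun do rewrite e.
apply: (proj2 (A := cint mu setT h)); apply: (@cDCT _ _ _ mu setT f_ h (fun x => nc (h x)) measurableT).
- by move=> n; apply: cmeasM; [apply: cmeas_real|exact: ccont_meas].
- exact: ccont_meas.
- move=> x _; have H (p : R[i] -> R) : (forall (a : R) z, p (a%:C * z) = a * p z) ->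
      (fun n => p (f_ n x)) @ \oo --> p (h x).
    move=> pM; apply: cvg_near_cst.
    apply: filterS (nbhs_infty_ger (`|x| : R)) => n xn.
    rewrite /f_ pM indicE mem_set ?mul1r//= in_itv/=.
    by rewrite -ler_norml.
  by split; apply: H => a z; [exact: Re_realM|exact: Im_realM].
- exact: cint_nc.
- move=> n x _; rewrite /f_ ncM nc_real indicE.
  by case: (_ \in _); rewrite ?normr1 ?normr0 ?mul1r// mul0r nc_ge0.
Qed.

Lemma cint_ker (h : R -> R[i]) K : cmeas setT h -> (forall x, nc (h x) <= K * ker x) ->
  cint mu setT h.
Proof.
move=> mh hK; apply: (@cint_dom _ _ _ mu setT measurableT h (fun x => K * ker x)) => //.
by apply: rintZ => //; exact: rint_ker.
Qed.

(** Goursat on [-n, n] x [0, Y]: each vertical side contributes at most K * ker n * Y, which tends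
    to 0, so the two horizontal sides have the same limit. *)
Lemma contour_shift_ge0 f K Y : (forall z, cdiff f z) -> 0 <= Y ->
  (forall x y, 0 <= y <= Y -> nc (f (x +i* y)) <= K * ker x) ->
  cI mu setT (fun x => f (x +i* Y)) = cI mu setT (fun x => f (x +i* 0)).
Proof.
move=> df Y0 fK.
have i0 y : 0 <= y <= Y -> cint mu setT (fun x => f (x +i* y)).
  move=> yY; apply: (@cint_ker _ K); first exact/ccont_meas/ccont_hor.
  by move=> x; exact: fK.
apply: (ccvg_unique_close (e := fun n => 2 * (K * ker n%:R) * Y)
  (Iseg_cvg (ccont_hor Y df) (i0 Y _)) (Iseg_cvg (ccont_hor 0 df) (i0 0 _))).
- by rewrite lexx Y0.
- by rewrite lexx Y0.
- move=> n; have n0 : (- n%:R : R) <= n%:R by rewrite ge0_cp.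
  have := Goursat df n0 Y0; rewrite /boundary_integral/=.
  set H0 := Iseg _ _ _; set H1 := Iseg _ _ _; set V1 := Iseg _ _ _; set V2 := Iseg _ _ _.
  move=> e; have -> : H1 - H0 = 'i * (V1 - V2) by apply/eqP; rewrite -subr_eq0 -oppr_eq0 -e; apply/eqP; ring.
  rewrite ncM nc_i mul1r; apply: le_trans (ncB _ _) _.
  have kn : ker (- n%:R) = ker n%:R :> R by rewrite /ker sqrrN.
  have h1 : nc V1 <= K * ker n%:R * (Y - 0).
    by apply: Iseg_le => //; [exact: ccont_ver|move=> y; exact: fK].
  have h2 : nc V2 <= K * ker n%:R * (Y - 0).
    rewrite -kn; by apply: Iseg_le => //; [exact: ccont_ver|move=> y; exact: fK].
  by move: h1 h2; rewrite subr0; lra.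
- rewrite -(mul0r Y) -(mulr0 2) -(mulr0 K).
  apply: cvgMl; apply: cvgMr; apply: cvgMr.
  apply: squeeze_cvgr (cvg_cst 0) cvg_harmonic.
  apply: nearW => n; rewrite ker_ge0/= lef_pV2 ?posrE ?oneDsq_gt0//.
  by rewrite -natr1 addrC lerD2l -natrX ler_nat; case: n => // n; rewrite leq_pmulr.
Qed.

Lemma contour_shift f K Y : (forall z, cdiff f z) ->
  (forall x y, `|y| <= `|Y| -> nc (f (x +i* y)) <= K * ker x) ->
  cI mu setT (fun x => f (x +i* Y)) = cI mu setT (fun x => f (x +i* 0)).
Proof.
move=> df fK; have [Y0|Y0] := leP 0 Y.
  apply: (contour_shift_ge0 (K := K)) => // x y /andP[y0 yY].
  by apply: fK; rewrite !ger0_norm.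
(* A downward shift of f is the upward shift by - Y of the translate g, read backwards. *)
pose g z := f (z + (0 +i* Y)).
have dg z : cdiff g z.
  have e : g = fun z => f ((0 +i* Y) + 1 * z).
    by apply/funext => w; rewrite mul1r addrC.
  by rewrite e; apply: cdiff_comp; [exact: df|exact: cdiff_affine].
have gE x y : g (x +i* y) = f (x +i* (y + Y)).
  by congr f; apply: complex_eqP; rewrite !cE/= ?addr0.
have := @contour_shift_ge0 g K (- Y) dg.
have -> : (fun x => g (x +i* - Y)) = fun x => f (x +i* 0).
  by apply/funext => x; rewrite gE addNr.
have -> : (fun x => g (x +i* 0)) = fun x => f (x +i* Y).
  by apply/funext => x; rewrite gE add0r.
move=> -> //; first by lra.
move=> x y /andP[y0 yY]; rewrite gE; apply: fK.
by rewrite (ltr0_norm Y0) ler_norml; apply/andP; split; lra.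
Qed.

End Contour.

(** * Fourier inversion *)

Section Inversion.
Context {R : realType}.
Notation mu := (@lebesgue_measure R).
Implicit Types (f : R -> R[i]) (K x y a : R).

Lemma cmeas_comp d d' (T : measurableType d) (T' : measurableType d')
    (h : T' -> R[i]) (g : T -> T') :
  cmeas setT h -> measurable_fun setT g -> cmeas setT (fun t => h (g t)).
Proof.
by move=> [hr hi] mg; split; [exact: measurableT_comp hr mg|exact: measurableT_comp hi mg].
Qed.

Lemma continuous_affine (r s : R) : continuous (fun t : R => r + s * t).
Proof. by move=> t; apply: cvgD; [exact: cvg_cst|apply: cvgM => //; exact: cvg_cst]. Qed.

Lemma ccont_phase a : ccont (fun t : R => cxp ('i * (a * t)%:C)).
Proof.
apply: ccont_cxp; apply: ccontM; first exact: ccont_cst.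
by apply: ccont_real; move=> t; apply: cvgM => //; exact: cvg_cst.
Qed.

Lemma nc_phase (t : R) : nc (cxp ('i * t%:C)) = 1.
Proof. by rewrite nc_cxp !cE/= mul0r mulr0 subrr expR0. Qed.

Lemma nc_phaseM (t : R) (z : R[i]) : nc (cxp ('i * t%:C) * z) = nc z.
Proof. by rewrite ncM nc_phase mul1r. Qed.

Lemma expR_le_ker x : expR (- x ^+ 2) <= ker x.
Proof.
rewrite expRN /ker lef_pV2 ?posrE ?expR_gt0 ?oneDsq_gt0//.
exact: expR_ge1Dx.
Qed.

Lemma ccont_gauss a : ccont (fun t : R => (expR (- (a * t) ^+ 2))%:C).
Proof.
apply: ccont_real => t; apply: continuous_comp; last exact: continuous_expR.
apply: cvgN; apply: cvgM; by apply: cvgM => //; exact: cvg_cst.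
Qed.

Lemma gauss_shift y : cI mu setT (fun x => cxp (- (x +i* y) ^+ 2)) = (Num.sqrt pi)%:C.
Proof.
pose f (z : R[i]) : R[i] := cxp (- z ^+ 2).
have df z : cdiff f z.
  apply: (@cdiff_comp _ cxp (fun z => - z ^+ 2)); first exact: cdiff_cxp.
  have -> : (fun z : R[i] => - z ^+ 2) = (fun z => (0 + (-1) * z) * (0 + 1 * z)).
    by apply/funext => w; ring.
  by apply: cdiffM; exact: cdiff_affine.
rewrite -[LHS]/(cI mu setT (fun x => f (x +i* y))).
rewrite (contour_shift (K := expR (y ^+ 2))) //.
  have -> : Num.sqrt pi = \int[mu]_x gauss_fun x :> R.
    by rewrite /Rintegral integralT_gauss.
  rewrite -cI_real; last exact: integrableT_gauss.
  apply: eq_cI => x _; rewrite /f /gauss_fun -cxp_real; congr cxp.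
  by apply: complex_eqP; rewrite !expr2 !cE/=; ring.
move=> x' y' yy; rewrite /f nc_cxp !expr2 !cE/=.
rewrite (_ : - _ = y' ^+ 2 + - x' ^+ 2); last by ring.
rewrite expRD; apply: (ler_pM (expR_ge0 _) (expR_ge0 _) _ (expR_le_ker _)).
by rewrite ler_expR -ler_sqrt ?sqr_ge0// !sqrtr_sqr.
Qed.

(** Completing the square, - x^2 + i a x = - (x - i a/2)^2 - (a/2)^2, reduces this to [gauss_shift]
    at height - a/2. *)
Lemma gauss_fourier a :
  cI mu setT (fun x => (expR (- x ^+ 2))%:C * cxp ('i * (a * x)%:C)) =
  (Num.sqrt pi * expR (- (a / 2) ^+ 2))%:C.
Proof.
rewrite rmorphM/= -(gauss_shift (- a / 2)) mulrC -(cIZ measurableT).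
  apply: eq_cI => x _; rewrite -!cxp_real -!cxpD; congr cxp.
  by apply: complex_eqP; rewrite !expr2 !cE/=; field.
apply: (@cint_ker _ _ (expR ((- a / 2) ^+ 2))).
  apply: ccont_meas; apply: ccont_cxp; apply: ccontN.
  have c1 : ccont (fun x : R => x +i* (- a / 2)).
    by split=> t; [exact: cvg_id|exact: cvg_cst].
  by apply: ccontM.
move=> x; rewrite nc_cxp !expr2 !cE/=.
rewrite (_ : - _ = (- a / 2) ^+ 2 + - x ^+ 2); last by ring.
by rewrite expRD -expr2 ler_pM2l ?expR_gt0// expR_le_ker.
Qed.

Lemma gauss_kernel_le (e x : R) : 0 < e <= 1 -> expR (- (e * x) ^+ 2) <= e^-2 * ker x.
Proof.
move=> /andP[e0 e1]; apply: le_trans (expR_le_ker _) _.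
rewrite /ker -invfM lef_pV2 ?posrE ?oneDsq_gt0 ?mulr_gt0 ?exprn_gt0 ?oneDsq_gt0//.
by rewrite exprMn mulrDr mulr1 lerD2r exprn_ile1// ltW.
Qed.

Lemma gauss_fourier_scaled (e a : R) : 0 < e ->
  cI mu setT (fun x => (expR (- (e * x) ^+ 2))%:C * cxp ('i * (a * x)%:C)) =
  (Num.sqrt pi / e * expR (- (a / (2 * e)) ^+ 2))%:C.
Proof.
move=> e0.
pose h x := (expR (- x ^+ 2))%:C * cxp ('i * (a / e * x)%:C).
have ch : ccont h.
  apply: ccontM; last exact: ccont_phase.
  by have := ccont_gauss 1; under eq_fun do rewrite mul1r.
have ih : cint mu setT h.
  apply: (@cint_ker _ _ 1); first exact: ccont_meas.
  move=> x; rewrite nc_realM nc_phase mulr1 mul1r ger0_norm ?expR_ge0//.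
  exact: expR_le_ker.
have [i1 e1] := cint_affine 0 e0 ch ih.
have eC : e%:C != 0 by rewrite -nc_gt0 nc_real normr_gt0 gt_eqF.
apply: (mulfI eC); rewrite -cIZ//; last first.
  have := cintZ measurableT (e%:C^-1) i1; congr cint.
  apply/funext => x; rewrite mulKf// /h addr0.
  by congr (_ * cxp ('i * (_)%:C)); field; rewrite gt_eqF.
rewrite (_ : cI _ _ _ = cI mu setT h); last first.
  rewrite -e1; apply: eq_cI => x _; rewrite /h addr0.
  by congr (_ * (_ * cxp ('i * (_)%:C))); field; rewrite gt_eqF.
rewrite /h gauss_fourier -rmorphM/=; congr (_%:C).
rewrite (_ : a / e / 2 = a / (2 * e)); last by field; rewrite gt_eqF.
by field; rewrite gt_eqF.
Qed.

Lemma ccvg_uniq (u : nat -> R[i]) l m : ccvg u l -> ccvg u m -> l = m.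
Proof.
move=> h1 h2; apply: (ccvg_unique_close (e := fun=> 0) h1 h2); last exact: cvg_cst.
by move=> n; rewrite subrr nc0.
Qed.

Lemma ccvg_cont (h : R -> R[i]) (u : nat -> R) (x : R) : ccont h ->
  u @ \oo --> x -> ccvg (fun n => h (u n)) (h x).
Proof.
move=> [h1 h2] ux; split.
  exact: (@continuous_cvg _ _ _ (nbhs \oo) _ u (cRe \o h) x (h1 x) ux).
exact: (@continuous_cvg _ _ _ (nbhs \oo) _ u (cIm \o h) x (h2 x) ux).
Qed.

(** Gaussian summation: after Fubini, the damped inversion integral is a Gaussian average of f
    around x whose width tends to 0. The sign s serves both coordinates of the symplectic kernel: s
    = 1 for x1 and s = -1 for x2. *)
Theorem Fourier_inversion (s : R) f K x : s ^+ 2 = 1 -> ccont f ->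
  (forall t, nc (f t) <= K) -> cint mu setT f ->
  let F xi := cI mu setT (fun t => cxp ('i * (s * t * xi)%:C) * f t) in
  cint mu setT F ->
  cI mu setT (fun xi => cxp ('i * (- s * x * xi)%:C) * F xi) = (2 * pi)%:C * f x.
Proof.
move=> s2 cf fK jf F jF.
pose en n : R := n.+1%:R^-1.
have en01 n : 0 < en n <= 1 by rewrite invr_gt0 ltr0n/= invf_le1 ?ler1n// ltr0n.
have en0 : en @ \oo --> (0 : R) by exact: cvg_harmonic.
have ens (r t : R) : (fun n => r + en n * t) @ \oo --> r.
  rewrite -[X in _ --> X]addr0 -[X in _ + X](mul0r t).
  by apply: cvgD; [exact: cvg_cst|apply: cvgMl].
(* The damped integrals have two limits to be compared: the undamped integral ([L1]) and, in the
   form [LE], the value 2 pi f x ([L2]). *)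
pose L n := cI mu setT (fun xi => (expR (- (en n * xi) ^+ 2))%:C *
  (cxp ('i * (- s * x * xi)%:C) * F xi)).
have mP : cmeas setT (fun xi => cxp ('i * (- s * x * xi)%:C) * F xi).
  by apply: cmeasM; [exact/ccont_meas/ccont_phase|exact: cint_meas jF].
have L1 : ccvg L (cI mu setT (fun xi => cxp ('i * (- s * x * xi)%:C) * F xi)).
  apply: (proj2 (A := cint mu setT (fun xi => cxp ('i * (- s * x * xi)%:C) * F xi))).
  apply: (@cDCT _ _ _ mu setT _ _ (fun xi => nc (F xi)) measurableT) => //.
  - by move=> n; apply: cmeasM => //; exact/ccont_meas/ccont_gauss.
  - move=> xi _; set z := _ * F xi.
    have c1 : ccont (fun t : R => (expR (- (t * xi) ^+ 2))%:C * z).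
      apply: ccontM; last exact: ccont_cst.
      by have := ccont_gauss xi; under eq_fun do rewrite mulrC.
    have := ccvg_cont c1 en0; rewrite mul0r expr0n oppr0 expR0.
    by rewrite [X in ccvg _ X]mul1r.
  - exact: cint_nc.
  - move=> n xi _; rewrite nc_realM nc_phaseM ger0_norm ?expR_ge0//.
    rewrite ler_piMl ?nc_ge0// -expR0 ler_expR oppr_le0 sqr_ge0//.
have LE n : L n = cI mu setT (fun t => (2 * Num.sqrt pi)%:C *
    ((expR (- t ^+ 2))%:C * f (2 * en n * t + x))).
  have /andP[e0 e1] := en01 n; set e := en n in e0 e1 *.
  pose W (p : R * R) := (expR (- (e * p.1) ^+ 2))%:C *
    (cxp ('i * (s * (p.2 - x) * p.1)%:C) * f p.2).
  have ncW p : nc (W p) <= (e^-2 * ker p.1) * nc (f p.2).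
    rewrite /W nc_realM nc_phaseM ler_wpM2r ?nc_ge0// ger0_norm ?expR_ge0//.
    by apply: gauss_kernel_le; rewrite e0.
  have mW : cmeas setT W.
    apply: cmeasM.
      apply: (@cmeas_comp _ _ _ _ (fun t : R => (expR (- (e * t) ^+ 2))%:C) fst) => //.
      exact/ccont_meas/ccont_gauss.
    apply: cmeasM; last by apply: (@cmeas_comp _ _ _ _ f snd) => //; exact: ccont_meas.
    apply: cmeas_cxp; apply: cmeasM; first exact: cmeas_cst.
    apply: cmeas_real; apply: measurable_funM => //.
    apply: measurable_funM; first exact: measurable_cst.
    by apply: measurable_funB => //; exact: measurable_cst.
  have e2 : 0 <= e^-2 by rewrite invr_ge0 exprn_ge0// ltW.
  have iW : cint (mu \x mu)%E setT W.
    apply: (@cint_dom _ _ _ (mu \x mu)%E setT measurableT W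
      (fun p => (e^-2 * ker p.1) * nc (f p.2))) => //.
    apply: (@rint_prod _ _ _ _ _ mu mu (fun t => e^-2 * ker t) (fun t => nc (f t))).
    - by move=> t; rewrite mulr_ge0// ker_ge0.
    - by move=> t; exact: nc_ge0.
    - by apply: rintZ => //; exact: rint_ker.
    - exact: cint_nc.
  have iW1 xi : cint mu setT (fun t => W (xi, t)).
    apply: (@cint_dom _ _ _ mu setT measurableT _ (fun t => (e^-2 * ker xi) * nc (f t))).
    - by apply: (@cmeas_comp _ _ _ _ W (fun t => (xi, t))) => //; exact: measurable_pair1.
    - by apply: rintZ => //; exact: cint_nc.
    - by move=> t _; exact: ncW.
  have iW2 t : cint mu setT (fun xi => W (xi, t)).
    apply: (@cint_ker _ _ (e^-2 * nc (f t))).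
      by apply: (@cmeas_comp _ _ _ _ W (fun xi => (xi, t))) => //; exact: measurable_pair2.
    by move=> xi; rewrite mulrAC; exact: ncW.
  have -> : L n = cI mu setT (fun xi => cI mu setT (fun t => W (xi, t))).
    apply: eq_cI => xi _; rewrite mulrA -cIZ//.
      apply: eq_cI => t _; rewrite /W/= -!mulrA; congr (_ * _).
      rewrite !mulrA -cxpD; congr (cxp _ * _).
      by apply: complex_eqP; rewrite !cE/=; ring.
    apply: (@cint_dom _ _ _ mu setT measurableT _ (fun t => nc (f t))).
    - apply: cmeasM; last exact: ccont_meas.
      apply: ccont_meas; have := ccont_phase (s * xi).
      by under eq_fun do rewrite mulrAC.
    - exact: cint_nc.
    - by move=> t _; rewrite nc_phaseM.
  rewrite -cFubini1// cFubini2//.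
  pose g y := (Num.sqrt pi / e * expR (- (s * (y - x) / (2 * e)) ^+ 2))%:C * f y.
  have -> : cI mu setT (fun y => cI mu setT (fun xi => W (xi, y))) = cI mu setT g.
    apply: eq_cI => y _; rewrite /g -gauss_fourier_scaled// -cIZr//.
      by apply: eq_cI => xi _; rewrite /W/= mulrA.
    apply: (@cint_ker _ _ (e^-2)).
      by apply: cmeasM; apply: ccont_meas; [exact: ccont_gauss|exact: ccont_phase].
    move=> xi; rewrite nc_realM nc_phase mulr1 ger0_norm ?expR_ge0//.
    by apply: gauss_kernel_le; rewrite e0.
  have cg : ccont g.
    apply: ccontM => //; apply: ccont_real => y.
    apply: cvgM; first exact: cvg_cst.
    apply: continuous_comp; last exact: continuous_expR.
    apply: cvgN; apply: cvgM; apply: cvgM; try exact: cvg_cst;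
      by apply: cvgM; [exact: cvg_cst|apply: cvgB => //; exact: cvg_cst].
  have jg : cint mu setT g.
    apply: (@cint_dom _ _ _ mu setT measurableT _ (fun t => (Num.sqrt pi / e) * nc (f t))).
    - exact: ccont_meas.
    - by apply: rintZ => //; exact: cint_nc.
    - move=> t _; rewrite /g nc_realM ler_wpM2r ?nc_ge0// ger0_norm.
        rewrite ler_piMr ?divr_ge0 ?sqrtr_ge0 ?(ltW e0)//.
        by rewrite -expR0 ler_expR oppr_le0 sqr_ge0.
      by rewrite mulr_ge0 ?expR_ge0// divr_ge0 ?sqrtr_ge0// ltW.
  have e20 : 0 < 2 * e by rewrite mulr_gt0.
  (* The substitution y = 2 e t + x makes the Gaussian independent of e; its Jacobian 2 e cancels
     the 1/e of the transform and leaves 2 sqrt pi, and the mass sqrt pi of exp (- t^2) completes it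
     to 2 pi. *)
  have [_ <-] := cint_affine x e20 cg jg.
  apply: eq_cI => t _; rewrite /g !mulrA -!rmorphM/=; congr (_%:C * _).
  rewrite (_ : (s * (2 * e * t + x - x) / (2 * e)) ^+ 2 = s ^+ 2 * t ^+ 2); last first.
    by field; rewrite gt_eqF.
  by rewrite s2 mul1r; field; rewrite gt_eqF.
have L2 : ccvg L ((2 * pi)%:C * f x).
  pose h t := (2 * Num.sqrt pi)%:C * ((expR (- t ^+ 2))%:C * f x).
  have -> : (2 * pi)%:C * f x = cI mu setT h.
    rewrite /h; have ig : cint mu setT (fun t : R => (expR (- t ^+ 2))%:C * cxp ('i * (0 * t)%:C)).
      apply: (@cint_ker _ _ 1).
        apply: cmeasM; last exact/ccont_meas/ccont_phase.
        by have := ccont_meas (ccont_gauss 1); under eq_fun do rewrite mul1r.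
      by move=> t; rewrite nc_realM nc_phase mulr1 mul1r ger0_norm ?expR_ge0// expR_le_ker.
    have := gauss_fourier 0; rewrite mul0r expr0n oppr0 expR0 mulr1 => e.
    transitivity ((2 * Num.sqrt pi)%:C * (Num.sqrt pi)%:C * f x).
      by rewrite -rmorphM/= -mulrA -expr2 sqr_sqrtr ?pi_ge0.
    rewrite -e -cIZ// -cIZr//; last exact: cintZ.
    apply: eq_cI => t _; rewrite mul0r (_ : 'i * 0%:C = 0) ?cxp0 ?mulr1 -?mulrA//.
    exact: mulr0.
  suff : ccvg (fun n => cI mu setT (fun t => (2 * Num.sqrt pi)%:C *
      ((expR (- t ^+ 2))%:C * f (2 * en n * t + x)))) (cI mu setT h).
    by congr ccvg; apply/funext => n; rewrite LE.
  apply: (proj2 (A := cint mu setT h)).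
  apply: (@cDCT _ _ _ mu setT _ _ (fun t => (2 * Num.sqrt pi * K) * ker t) measurableT) => //.
  - move=> n; apply: cmeasM; first exact: cmeas_cst.
    apply: cmeasM; first by have := ccont_meas (ccont_gauss 1); under eq_fun do rewrite mul1r.
    apply: (@cmeas_comp _ _ _ _ f (fun t : R => 2 * en n * t + x)); first exact: ccont_meas.
    apply: continuous_measurable_fun.
    by have := @continuous_affine x (2 * en n); under eq_fun do rewrite addrC.
  - apply: cmeasM; first exact: cmeas_cst.
    apply: cmeasM; last exact: cmeas_cst.
    by have := ccont_meas (ccont_gauss 1); under eq_fun do rewrite mul1r.
  - move=> t _.
    have c1 : ccont (fun r => (2 * Num.sqrt pi)%:C * ((expR (- t ^+ 2))%:C * f r)).
      by do 2 (apply: ccontM; first exact: ccont_cst).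
    apply: (ccvg_cont c1).
    by have := ens x (2 * t); under eq_fun do rewrite addrC mulrCA mulrA.
  - by apply: rintZ => //; exact: rint_ker.
  - move=> n t _; rewrite !nc_realM [`|expR _|]ger0_norm ?expR_ge0//.
    have c0 : 0 <= 2 * Num.sqrt pi :> R by rewrite mulr_ge0 ?sqrtr_ge0.
    rewrite ger0_norm// -[leRHS]mulrA ler_wpM2l// mulrC.
    by apply: ler_pM; rewrite ?nc_ge0 ?expR_ge0 ?expR_le_ker.
exact: ccvg_uniq L1 L2.
Qed.

End Inversion.

(** * The symplectic Fourier transform on the plane and its inversion *)

Section Plane.
Context {R : realType}.
Notation mu := (@lebesgue_measure R).
Notation mu2 := (mu \x mu)%E.
Implicit Types (F : R -> R -> R[i]) (K x y a : R).

(* Every integrability claim on the plane below is a comparison with this product kernel. *)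
Definition tame K F := [/\ forall x2, ccont (F ^~ x2), forall x1, ccont (F x1) &
  forall x1 x2, nc (F x1 x2) <= K * (ker x1 * ker x2)].

Lemma tame_ge0 K F : tame K F -> 0 <= K.
Proof.
move=> [_ _ FK]; have := le_trans (nc_ge0 _) (FK 0 0).
by rewrite pmulr_lge0// mulr_gt0 ?ker_gt0.
Qed.

Lemma tame_meas K F : tame K F -> cmeas setT (fun p : R * R => F p.1 p.2).
Proof. by move=> [c1 c2 _]; apply: cCaratheodory => // x; exact: ccont_meas. Qed.

Lemma rint_ker2 : rint mu2 setT (fun p => ker p.1 * ker p.2).
Proof.
by apply: (@rint_prod _ _ _ _ _ mu mu ker ker); [exact: ker_ge0|exact: ker_ge0|exact: rint_ker..].
Qed.

Lemma cint_ker2 K (h : R * R -> R[i]) : cmeas setT h ->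
  (forall p, nc (h p) <= K * (ker p.1 * ker p.2)) -> cint mu2 setT h.
Proof.
move=> mh hK; apply: (@cint_dom _ _ _ mu2 setT measurableT h (fun p => K * (ker p.1 * ker p.2))) => //.
by apply: rintZ => //; exact: rint_ker2.
Qed.

Lemma tame_int K F : tame K F -> cint mu2 setT (fun p : R * R => F p.1 p.2).
Proof. by move=> tF; apply: (cint_ker2 (tame_meas tF)) => p; case: tF. Qed.

Lemma tame_le1 K F x1 x2 : tame K F -> nc (F x1 x2) <= K * ker x2.
Proof.
move=> tF; have K0 := tame_ge0 tF; case: tF => _ _ /(_ x1 x2)/le_trans; apply.
by rewrite ler_wpM2l// ler_piMl ?ker_ge0 ?ker_le1.
Qed.

Lemma tame_le2 K F x1 x2 : tame K F -> nc (F x1 x2) <= K * ker x1.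
Proof.
move=> tF; have K0 := tame_ge0 tF; case: tF => _ _ /(_ x1 x2)/le_trans; apply.
by rewrite ler_wpM2l// ler_piMr ?ker_ge0 ?ker_le1.
Qed.

Lemma tame_int1 K F x2 : tame K F -> cint mu setT (F ^~ x2).
Proof.
move=> tF; apply: (@cint_ker _ _ K); first by case: tF => c1 _ _; exact: ccont_meas.
by move=> x1; exact: tame_le2.
Qed.

Lemma tame_int2 K F x1 : tame K F -> cint mu setT (F x1).
Proof.
move=> tF; apply: (@cint_ker _ _ K); first by case: tF => _ c2 _; exact: ccont_meas.
by move=> x2; exact: tame_le1.
Qed.

Lemma tame_Fubini1 K F : tame K F ->
  cI mu2 setT (fun p => F p.1 p.2) = cI mu setT (fun x1 => cI mu setT (fun x2 => F x1 x2)).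
Proof.
move=> tF; rewrite (@cFubini1 _ _ _ _ _ mu mu (fun p => F p.1 p.2))//=.
  exact: tame_int tF.
by move=> x; exact: tame_int2 tF.
Qed.

Lemma tame_Fubini2 K F : tame K F ->
  cI mu2 setT (fun p => F p.1 p.2) = cI mu setT (fun x2 => cI mu setT (fun x1 => F x1 x2)).
Proof.
move=> tF; rewrite (@cFubini2 _ _ _ _ _ mu mu (fun p => F p.1 p.2))//=.
  exact: tame_int tF.
by move=> x; exact: tame_int1 tF.
Qed.

Lemma tameM K F (G : R -> R -> R[i]) M : tame K F -> 0 <= M ->
  (forall x2, ccont (G ^~ x2)) -> (forall x1, ccont (G x1)) ->
  (forall x1 x2, nc (G x1 x2) <= M) -> tame (M * K) (fun x1 x2 => G x1 x2 * F x1 x2).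
Proof.
move=> [c1 c2 FK] M0 g1 g2 gM; split; try by move=> ?; exact: ccontM.
by move=> x1 x2; rewrite ncM -mulrA; apply: ler_pM; rewrite ?nc_ge0.
Qed.

(* [SF] at complex frequencies. *)
Definition FT F (w1 w2 : R[i]) : R[i] :=
  cI mu2 setT (fun p => cxp ('i * (p.1%:C * w2 - p.2%:C * w1)) * F p.1 p.2).

Definition phase2 (x1 x2 y1 y2 : R) : R[i] := cxp ('i * (x1 * y2 - x2 * y1)%:C).

Lemma phase2E (x1 x2 y1 y2 : R) :
  cxp ('i * (x1%:C * y2%:C - x2%:C * y1%:C)) = phase2 x1 x2 y1 y2.
Proof. by rewrite /phase2 !(rmorphB, rmorphM). Qed.

Lemma nc_phase2 (x1 x2 y1 y2 : R) : nc (phase2 x1 x2 y1 y2) = 1.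
Proof. exact: nc_phase. Qed.

Lemma ccont_phaseD (r a : R) : ccont (fun t : R => cxp ('i * (r + a * t)%:C)).
Proof.
apply: ccont_cxp; apply: ccontM; first exact: ccont_cst.
by apply: ccont_real; exact: continuous_affine.
Qed.

Lemma ccont_phase2_1 x2 y1 y2 : ccont (fun x1 => phase2 x1 x2 y1 y2).
Proof.
have := ccont_phaseD (- (x2 * y1)) y2; rewrite /phase2.
by under eq_fun do rewrite addrC mulrC [y2 * _]mulrC mulrC.
Qed.

Lemma ccont_phase2_2 x1 y1 y2 : ccont (fun x2 => phase2 x1 x2 y1 y2).
Proof.
have := ccont_phaseD (x1 * y2) (- y1); rewrite /phase2.
by under eq_fun do rewrite mulNr [y1 * _]mulrC.
Qed.

Lemma ccont_phase2_3 x1 x2 y2 : ccont (fun y1 => phase2 x1 x2 y1 y2).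
Proof.
have := ccont_phaseD (x1 * y2) (- x2); rewrite /phase2.
by under eq_fun do rewrite mulNr.
Qed.

Lemma ccont_phase2_4 x1 x2 y1 : ccont (fun y2 => phase2 x1 x2 y1 y2).
Proof.
have := ccont_phaseD (- (x2 * y1)) x1; rewrite /phase2.
by under eq_fun do rewrite addrC.
Qed.

Lemma tame_phase K F y1 y2 : tame K F ->
  tame K (fun x1 x2 => phase2 x1 x2 y1 y2 * F x1 x2).
Proof.
move=> tF; rewrite -[K]mul1r; apply: tameM => //.
- by move=> x2; exact: ccont_phase2_1.
- by move=> x1; exact: ccont_phase2_2.
- by move=> x1 x2; rewrite nc_phase2.
Qed.

Lemma FT_real F y1 y2 :
  FT F y1%:C y2%:C = cI mu2 setT (fun p => phase2 p.1 p.2 y1 y2 * F p.1 p.2).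
Proof. by apply: eq_cI => p _; rewrite phase2E. Qed.

Lemma FT_ccont1 K F y2 : tame K F -> ccont (fun y1 : R => FT F y1%:C y2%:C).
Proof.
move=> tF; under eq_fun do rewrite FT_real.
apply: (@ccont_cI _ _ _ mu2 (fun y1 (p : R * R) => phase2 p.1 p.2 y1 y2 * F p.1 p.2)
  (fun p => K * (ker p.1 * ker p.2))).
- by move=> y1; exact: tame_meas (tame_phase y1 y2 tF).
- by move=> p; apply: ccontM; [exact: ccont_phase2_3|exact: ccont_cst].
- by apply: rintZ => //; exact: rint_ker2.
- by move=> y1 p; rewrite ncM nc_phase2 mul1r; case: tF.
Qed.

Lemma FT_ccont2 K F y1 : tame K F -> ccont (fun y2 : R => FT F y1%:C y2%:C).
Proof.
move=> tF; under eq_fun do rewrite FT_real.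
apply: (@ccont_cI _ _ _ mu2 (fun y2 (p : R * R) => phase2 p.1 p.2 y1 y2 * F p.1 p.2)
  (fun p => K * (ker p.1 * ker p.2))).
- by move=> y2; exact: tame_meas (tame_phase y1 y2 tF).
- by move=> p; apply: ccontM; [exact: ccont_phase2_4|exact: ccont_cst].
- by apply: rintZ => //; exact: rint_ker2.
- by move=> y2 p; rewrite ncM nc_phase2 mul1r; case: tF.
Qed.

Lemma FT_tame K M F : tame K F ->
  (forall y1 y2 : R, nc (FT F y1%:C y2%:C) <= M * (ker y1 * ker y2)) ->
  tame M (fun y1 y2 : R => FT F y1%:C y2%:C).
Proof.
by move=> tF FM; split=> // y; [exact: FT_ccont1 tF|exact: FT_ccont2 tF].
Qed.

(** One-dimensional inversion twice: the partial transform g in x1 is recovered from FT F by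
    integrating over y1 (sign -1), and F from g by integrating over y2 (sign 1). *)
Theorem FT_inversion K M F (x1 x2 : R) : tame K F ->
  (forall y1 y2 : R, nc (FT F y1%:C y2%:C) <= M * (ker y1 * ker y2)) ->
  FT (fun y1 y2 : R => FT F y1%:C y2%:C) x1%:C x2%:C = ((2 * pi) ^+ 2)%:C * F x1 x2.
Proof.
move=> tF FM; have tG := FT_tame tF FM; have K0 := tame_ge0 tF.
pose g y2 x2 := cI mu setT (fun x1 => cxp ('i * (1 * x1 * y2)%:C) * F x1 x2).
have mph (y2 : R) : ccont (fun x1 => cxp ('i * (1 * x1 * y2)%:C)).
  have := ccont_phase y2; congr ccont; apply/funext => t.
  by congr (cxp ('i * _%:C)); ring.
have ig y2 x : cint mu setT (fun x1 => cxp ('i * (1 * x1 * y2)%:C) * F x1 x).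
  apply: (@cint_ker _ _ K).
    by apply: ccont_meas; apply: ccontM => //; case: tF.
  by move=> t; rewrite nc_phaseM; exact: tame_le2.
have cg y2 : ccont (g y2).
  apply: (@ccont_cI _ _ _ mu (fun x2 x1 => cxp ('i * (1 * x1 * y2)%:C) * F x1 x2)
    (fun x1 => K * ker x1)).
  - by move=> x; exact: cint_meas (ig _ _).
  - by move=> t; apply: ccontM; [exact: ccont_cst|case: tF].
  - by apply: rintZ => //; exact: rint_ker.
  - by move=> x t; rewrite nc_phaseM; exact: tame_le2.
have cg' x : ccont (g ^~ x).
  apply: (@ccont_cI _ _ _ mu (fun y2 x1 => cxp ('i * (1 * x1 * y2)%:C) * F x1 x)
    (fun x1 => K * ker x1)).
  - by move=> y; exact: cint_meas (ig _ _).
  - by move=> t; apply: ccontM; [exact: ccont_phase|exact: ccont_cst].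
  - by apply: rintZ => //; exact: rint_ker.
  - by move=> y t; rewrite nc_phaseM; exact: tame_le2.
pose I := \int[mu]_x ker x.
have gK y2 x : nc (g y2 x) <= (I * K) * ker x.
  have -> : I * K * ker x = \int[mu]_t ((K * ker x) * ker t).
    by rewrite RintegralZl//; [rewrite /I; ring|exact: rint_ker].
  apply: le_cI => //; first by apply: rintZ => //; exact: rint_ker.
  move=> t _; rewrite nc_phaseM -mulrA [ker x * _]mulrC.
  by case: tF.
have IK0 : 0 <= I * K.
  by rewrite mulr_ge0//; apply: Rintegral_ge0 => t _; exact: ker_ge0.
have jg y2 : cint mu setT (g y2) by apply: (@cint_ker _ _ (I * K)) => //; exact: ccont_meas.
have FTg y1 y2 : FT F y1%:C y2%:C =
    cI mu setT (fun t => cxp ('i * (-1 * t * y1)%:C) * g y2 t).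
  rewrite FT_real (tame_Fubini2 (tame_phase y1 y2 tF)); apply: eq_cI => t _.
  rewrite -cIZ//; apply: eq_cI => s _; rewrite mulrA -cxpD; congr (cxp _ * _).
  by apply: complex_eqP; rewrite !cE/=; ring.
have inv1 y2 x : cI mu setT (fun y1 => cxp ('i * (- (-1) * x * y1)%:C) * FT F y1%:C y2%:C) =
    (2 * pi)%:C * g y2 x.
  rewrite -(@Fourier_inversion _ (-1) (g y2) (I * K) x)//.
  - by apply: eq_cI => t _; rewrite FTg.
  - by rewrite sqrrN expr1n.
  - by move=> t; apply: le_trans (gK _ _) _; rewrite ler_piMr ?ker_le1.
  - have := tame_int1 y2 tG; congr cint; apply/funext => t; exact: FTg.
pose M' := I * M / (2 * pi).
have pi0 : 0 < 2 * pi :> R by rewrite mulr_gt0 ?pi_gt0.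
(* The bound on F controls g only in x. Decay in y2 is read off from [inv1], that is, from the
   assumed decay of FT F. *)
have gM y2 x : nc (g y2 x) <= M' * ker y2.
  rewrite /M' mulrAC ler_pdivlMr// -[2 * pi]gtr0_norm// mulrC -nc_realM -inv1.
  have -> : I * M * ker y2 = \int[mu]_t ((M * ker y2) * ker t).
    by rewrite RintegralZl//; [rewrite /I; ring|exact: rint_ker].
  apply: le_cI => //; last 2 first.
  - by apply: rintZ => //; exact: rint_ker.
  - by move=> t _; rewrite nc_phaseM -mulrA [ker y2 * _]mulrC FM.
  apply: (@cint_ker _ _ M).
    apply: cmeasM; last exact: cint_meas (tame_int1 y2 tG).
    exact/ccont_meas/ccont_phase.
  by move=> t; rewrite nc_phaseM; exact: tame_le2 tG.
have jg2 x : cint mu setT (g ^~ x).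
  by apply: (@cint_ker _ _ M') => //; exact: ccont_meas.
have := @Fourier_inversion _ 1 (F ^~ x2) K x1 (expr1n _ _).
move=> /(_ _ _ _ (jg2 x2)) inv2.
rewrite FT_real (tame_Fubini2 (tame_phase x1 x2 tG)).
rewrite expr2 rmorphM/= -mulrA -inv2; last 3 first.
- by case: tF.
- by move=> t; apply: le_trans (tame_le2 _ _ tF) _; rewrite ler_piMr ?ker_le1.
- exact: tame_int1 tF.
rewrite -cIZ//; last first.
  apply: (@cint_ker _ _ M').
    by apply: cmeasM; [exact/ccont_meas/ccont_phase|exact: ccont_meas (cg' x2)].
  by move=> t; rewrite nc_phaseM; exact: gM.
apply: eq_cI => y2 _; rewrite mulrCA -/(g y2 x2) -inv1 -cIZ//; last first.
  apply: (@cint_ker _ _ M).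
    apply: cmeasM; last exact: cint_meas (tame_int1 y2 tG).
    exact/ccont_meas/ccont_phase.
  by move=> t; rewrite nc_phaseM; exact: tame_le2 tG.
apply: eq_cI => y1 _; rewrite mulrA -cxpD; congr (cxp _ * _).
by apply: complex_eqP; rewrite !cE/=; ring.
Qed.

End Plane.

(** * Integrals of exponentials depending on parameters *)

Section QuadDiff.

(** Stated over an arbitrary numeric field because it serves twice: over R[i] for entire functions,
    over R for the smoothness of tau. *)
Lemma quad_differentiable (K : numFieldType) (V W : normedModType K)
    (f : V -> W) (df : {linear V -> W}) x (C r : K) : 0 <= C -> 0 < r ->
  continuous df -> (forall h, `|h| < r -> `|f (h + x) - f x - df h| <= C * `|h| ^+ 2) ->
  differentiable f x /\ 'd f x = df :> (V -> W).
Proof.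
move=> C0 r0 cdf H.
have e : f \o shift x = cst (f x) + df +o_ 0 id.
  apply/eqaddoP => eps eps0; have C1 : 0 < C + 1 by rewrite ltr_wpDl.
  have eC : 0 < eps / (C + 1) by rewrite divr_gt0.
  near=> h => /=.
  have h1 : `|h| < r.
    near: h; apply/nbhs_normP; exists r => //= y.
    by rewrite /ball_/= sub0r normrN.
  have h2 : `|h| < eps / (C + 1).
    near: h; apply/nbhs_normP; exists (eps / (C + 1)); first exact: eC.
    by move=> y; rewrite /ball_/= sub0r normrN.
  rewrite [X in `|X|](_ : _ = f (h + x) - f x - df h); last first.
    by rewrite !fctE /= opprD addrA.
  apply: le_trans (H _ h1) _; rewrite expr2 mulrA ler_wpM2r//.
  apply: le_trans (_ : (C + 1) * `|h| <= _).
    by rewrite ler_wpM2r// lerDl.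
  by rewrite mulrC -ler_pdivlMr// ltW.
have d := diff_unique cdf e; split=> //.
by apply/diff_locallyP; rewrite d.
Unshelve. all: by end_near. Qed.

Definition lin2 (K : numFieldType) (a b : K) (h : 'rV[K]_2) : K^o :=
  h 0 0 * a + h 0 1 * b.

Lemma lin2_is_linear (K : numFieldType) (a b : K) : linear (lin2 a b).
Proof.
by move=> c u v; rewrite /lin2 !mxE /GRing.scale/= !mulrDl !mulrDr !mulrA addrACA.
Qed.

HB.instance Definition _ (K : numFieldType) (a b : K) :=
  GRing.isLinear.Build K 'rV[K]_2 K^o _ (lin2 a b) (lin2_is_linear a b).

Lemma continuous_lin2 (K : numFieldType) (a b : K) : continuous (lin2 a b).
Proof.
move=> h; apply: (@differentiable_continuous K 'rV[K]_2 K^o).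
apply: (@differentiableD _ _ _ (fun h : 'rV[K]_2 => h 0 0 * a : K^o) (fun h => h 0 1 * b : K^o)).
  apply: (@differentiableM _ _ (fun h : 'rV[K]_2 => h 0 0 : K^o) (fun=> a)).
    exact: differentiable_coord.
  exact: differentiable_cst.
apply: (@differentiableM _ _ (fun h : 'rV[K]_2 => h 0 1 : K^o) (fun=> b)).
  exact: differentiable_coord.
exact: differentiable_cst.
Qed.

End QuadDiff.

Section ExpInt.
Context {R : realType} d (T : measurableType d) (mu : {measure set T -> \bar R}).
Variables (l1 l2 : T -> R[i]).
Hypothesis (ml1 : cmeas setT l1) (ml2 : cmeas setT l2).
Implicit Types (h : T -> R[i]) (z v : R[i]).

Let L t : R := nc (l1 t) + nc (l2 t).
Let L0 t : 0 <= L t. Proof. by rewrite addr_ge0 ?nc_ge0. Qed.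

(** The symplectic transform, the twisted convolution, the Laplace transform and tau can all be
    written in this form; differentiation in z1 or z2 multiplies the density h by [l1] or [l2]. *)
Definition EI h z1 z2 := cI mu setT (fun t => cxp (l1 t * z1 + l2 t * z2) * h t).

Let mlin z1 z2 : cmeas setT (fun t => l1 t * z1 + l2 t * z2).
Proof. by apply: cmeasD; apply: cmeasM => //; exact: cmeas_cst. Qed.

Let linle v1 v2 t : nc (l1 t * v1 + l2 t * v2) <= L t * (nc v1 + nc v2).
Proof.
apply: le_trans (ncD _ _) _; rewrite !ncM /L.
have := nc_ge0 (l1 t); have := nc_ge0 (l2 t); have := nc_ge0 v1; have := nc_ge0 v2.
by move=> ? ? ? ?; rewrite mulrDl !mulrDr; nra.
Qed.

(** Integrates |exp b - 1 - b| <= |b|^2 exp |Re b| against exp a * h, where b is the increment of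
    the exponent a. The weight w abstracts the bound on |Re b|: it is L for complex increments and a
    constant for real ones. *)
Lemma EI_quad h z1 z2 (w : T -> R) : cmeas setT h -> (forall t, 0 <= w t) ->
  rint mu setT (fun t => expR (cRe (l1 t * z1 + l2 t * z2) + w t) * (1 + L t) ^+ 2 * nc (h t)) ->
  forall v1 v2, nc v1 + nc v2 <= 1 ->
  (forall t, `|cRe (l1 t * v1 + l2 t * v2)| <= w t) ->
  nc (EI h (z1 + v1) (z2 + v2) - EI h z1 z2 -
      (v1 * EI (fun t => l1 t * h t) z1 z2 + v2 * EI (fun t => l2 t * h t) z1 z2)) <=
  (nc v1 + nc v2) ^+ 2 *
  \int[mu]_t (expR (cRe (l1 t * z1 + l2 t * z2) + w t) * (1 + L t) ^+ 2 * nc (h t)).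
Proof.
move=> mh w0 iD v1 v2 v1_le1 wv.
set a := fun t => l1 t * z1 + l2 t * z2; set D := fun t => _ * _ in iD *.
pose b t := l1 t * v1 + l2 t * v2; pose s := nc v1 + nc v2.
have s0 : 0 <= s by rewrite addr_ge0 ?nc_ge0.
have ma : cmeas setT (fun t => cxp (a t)) by apply: cmeas_cxp; exact: mlin.
have DE t : D t = expR (cRe (a t)) * expR (w t) * (1 + L t) ^+ 2 * nc (h t).
  by rewrite /D expRD.
have ew t : 1 <= expR (w t) by rewrite -expR0 ler_expR.
have L1 t : 1 <= 1 + L t by rewrite lerDl.
have bnd (X : R) t : 0 <= X -> X <= expR (w t) * (1 + L t) ^+ 2 ->
    expR (cRe (a t)) * (X * nc (h t)) <= D t.
  move=> X0 XD.
  have -> : D t = expR (cRe (a t)) * ((expR (w t) * (1 + L t) ^+ 2) * nc (h t)).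
    by rewrite DE; ring.
  by rewrite ler_wpM2l ?expR_ge0// ler_wpM2r ?nc_ge0.
have i0 : cint mu setT (fun t => cxp (a t) * h t).
  apply: (cint_dom measurableT _ iD); first exact: cmeasM.
  move=> t _; rewrite ncM nc_cxp -[nc (h t)]mul1r; apply: bnd => //.
  by rewrite -[leLHS]mulr1 ler_pM// exprn_ege1.
have iL (l : T -> R[i]) : cmeas setT l -> (forall t, nc (l t) <= L t) ->
    cint mu setT (fun t => cxp (a t) * (l t * h t)).
  move=> ml lL; apply: (cint_dom measurableT _ iD); first by apply: cmeasM => //; exact: cmeasM.
  move=> t _; rewrite !ncM nc_cxp; apply: bnd; first exact: nc_ge0.
  rewrite -[leLHS]mul1r ler_pM ?nc_ge0// (le_trans (lL t))//.
  by rewrite expr2; have := L0 t; nra.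
have i1 : cint mu setT (fun t => cxp (a t) * (l1 t * h t)).
  by apply: iL => // t; rewrite lerDl nc_ge0.
have i2 : cint mu setT (fun t => cxp (a t) * (l2 t * h t)).
  by apply: iL => // t; rewrite lerDr nc_ge0.
have iv : cint mu setT (fun t => cxp (l1 t * (z1 + v1) + l2 t * (z2 + v2)) * h t).
  apply: (cint_dom measurableT _ iD); first by apply: cmeasM => //; apply: cmeas_cxp; exact: mlin.
  move=> t _; rewrite ncM nc_cxp.
  rewrite (_ : l1 t * _ + _ = a t + b t); last by rewrite /a /b; ring.
  rewrite cReD expRD -mulrA; apply: bnd; first exact: expR_ge0.
  rewrite -[leLHS]mulr1 ler_pM ?expR_ge0 ?exprn_ege1//.
  by rewrite ler_expR; exact: le_trans (ler_norm _) (wv t).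
rewrite /EI -cIB// -cIZ// -cIZ// -cID//; [|exact: cintZ..].
rewrite -cIB//; [|exact: cintB|by apply: cintD => //; exact: cintZ].
rewrite -RintegralZl//.
apply: le_cI => //.
- by apply: cintB => //; [exact: cintB|apply: cintD => //; exact: cintZ].
- exact: rintZ.
move=> t _.
rewrite (_ : _ - _ = cxp (a t) * h t * (cxp (b t) - 1 - b t)); last first.
  rewrite (_ : l1 t * (z1 + v1) + l2 t * (z2 + v2) = a t + b t); last by rewrite /a /b; ring.
  by rewrite cxpD /a /b; ring.
rewrite !ncM nc_cxp -/(D t); apply: le_trans (ler_wpM2l _ (cxp_quad _)) _.
  by rewrite mulr_ge0 ?expR_ge0 ?nc_ge0.
have bs : nc (b t) <= L t * s by exact: linle.
have b2 : nc (b t) ^+ 2 <= s ^+ 2 * (1 + L t) ^+ 2.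
  have Lt1 : 0 <= 1 + L t := le_trans ler01 (L1 t).
  rewrite -exprMn ler_sqr ?nnegrE ?nc_ge0 ?mulr_ge0//.
  by apply: le_trans bs _; rewrite mulrC ler_wpM2l// lerDr.
rewrite DE.
have e1 : expR `|cRe (b t)| <= expR (w t) by rewrite ler_expR; exact: wv.
have H : nc (b t) ^+ 2 * expR `|cRe (b t)| <= s ^+ 2 * (1 + L t) ^+ 2 * expR (w t).
  by apply: ler_pM => //; rewrite ?expR_ge0 ?sqr_ge0.
apply: le_trans (ler_wpM2l _ H) _; first by rewrite mulr_ge0 ?expR_ge0 ?nc_ge0.
by rewrite le_eqVlt; apply/orP; left; apply/eqP; rewrite /s; ring.
Qed.

Lemma EI_complex_quad h : cmeas setT h ->
  (forall M, 0 <= M -> rint mu setT (fun t => expR (M * L t) * nc (h t))) ->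
  forall z1 z2, exists2 C : R, 0 <= C & forall v1 v2, nc v1 + nc v2 <= 1 ->
  nc (EI h (z1 + v1) (z2 + v2) - EI h z1 z2 -
      (v1 * EI (fun t => l1 t * h t) z1 z2 + v2 * EI (fun t => l2 t * h t) z1 z2)) <=
  C * (nc v1 + nc v2) ^+ 2.
Proof.
move=> mh ih z1 z2; pose Z := nc z1 + nc z2.
have Z0 : 0 <= Z by rewrite addr_ge0 ?nc_ge0.
have iD : rint mu setT (fun t => expR (cRe (l1 t * z1 + l2 t * z2) + L t) * (1 + L t) ^+ 2 * nc (h t)).
  (* Z + 3 collects Z from the exponent at (z1, z2), 1 from the weight L, and 2 from (1 + L)^2 <=
     exp (2 L). *)
  apply: (rint_dom measurableT _ (ih (Z + 3) _)).
  - apply: measurable_funM; last exact: cmeas_nc.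
    have mL : measurable_fun setT L by apply: measurable_funD; exact: cmeas_nc.
    apply: measurable_funM; last first.
      by apply: measurable_funX; apply: measurable_funD => //; exact: measurable_cst.
    apply: measurableT_comp => //; apply: measurable_funD => //.
    exact: (mlin z1 z2).1.
  - by rewrite addr_ge0.
  move=> t _; rewrite ger0_norm; last first.
    by rewrite mulr_ge0 ?nc_ge0// mulr_ge0 ?expR_ge0 ?sqr_ge0.
  rewrite ler_wpM2r ?nc_ge0//.
  apply: (@le_trans _ _ (expR (Z * L t + L t) * expR (L t) ^+ 2)).
    apply: ler_pM; rewrite ?expR_ge0 ?sqr_ge0//.
      rewrite ler_expR lerD2r (le_trans (ler_norm _))// (le_trans (nc_Re _))//.
      by rewrite [leRHS]mulrC; exact: linle.
    have p : 0 <= 1 + L t by rewrite addr_ge0 ?L0.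
    by rewrite ler_sqr ?nnegrE ?expR_ge0// expR_ge1Dx.
  by rewrite -expRM_natl -expRD ler_expR; lra.
exists (\int[mu]_t (expR (cRe (l1 t * z1 + l2 t * z2) + L t) * (1 + L t) ^+ 2 * nc (h t))).
  apply: Rintegral_ge0 => t _.
  by rewrite mulr_ge0 ?nc_ge0// mulr_ge0 ?expR_ge0 ?sqr_ge0.
move=> v1 v2 v_le1; rewrite [leRHS]mulrC; apply: EI_quad => // t.
apply: le_trans (nc_Re _) _; apply: le_trans (linle _ _ _) _.
by rewrite ler_piMr.
Qed.

(** At real parameters only the real parts of l1 and l2 enter the modulus; if these are bounded,
    polynomial moments of h replace exponential ones. The density of tau decays fast enough only for
    this version. *)
Lemma EI_real_quad h A : cmeas setT h ->
  (forall t, `|cRe (l1 t)| <= A) -> (forall t, `|cRe (l2 t)| <= A) ->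
  rint mu setT (fun t => (1 + L t) ^+ 2 * nc (h t)) ->
  forall x1 x2 : R, exists2 C : R, 0 <= C & forall v1 v2 : R, `|v1| + `|v2| <= 1 ->
  nc (EI h (x1 + v1)%:C (x2 + v2)%:C - EI h x1%:C x2%:C -
      (v1%:C * EI (fun t => l1 t * h t) x1%:C x2%:C + v2%:C * EI (fun t => l2 t * h t) x1%:C x2%:C)) <=
  C * (`|v1| + `|v2|) ^+ 2.
Proof.
move=> mh A1 A2 ih x1 x2.
have Rlin (y1 y2 : R) t : `|cRe (l1 t * y1%:C + l2 t * y2%:C)| <= A * (`|y1| + `|y2|).
  rewrite !cE/= !mulr0 !subr0; apply: le_trans (ler_normD _ _) _.
  by rewrite !normrM mulrDr lerD// ler_wpM2r.
have A0 t : 0 <= A := le_trans (normr_ge0 _) (A1 t).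
have iD : rint mu setT (fun t => expR (cRe (l1 t * x1%:C + l2 t * x2%:C) + `|A|) * (1 + L t) ^+ 2 * nc (h t)).
  have := rintZ measurableT (expR (A * (`|x1| + `|x2|) + `|A|)) ih.
  move=> /(rint_dom measurableT); apply.
    apply: measurable_funM; last exact: cmeas_nc.
    have mL : measurable_fun setT L by apply: measurable_funD; exact: cmeas_nc.
    apply: measurable_funM; last first.
      by apply: measurable_funX; apply: measurable_funD => //; exact: measurable_cst.
    apply: measurableT_comp => //; apply: measurable_funD; last exact: measurable_cst.
    exact: (mlin _ _).1.
  move=> t _; rewrite ger0_norm; last first.
    by rewrite mulr_ge0 ?nc_ge0// mulr_ge0 ?expR_ge0 ?sqr_ge0.
  have p : 0 <= (1 + L t) ^+ 2 * nc (h t).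
    by apply: mulr_ge0; [exact: sqr_ge0|exact: nc_ge0].
  rewrite -mulrA ler_wpM2r//.
  by rewrite ler_expR lerD2r (le_trans (ler_norm _)).
exists (\int[mu]_t (expR (cRe (l1 t * x1%:C + l2 t * x2%:C) + `|A|) * (1 + L t) ^+ 2 * nc (h t))).
  apply: Rintegral_ge0 => t _.
  by rewrite mulr_ge0 ?nc_ge0// mulr_ge0 ?expR_ge0 ?sqr_ge0.
move=> v1 v2 v_le1; rewrite [leRHS]mulrC !rmorphD/= -(nc_real v1) -(nc_real v2).
apply: EI_quad => //; first by rewrite !nc_real.
move=> t; apply: le_trans (Rlin _ _ _) _; rewrite (le_trans _ (ler_norm _))//.
by rewrite ler_piMr// A0.
Qed.

End ExpInt.

(** * Growth of entire functions on C^2 *)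

Section PowerEstimates.
Context {R : realType}.
Implicit Types (a b p q s t x y M : R).

Definition conj_exp p q := [/\ 1 < p, 1 < q & p^-1 + q^-1 = 1].

(** Young's inequality with a prescribed coefficient a, obtained by scaling s by l and t by 1/l with
    l^p = a p. *)
Lemma young_powR p q a : conj_exp p q -> 0 < a -> exists2 K : R, 0 < K &
  forall s t, 0 <= s -> 0 <= t -> s * t <= a * s `^ p + K * t `^ q.
Proof.
move=> [p1 q1 pq] a0.
have p0 : 0 < p by lra.
have q0 : 0 < q by lra.
pose l := (a * p) `^ p^-1.
have l0 : 0 < l by rewrite powR_gt0// mulr_gt0.
have lp : l `^ p = a * p.
  by rewrite -powRrM mulVf ?gt_eqF// powRr1// mulr_ge0// ltW.
exists (l^-1 `^ q / q); first by rewrite divr_gt0// powR_gt0// invr_gt0.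
move=> s t s0 t0.
have li : 0 <= l^-1 by rewrite invr_ge0 ltW.
have := @conjugate_powR _ (l * s) (l^-1 * t) p q (mulr_ge0 (ltW l0) s0) (mulr_ge0 li t0) p0 q0 pq.
rewrite !powRM ?(ltW l0)// lp.
have -> : l * s * (l^-1 * t) = s * t by field; rewrite gt_eqF.
have -> : a * p * s `^ p / p = a * s `^ p by field; rewrite gt_eqF.
by have -> : l^-1 `^ q * t `^ q / q = l^-1 `^ q / q * t `^ q by field; rewrite gt_eqF.
Qed.

(** The choice of the contour height. With y = k t^(p-1), a multiple of the minimiser, the exponent
    (p-1) q equals p, and k is such that b y^q is half of y t; what remains is - (k/2) t^p. *)
Lemma opt_powR p q b : conj_exp p q -> 0 < b -> exists2 a : R, 0 < a &
  forall t, 0 <= t -> exists2 y : R, 0 <= y & b * y `^ q - y * t <= - (a * t `^ p).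
Proof.
move=> [p1 q1 pq] b0.
have p0 : 0 < p by lra.
have q0 : 0 < q by lra.
have q10 : 0 < q - 1 by lra.
pose k := (2 * b)^-1 `^ (q - 1)^-1.
have k0 : 0 < k by rewrite powR_gt0// invr_gt0 mulr_gt0.
have kq : k `^ q = k * (2 * b)^-1.
  rewrite -mulr_powRB1 ?(ltW k0)//; congr (_ * _).
  by rewrite -powRrM mulVf ?gt_eqF// powRr1// invr_ge0 mulr_ge0// ltW.
have pe : (p - 1) * q = p.
  have h : (p^-1 + q^-1) * (p * q) = q + p by field; rewrite !gt_eqF.
  by rewrite mulrBl mul1r -[p * q]mul1r -pq h; ring.
exists (k / 2); first by rewrite divr_gt0.
move=> t t0; exists (k * t `^ (p - 1)).
  by rewrite mulr_ge0 ?powR_ge0// ltW.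
rewrite powRM ?powR_ge0 ?(ltW k0)// -powRrM pe kq -[k * _ * t]mulrA [_ * t]mulrC mulr_powRB1//.
by rewrite le_eqVlt; apply/orP; left; apply/eqP; field; rewrite gt_eqF.
Qed.

Lemma powRD_le p x y : 0 <= p -> 0 <= x -> 0 <= y ->
  (x + y) `^ p <= 2 `^ p * (x `^ p + y `^ p).
Proof.
move=> p0 x0 y0; pose m := Num.max x y.
have m0 : 0 <= m by rewrite le_max x0.
have H : x + y <= 2 * m.
  have : x <= m by rewrite le_max lexx.
  have : y <= m by rewrite le_max lexx orbT.
  by lra.
apply: le_trans (_ : (2 * m) `^ p <= _).
  by apply: ge0_ler_powR => //; rewrite nnegrE ?addr_ge0 ?mulr_ge0.
rewrite powRM// ler_wpM2l ?powR_ge0//.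
by rewrite /m maxEle; case: ifP => _; [rewrite lerDr|rewrite lerDl]; exact: powR_ge0.
Qed.

Lemma expR_norm_ker x : expR (- `|x|) <= 4 * ker x.
Proof.
have H : (1 + `|x| / 2) ^+ 2 <= expR `|x|.
  rewrite (_ : expR `|x| = expR (`|x| / 2) ^+ 2); last first.
    by rewrite -expRM_natl; congr expR; field.
  rewrite ler_sqr ?nnegrE ?expR_ge0 ?expR_ge1Dx// addr_ge0// divr_ge0//.
rewrite expRN /ker -[leLHS]mul1r ler_pdivrMr ?expR_gt0//.
rewrite -mulrA mulrC -mulrA ler_pdivlMl ?oneDsq_gt0// mulr1.
apply: (@le_trans _ _ (4 * (1 + `|x| / 2) ^+ 2)); last by lra.
have := normr_ge0 x; have <- : `|x| ^+ 2 = x ^+ 2 by exact: sqrn.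
by nra.
Qed.

(** Young's inequality lets the power absorb (M + 1) |x|, one unit more than needed; the surplus exp
    (- |x|) lies below a multiple of [ker]. *)
Lemma expR_powR_ker p a M : 1 < p -> 0 < a -> 0 <= M -> exists2 K : R, 0 < K &
  forall x, expR (- (a * `|x| `^ p) + M * `|x|) <= K * ker x.
Proof.
move=> p1 a0 M0; pose q := (1 - p^-1)^-1.
have pi : 0 < p^-1 < 1 by rewrite invr_gt0 invf_lt1; lra.
have pq : conj_exp p q.
  split=> //; last by rewrite /q invrK addrC subrK.
  by rewrite /q invf_gt1; lra.
have [K K0 HK] := young_powR pq a0.
exists (4 * expR (K * (M + 1) `^ q)); first by rewrite mulr_gt0 ?expR_gt0.
move=> x; apply: (@le_trans _ _ (expR (K * (M + 1) `^ q) * expR (- `|x|))).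
  rewrite -expRD ler_expR.
  by have := HK _ (M + 1) (normr_ge0 x) (addr_ge0 M0 ler01); lra.
by rewrite [4 * _]mulrC -[leRHS]mulrA ler_wpM2l ?expR_ge0// expR_norm_ker.
Qed.

End PowerEstimates.

Section TwoVariables.
Context {R : realType}.
Notation mu := (@lebesgue_measure R).
Notation mu2 := (mu \x mu)%E.
Implicit Types (F H : R[i] -> R[i] -> R[i]) (A K M N x y : R).

(* Separate holomorphy is all that the contour shifts use. *)
Definition sephol F :=
  (forall z2 z1, cdiff (F ^~ z2) z1) /\ (forall z1 z2, cdiff (F z1) z2).

(** The form in which differentiation under the integral delivers holomorphy: joint in both
    variables, with an explicit remainder, hence stronger than [sephol]. *)
Definition quad_diff F := forall z1 z2, exists a b : R[i], exists2 C : R, 0 <= C &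
  forall v1 v2, nc v1 + nc v2 <= 1 ->
  nc (F (z1 + v1) (z2 + v2) - F z1 z2 - (v1 * a + v2 * b)) <= C * (nc v1 + nc v2) ^+ 2.

Lemma quad_cdiff (f : R[i] -> R[i]) z (a : R[i]) C : 0 <= C ->
  (forall v, nc v <= 1 -> nc (f (z + v) - f z - v * a) <= C * nc v ^+ 2) -> cdiff f z.
Proof.
move=> C0 H; exists a => e e0.
have C1 : 0 < C + 1 by lra.
exists (Num.min 1 (e / (C + 1))); first by rewrite lt_min ltr01 divr_gt0.
move=> h; rewrite lt_min ltr_pdivlMr// => /andP[h1 h2].
rewrite [a * h]mulrC; apply: le_trans (H _ (ltW h1)) _.
by have := nc_ge0 h; nra.
Qed.

Lemma quad_diff_sephol F : quad_diff F -> sephol F.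
Proof.
move=> qF; split=> [z2 z1|z1 z2]; have [a [b [C C0 HC]]] := qF z1 z2.
  apply: (@quad_cdiff _ _ a _ C0) => v v1; have := HC v 0.
  by rewrite nc0 !addr0 mul0r addr0; apply.
apply: (@quad_cdiff _ _ b _ C0) => v v1; have := HC 0 v.
by rewrite nc0 add0r addr0 mul0r add0r; apply.
Qed.

Lemma sephol_ccont1 F y1 z2 : sephol F -> ccont (fun x1 => F (x1 +i* y1) z2).
Proof. by move=> [h _]; exact: (ccont_hor y1 (h z2)). Qed.

Lemma sephol_ccont2 F y2 z1 : sephol F -> ccont (fun x2 => F z1 (x2 +i* y2)).
Proof. by move=> [_ h]; exact: (ccont_hor y2 (h z1)). Qed.

(** The contours move one after the other: first that of x1 while the other stays at height y2, then
    that of x2. *)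
Lemma shift2 H : sephol H ->
  (forall Y : R, exists K : R, forall x1 x2 y1 y2 : R, `|y1| <= Y -> `|y2| <= Y ->
     nc (H (x1 +i* y1) (x2 +i* y2)) <= K * (ker x1 * ker x2)) ->
  forall y1 y2 : R,
  cI mu2 setT (fun p => H (p.1 +i* y1) (p.2 +i* y2)) =
  cI mu2 setT (fun p => H p.1%:C p.2%:C).
Proof.
move=> sH bH y1 y2; have [h1 h2] := sH.
have [K HK] := bH (Num.max `|y1| `|y2|).
have Y1 : `|y1| <= Num.max `|y1| `|y2| by rewrite le_max lexx.
have Y2 : `|y2| <= Num.max `|y1| `|y2| by rewrite le_max lexx orbT.
have Y0 : `|0 : R| <= Num.max `|y1| `|y2| by rewrite normr0 (le_trans _ Y1).
have tm t1 t2 : `|t1| <= Num.max `|y1| `|y2| -> `|t2| <= Num.max `|y1| `|y2| ->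
    tame K (fun x1 x2 => H (x1 +i* t1) (x2 +i* t2)).
  move=> T1 T2; split=> [x2|x1|x1 x2]; last exact: HK.
    exact: sephol_ccont1.
  exact: sephol_ccont2.
have K0 := tame_ge0 (tm _ _ Y1 Y2).
rewrite (tame_Fubini2 (tm _ _ Y1 Y2)).
transitivity (cI mu2 setT (fun p => H (p.1 +i* 0) (p.2 +i* y2))).
  rewrite (tame_Fubini2 (tm _ _ Y0 Y2)); apply: eq_cI => x2 _.
  apply: (@contour_shift _ (H ^~ (x2 +i* y2)) K) => // x t ty.
  apply: le_trans (HK _ _ _ _ (le_trans ty Y1) Y2) _.
  by rewrite ler_wpM2l// ler_piMr ?ker_ge0 ?ker_le1.
rewrite (tame_Fubini1 (tm _ _ Y0 Y2)) (tame_Fubini1 (tm _ _ Y0 Y0)).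
apply: eq_cI => x1 _.
apply: (@contour_shift _ (H (x1 +i* 0)) K) => // x t ty.
apply: le_trans (HK _ _ _ _ Y0 (le_trans ty Y2)) _.
by rewrite ler_wpM2l// ler_piMl ?ker_ge0 ?ker_le1.
Qed.

Definition decay p1 p2 (x1 x2 : R) : R := `|x1| `^ p1 + `|x2| `^ p2.

Lemma decay_ge0 p1 p2 (x1 x2 : R) : 0 <= decay p1 p2 x1 x2.
Proof. by rewrite addr_ge0 ?powR_ge0. Qed.

(** The bound defining type S, with one constant a and one b common to both coordinates: the least
    of the a_j and the greatest of the b_j. *)
Definition growth p1 p2 r1 r2 F := exists A a b, [/\ 0 < A, 0 < a, 0 < b &
  forall x1 y1 x2 y2, nc (F (x1 +i* y1) (x2 +i* y2)) <=
    A * expR (- (a * decay p1 p2 x1 x2) + b * decay r1 r2 y1 y2)].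

Definition rr F (x1 x2 : R) := F x1%:C x2%:C.

Definition eker (w1 w2 z1 z2 : R[i]) : R[i] := cxp ('i * (z1 * w2 - z2 * w1)).

Lemma eker_sephol w1 w2 : sephol (eker w1 w2).
Proof.
split=> [z2 z1|z1 z2]; apply: (@cdiff_comp _ cxp); try exact: cdiff_cxp.
  have -> : (fun z => 'i * (z * w2 - z2 * w1)) = (fun z => - ('i * z2 * w1) + ('i * w2) * z).
    by apply/funext => z; ring.
  exact: cdiff_affine.
have -> : (fun z => 'i * (z1 * w2 - z * w1)) = (fun z => ('i * z1 * w2) + (- 'i * w1) * z).
  by apply/funext => z; ring.
exact: cdiff_affine.
Qed.

Lemma sepholM F H : sephol F -> sephol H -> sephol (fun z1 z2 => F z1 z2 * H z1 z2).
Proof.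
by move=> [f1 f2] [h1 h2]; split=> [z2 z1|z1 z2]; [exact: cdiffM (f1 _ _) (h1 _ _)|exact: cdiffM (f2 _ _) (h2 _ _)].
Qed.

Lemma nc_eker (xi1 et1 xi2 et2 x1 y1 x2 y2 : R) :
  nc (eker (xi1 +i* et1) (xi2 +i* et2) (x1 +i* y1) (x2 +i* y2)) =
  expR (- (x1 * et2) - y1 * xi2 + (x2 * et1 + y2 * xi1)).
Proof. by rewrite nc_cxp; congr expR; rewrite !cE/=; ring. Qed.

Section Growth.
Variables (p1 p2 r1 r2 : R).
Hypothesis (pr1 : conj_exp p1 r2) (pr2 : conj_exp p2 r1).
Let p1_gt1 : 1 < p1. Proof. by case: pr1. Qed.
Let p2_gt1 : 1 < p2. Proof. by case: pr2. Qed.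

Lemma decay_ker a N : 0 < a -> 0 <= N -> exists2 K : R, 0 < K & forall x1 x2,
  expR (- (a * decay p1 p2 x1 x2) + N * (`|x1| + `|x2|)) <= K * (ker x1 * ker x2).
Proof.
move=> a0 N0.
have [K1 K10 H1] := expR_powR_ker p1_gt1 a0 N0.
have [K2 K20 H2] := expR_powR_ker p2_gt1 a0 N0.
exists (K1 * K2); first exact: mulr_gt0.
move=> x1 x2; rewrite mulrACA (_ : _ + _ = (- (a * `|x1| `^ p1) + N * `|x1|) +
  (- (a * `|x2| `^ p2) + N * `|x2|)); last by rewrite /decay; ring.
by rewrite expRD; apply: ler_pM; rewrite ?expR_ge0.
Qed.

Lemma growth_ker F N : growth p1 p2 r1 r2 F -> 0 <= N -> exists K b : R, [/\ 0 < K, 0 < b &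
  forall x1 y1 x2 y2, nc (F (x1 +i* y1) (x2 +i* y2)) * expR (N * (`|x1| + `|x2|)) <=
    K * expR (b * decay r1 r2 y1 y2) * (ker x1 * ker x2)].
Proof.
move=> [A [a [b [A0 a0 b0 HF]]]] N0; have [K K0 HK] := decay_ker a0 N0.
exists (A * K), b; split=> //; first exact: mulr_gt0.
move=> x1 y1 x2 y2; apply: le_trans (ler_wpM2r (expR_ge0 _) (HF _ _ _ _)) _.
rewrite [leLHS](_ : _ = A * (expR (- (a * decay p1 p2 x1 x2) + N * (`|x1| + `|x2|)) *
  expR (b * decay r1 r2 y1 y2))); last first.
  by rewrite -[LHS]mulrA -!expRD; congr (_ * expR _); ring.
rewrite [leRHS](_ : _ = A * ((K * (ker x1 * ker x2)) * expR (b * decay r1 r2 y1 y2))); last by ring.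
by rewrite ler_wpM2l ?(ltW A0)// ler_wpM2r ?expR_ge0.
Qed.

(** Makes the contour heights free parameters: [FT_growth] lets them depend on the frequency,
    [FT_inversion_complex] takes the imaginary part of the evaluation point. *)
Lemma eker_growth_shift F w1 w2 : sephol F -> growth p1 p2 r1 r2 F -> forall y1 y2,
  FT (rr F) w1 w2 = cI mu2 setT (fun p =>
    eker w1 w2 (p.1 +i* y1) (p.2 +i* y2) * F (p.1 +i* y1) (p.2 +i* y2)).
Proof.
move=> sF gF y1 y2.
rewrite (@shift2 (fun z1 z2 => eker w1 w2 z1 z2 * F z1 z2))//.
  exact: (sepholM (eker_sephol w1 w2) sF).
move=> Y; pose N := nc w1 + nc w2.
have N0 : 0 <= N by rewrite addr_ge0 ?nc_ge0.
have [K [b [K0 b0 HK]]] := growth_ker gF N0.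
have r10 : 0 <= r1 by case: pr2 => _ + _; lra.
have r20 : 0 <= r2 by case: pr1 => _ + _; lra.
exists (expR (Y * N) * (K * expR (b * (Y `^ r1 + Y `^ r2)))) => x1 x2 t1 t2 T1 T2.
have Y0 : 0 <= Y := le_trans (normr_ge0 _) T1.
rewrite ncM; case: w1 w2 @N N0 HK => [xi1 et1] [xi2 et2] N N0 HK; rewrite nc_eker.
apply: (@le_trans _ _ (expR (Y * N) * (K * expR (b * decay r1 r2 t1 t2) * (ker x1 * ker x2)))).
  apply: le_trans (_ : expR (Y * N) * (nc (F (x1 +i* t1) (x2 +i* t2)) * expR (N * (`|x1| + `|x2|))) <= _); last first.
    by rewrite ler_wpM2l ?expR_ge0.
  rewrite mulrCA mulrC -expRD ler_wpM2l ?nc_ge0// ler_expR.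
  have a1 : - (x1 * et2) <= `|x1| * nc (xi2 +i* et2).
    by rewrite (le_trans (ler_norm _))// normrN normrM ler_wpM2l// (nc_Im (xi2 +i* et2)).
  have a2 : - (t1 * xi2) <= Y * nc (xi2 +i* et2).
    by rewrite (le_trans (ler_norm _))// normrN normrM ler_pM// (nc_Re (xi2 +i* et2)).
  have a3 : x2 * et1 <= `|x2| * nc (xi1 +i* et1).
    by rewrite (le_trans (ler_norm _))// normrM ler_wpM2l// (nc_Im (xi1 +i* et1)).
  have a4 : t2 * xi1 <= Y * nc (xi1 +i* et1).
    by rewrite (le_trans (ler_norm _))// normrM ler_pM// (nc_Re (xi1 +i* et1)).
  have := nc_ge0 (xi1 +i* et1); have := nc_ge0 (xi2 +i* et2).
  by have := normr_ge0 x1; have := normr_ge0 x2; rewrite /N; nra.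
rewrite -!mulrA ler_wpM2l ?expR_ge0// ler_wpM2l ?(ltW K0)//.
rewrite ler_wpM2r ?mulr_ge0 ?ker_ge0// ler_expR ler_wpM2l ?(ltW b0)//.
by rewrite lerD// ge0_ler_powR// nnegrE.
Qed.

Let young2 p q a : conj_exp p q -> 0 < a -> exists2 K : R, 0 < K &
  forall x t, x * t <= a * `|x| `^ p + K * `|t| `^ q.
Proof.
move=> pq a0; have [K K0 HK] := young_powR pq a0; exists K => // x t.
by apply: le_trans (HK _ _ (normr_ge0 x) (normr_ge0 t)); rewrite -normrM ler_norm.
Qed.

Let opt2 p q b : conj_exp p q -> 0 < b -> exists2 a : R, 0 < a &
  forall t, exists y : R, b * `|y| `^ q - y * t <= - (a * `|t| `^ p).
Proof.
move=> pq b0; have [a a0 Ha] := opt_powR pq b0; exists a => // t.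
have [y y0 Hy] := Ha _ (normr_ge0 t).
have [t0|t0] := leP 0 t.
  by exists y; rewrite [`|y|]ger0_norm//; rewrite (ger0_norm t0) in Hy *.
exists (- y); rewrite normrN [`|y|]ger0_norm//; move: Hy.
by rewrite (ltr0_norm t0) mulrN mulNr.
Qed.

(** On the shifted contour the kernel contributes exp (- y1 xi2 + y2 xi1), whose optimisation
    against the growth of F gives decay in xi, and exp (x2 et1 - x1 et2), which Young's inequality
    bounds by half the decay of F in x and growth in et. *)
Lemma FT_growth F : sephol F -> growth p1 p2 r1 r2 F -> growth p1 p2 r1 r2 (FT (rr F)).
Proof.
move=> sF gF; have [A [a [b [A0 a0 b0 HF]]]] := gF.
(* Half of the decay of F pays for Young's inequality, the other half for integrability. *)
have a20 : 0 < a / 2 by rewrite divr_gt0.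
have [K1 K10 HK1] := young2 pr1 a20; have [K2 K20 HK2] := young2 pr2 a20.
have [a1 a10 Ha1] := opt2 pr1 b0; have [a2 a20' Ha2] := opt2 pr2 b0.
have [K3 K30 HK3] := decay_ker a20 (lexx 0).
pose I := \int[mu2]_p (ker p.1 * ker p.2).
have I0 : 0 <= I by apply: Rintegral_ge0 => p _; rewrite mulr_ge0 ?ker_ge0.
exists (A * K3 * (I + 1)), (Num.min a1 a2), (Num.max K1 K2); split.
- by rewrite !mulr_gt0// ltr_wpDl.
- by rewrite lt_min a10.
- by rewrite lt_max K10.
move=> xi1 et1 xi2 et2.
(* The symplectic kernel couples y1 to xi2 and y2 to xi1 with opposite signs, whence the crossed
   indices and - xi1. *)
have [y1 Hy1] := Ha2 xi2; have [y2 Hy2] := Ha1 (- xi1).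
rewrite (eker_growth_shift _ _ sF gF y1 y2).
set D := expR (_ + _).
have D0 : 0 < D := expR_gt0 _.
have bnd (x1 x2 : R) : nc (eker (xi1 +i* et1) (xi2 +i* et2) (x1 +i* y1) (x2 +i* y2) *
    F (x1 +i* y1) (x2 +i* y2)) <= (A * K3 * D) * (ker x1 * ker x2).
  rewrite ncM nc_eker; apply: le_trans (ler_wpM2l (expR_ge0 _) (HF _ _ _ _)) _.
  rewrite mulrCA -expRD -!mulrA ler_wpM2l ?(ltW A0)//.
  apply: (@le_trans _ _ (D * expR (- (a / 2 * decay p1 p2 x1 x2) + 0 * (`|x1| + `|x2|)))); last first.
    by rewrite mulrCA ler_wpM2l// ltW.
  rewrite -expRD ler_expR mul0r addr0.
  have e1 := HK1 (- x1) et2; have e2 := HK2 x2 et1; rewrite normrN in e1.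
  rewrite normrN in Hy2.
  have m1 : Num.min a1 a2 * `|xi1| `^ p1 <= a1 * `|xi1| `^ p1.
    by rewrite ler_wpM2r ?powR_ge0// ge_min lexx.
  have m2 : Num.min a1 a2 * `|xi2| `^ p2 <= a2 * `|xi2| `^ p2.
    by rewrite ler_wpM2r ?powR_ge0// ge_min lexx orbT.
  have m3 : K1 * `|et2| `^ r2 <= Num.max K1 K2 * `|et2| `^ r2.
    by rewrite ler_wpM2r ?powR_ge0// le_max lexx.
  have m4 : K2 * `|et1| `^ r1 <= Num.max K1 K2 * `|et1| `^ r1.
    by rewrite ler_wpM2r ?powR_ge0// le_max lexx orbT.
  by rewrite /decay; lra.
have iB : rint mu2 setT (fun p => (A * K3 * D) * (ker p.1 * ker p.2)).
  by apply: rintZ => //; exact: rint_ker2.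
apply: le_trans (_ : \int[mu2]_p ((A * K3 * D) * (ker p.1 * ker p.2)) <= _).
  apply: (le_cI measurableT _ iB) => [|p _]; last exact: bnd.
  have sH := sepholM (eker_sephol (xi1 +i* et1) (xi2 +i* et2)) sF.
  apply: (@tame_int _ (A * K3 * D) (fun x1 x2 => eker (xi1 +i* et1) (xi2 +i* et2)
    (x1 +i* y1) (x2 +i* y2) * F (x1 +i* y1) (x2 +i* y2))); split=> //.
    by move=> x2; exact: (sephol_ccont1 y1 (x2 +i* y2) sH).
  by move=> x1; exact: (sephol_ccont2 y2 (x1 +i* y1) sH).
rewrite RintegralZl//; last exact: rint_ker2.
rewrite -/I [leRHS]mulrAC ler_wpM2l ?lerDl//.
by rewrite !mulr_ge0// ltW.
Qed.

Lemma growth_tame F y1 y2 : sephol F -> growth p1 p2 r1 r2 F ->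
  exists K, tame K (fun x1 x2 => F (x1 +i* y1) (x2 +i* y2)).
Proof.
move=> sF gF; have [K [b [K0 b0 HK]]] := growth_ker gF (lexx 0).
exists (K * expR (b * decay r1 r2 y1 y2)); split=> [x2|x1|x1 x2].
- exact: sephol_ccont1.
- exact: sephol_ccont2.
- by have := HK x1 y1 x2 y2; rewrite mul0r expR0 mulr1.
Qed.

End Growth.
End TwoVariables.

Section Twisted.
Context {R : realType}.
Notation mu := (@lebesgue_measure R).
Notation mu2 := (mu \x mu)%E.
Implicit Types (F G H : R[i] -> R[i] -> R[i]) (f g h : R -> R -> R[i]) (K M x y : R).

(** What real values alone must satisfy for the Fourier transform to exist at all complex
    frequencies: decay beating every exponential. *)
Definition superexp f := [/\ forall x2, ccont (f ^~ x2), forall x1, ccont (f x1) &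
  forall N, 0 <= N -> exists2 K : R, 0 <= K &
    forall x1 x2, expR (N * (`|x1| + `|x2|)) * nc (f x1 x2) <= K * (ker x1 * ker x2)].

Lemma superexp_tame f : superexp f -> exists K, tame K f.
Proof.
move=> [f1 f2 fN]; have [K K0 HK] := fN 0 (lexx 0); exists K; split=> // x1 x2.
by have := HK x1 x2; rewrite mul0r expR0 mul1r.
Qed.

Lemma growth_superexp p1 p2 r1 r2 F : conj_exp p1 r2 -> conj_exp p2 r1 ->
  sephol F -> growth p1 p2 r1 r2 F -> superexp (rr F).
Proof.
move=> pr1 pr2 sF gF; split=> [x2|x1|N N0].
- exact: (sephol_ccont1 0 x2%:C sF).
- exact: (sephol_ccont2 0 x1%:C sF).
have [K [b [K0 b0 HK]]] := growth_ker pr1 pr2 gF N0.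
exists (K * expR (b * decay r1 r2 0 0)); first by rewrite mulr_ge0 ?expR_ge0// ltW.
by move=> x1 x2; rewrite mulrC; exact: HK.
Qed.

Lemma FT_quad_diff f : superexp f -> quad_diff (FT f).
Proof.
move=> sf w1 w2; have [K tf] := superexp_tame sf; have [f1 f2 fN] := sf.
pose l1 (p : R * R) : R[i] := - 'i * p.2%:C; pose l2 (p : R * R) : R[i] := 'i * p.1%:C.
have m1 : cmeas setT l1.
  by apply: cmeasM; [exact: cmeas_cst|exact: cmeas_real].
have m2 : cmeas setT l2.
  by apply: cmeasM; [exact: cmeas_cst|exact: cmeas_real].
have mf := tame_meas tf.
have FE z1 z2 : FT f z1 z2 = EI mu2 l1 l2 (fun p => f p.1 p.2) z1 z2.
  apply: eq_cI => p _; rewrite /l1 /l2; congr (cxp _ * _); ring.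
have n1 p : nc (l1 p) = `|p.2| by rewrite /l1 ncM ncN nc_i mul1r nc_real.
have n2 p : nc (l2 p) = `|p.1| by rewrite /l2 ncM nc_i mul1r nc_real.
have [|C C0 HC] := @EI_complex_quad _ _ _ mu2 _ _ m1 m2 _ mf _ w1 w2.
  move=> M M0; have [K' K'0 HK'] := fN M M0.
  apply: (@rint_dom _ _ _ mu2 setT measurableT _ (fun p => K' * (ker p.1 * ker p.2))).
  - apply: measurable_funM; last exact: cmeas_nc.
    apply: measurableT_comp => //; apply: measurable_funM; first exact: measurable_cst.
    by apply: measurable_funD; exact: cmeas_nc.
  - by apply: rintZ => //; exact: rint_ker2.
  - move=> p _; rewrite n1 n2 ger0_norm; last by rewrite mulr_ge0 ?expR_ge0 ?nc_ge0.
    by rewrite addrC.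
by do 2 eexists; exists C => // v1 v2 v; rewrite !FE; exact: HC v.
Qed.

Lemma FT_integrand (w1 w2 : R[i]) f : superexp f ->
  cint mu2 setT (fun p => cxp ('i * (p.1%:C * w2 - p.2%:C * w1)) * f p.1 p.2).
Proof.
move=> ef; have [_ _ fN] := ef; have [K tf] := superexp_tame ef.
have N0 : 0 <= nc w1 + nc w2 by rewrite addr_ge0 ?nc_ge0.
have [C C0 HC] := fN _ N0.
apply: (@cint_ker2 _ C).
  apply: cmeasM; last exact: tame_meas tf.
  apply: cmeas_cxp; apply: cmeasM; first exact: cmeas_cst.
  apply: cmeasD; last apply: cmeasN.
    by apply: cmeasM; [exact: cmeas_real|exact: cmeas_cst].
  by apply: cmeasM; [exact: cmeas_real|exact: cmeas_cst].
move=> p; rewrite ncM; apply: le_trans (HC p.1 p.2).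
rewrite ler_wpM2r ?nc_ge0// nc_cxp ler_expR.
apply: le_trans (ler_norm _) _; apply: le_trans (nc_Re _) _.
rewrite ncM nc_i mul1r; apply: le_trans (ncB _ _) _; rewrite !ncM !nc_real.
have := nc_ge0 w1; have := nc_ge0 w2; have := normr_ge0 p.1; have := normr_ge0 p.2; nra.
Qed.

End Twisted.

(** * The twisted convolution *)

Section Twisted2.
Context {R : realType}.
Notation mu := (@lebesgue_measure R).
Notation mu2 := (mu \x mu)%E.
Implicit Types (F G H : R[i] -> R[i] -> R[i]) (f g h : R -> R -> R[i]) (K M x y : R).

(** The restriction of F to R^2 + i (y1, y2) has as transform FT F times a real exponential, by the
    contour shift. Real inversion for this restriction is the claim at the complex point. *)
Lemma FT_inversion_complex p1 p2 r1 r2 F : conj_exp p1 r2 -> conj_exp p2 r1 ->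
  sephol F -> growth p1 p2 r1 r2 F -> forall z1 z2,
  FT (rr (FT (rr F))) z1 z2 = ((2 * pi) ^+ 2)%:C * F z1 z2.
Proof.
move=> pr1 pr2 sF gF [x1 y1] [x2 y2].
have gFT := FT_growth pr1 pr2 sF gF.
have sFT : sephol (FT (rr F)).
  exact/quad_diff_sephol/FT_quad_diff/(growth_superexp pr1 pr2 sF gF).
pose f (u1 u2 : R) := F (u1 +i* y1) (u2 +i* y2).
have [K tf] := growth_tame pr1 pr2 y1 y2 sF gF.
have [Kr tr] := growth_tame pr1 pr2 0 0 sF gF.
have fE (xi1 xi2 : R) : FT f xi1%:C xi2%:C =
    (expR (y1 * xi2 - y2 * xi1))%:C * FT (rr F) xi1%:C xi2%:C.
  rewrite (eker_growth_shift pr1 pr2 xi1%:C xi2%:C sF gF y1 y2) -cIZ//.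
    apply: eq_cI => p _; rewrite mulrA -cxp_real -cxpD; congr (cxp _ * _).
    by apply: complex_eqP; rewrite !cE/=; ring.
  have := cintZ measurableT (expR (- (y1 * xi2) + y2 * xi1))%:C (tame_int (tame_phase xi1 xi2 tf)).
  congr cint; apply/funext => p; rewrite mulrA -phase2E -cxp_real -cxpD; congr (cxp _ * _).
  by apply: complex_eqP; rewrite !cE/=; ring.
pose N := `|y1| + `|y2|.
have N0 : 0 <= N by rewrite addr_ge0.
have [K1 [b [K10 b0 HK1]]] := growth_ker pr1 pr2 gFT N0.
have bf (xi1 xi2 : R) : nc (FT f xi1%:C xi2%:C) <=
    (K1 * expR (b * decay r1 r2 0 0)) * (ker xi1 * ker xi2).
  rewrite fE nc_realM ger0_norm ?expR_ge0// mulrC; apply: le_trans (HK1 xi1 0 xi2 0).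
  rewrite ler_wpM2l ?nc_ge0// ler_expR /N.
  have a1 : y1 * xi2 <= `|y1| * `|xi2| by rewrite -normrM ler_norm.
  have a2 : - (y2 * xi1) <= `|y2| * `|xi1| by rewrite -normrM -normrN ler_norm.
  have := normr_ge0 y1; have := normr_ge0 y2; have := normr_ge0 xi1.
  by have := normr_ge0 xi2; nra.
rewrite -[F _ _]/(f x1 x2) -(FT_inversion x1 x2 tf bf) FT_real.
apply: eq_cI => p _; rewrite fE /rr mulrA; congr (_ * _).
rewrite -phase2E -cxp_real -cxpD; congr cxp.
by apply: complex_eqP; rewrite !cE/=; ring.
Qed.

Definition TC q F G (w1 w2 : R[i]) : R[i] :=
  cI mu2 setT (fun p => cxp ('i * q%:C * (w1 * p.2%:C - w2 * p.1%:C)) *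
    F p.1%:C p.2%:C * G (w1 - p.1%:C) (w2 - p.2%:C)).

(** Integration stays on R^2, so et enters only through G and the twist. The twist q (et2 y1 - et1
    y2) is absorbed by Young's inequality, and decay in xi comes from |xi|^p <= 2^p (|y|^p + |xi -
    y|^p). *)
Lemma TC_growth q p1 p2 r1 r2 F G : conj_exp p1 r2 -> conj_exp p2 r1 ->
  sephol F -> sephol G ->
  growth p1 p2 r1 r2 F -> growth p1 p2 r1 r2 G -> growth p1 p2 r1 r2 (TC q F G).
Proof.
move=> pr1 pr2 sF sG [A [a [b [A0 a0 b0 HF]]]] [A' [a' [b' [A'0 a'0 b'0 HG]]]].
(* The decay m |y|^p is spent in three portions: m/2 for the decay in xi, m/4 for the twist, m/4 for
   integrability. *)
pose m := Num.min a a'.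
have m0 : 0 < m by rewrite lt_min a0.
have m4 : 0 < m / 4 by rewrite divr_gt0.
have [K1 K10 HK1] := young_powR pr1 m4; have [K2 K20 HK2] := young_powR pr2 m4.
have [K3 K30 HK3] := decay_ker pr1 pr2 m4 (lexx 0).
pose I := \int[mu2]_p (ker p.1 * ker p.2).
have I0 : 0 <= I by apply: Rintegral_ge0 => p _; rewrite mulr_ge0 ?ker_ge0.
have p1_gt0 : 0 < p1 by case: pr1; lra.
have p2_gt0 : 0 < p2 by case: pr2; lra.
have r1_gt0 : 0 < r1 by case: pr2; lra.
have r2_gt0 : 0 < r2 by case: pr1; lra.
pose c1 := m / 2 / 2 `^ p1; pose c2 := m / 2 / 2 `^ p2.
have c10 : 0 < c1 by rewrite !divr_gt0// powR_gt0.
have c20 : 0 < c2 by rewrite !divr_gt0// powR_gt0.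
pose d1 := b' + K2 * `|q| `^ r1; pose d2 := b' + K1 * `|q| `^ r2.
have d10 : 0 < d1 by rewrite ltr_wpDr// mulr_ge0 ?powR_ge0// ltW.
have d20 : 0 < d2 by rewrite ltr_wpDr// mulr_ge0 ?powR_ge0// ltW.
pose B := A * expR (b * decay r1 r2 0 0) * A' * K3.
have B0 : 0 < B by rewrite !mulr_gt0 ?expR_gt0.
exists (B * (I + 1)), (Num.min c1 c2), (Num.max d1 d2); split.
- by rewrite mulr_gt0// ltr_wpDl.
- by rewrite lt_min c10.
- by rewrite lt_max d10.
move=> xi1 et1 xi2 et2; set D := expR (_ + _).
have D0 : 0 < D := expR_gt0 _.
have tri c p (u v : R) : 0 < p -> c / 2 `^ p * `|u| `^ p <= c * (`|v| `^ p + `|u - v| `^ p) \/ c < 0.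
  move=> p0; have [c0|c0] := leP 0 c; [left|by right].
  rewrite -mulrA ler_wpM2l// ler_pdivrMl ?powR_gt0//.
  apply: le_trans (powRD_le _ (normr_ge0 _) (normr_ge0 _)); last exact: ltW.
  apply: ge0_ler_powR; rewrite ?nnegrE ?addr_ge0// ?(ltW p0)//.
  by apply: le_trans (ler_normD _ _); rewrite addrC subrK.
have bnd (y1 y2 : R) : nc (cxp ('i * q%:C * ((xi1 +i* et1) * y2%:C - (xi2 +i* et2) * y1%:C)) *
    F y1%:C y2%:C * G ((xi1 +i* et1) - y1%:C) ((xi2 +i* et2) - y2%:C)) <=
    (B * D) * (ker y1 * ker y2).
  rewrite !ncM nc_cxp.
  set X := cRe _.
  have XE : X = q * (et2 * y1 - et1 * y2) by rewrite /X !cE/=; ring.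
  have -> : (xi1 +i* et1) - y1%:C = (xi1 - y1) +i* et1.
    by apply: complex_eqP; rewrite !cE/= ?subr0.
  have -> : (xi2 +i* et2) - y2%:C = (xi2 - y2) +i* et2.
    by apply: complex_eqP; rewrite !cE/= ?subr0.
  have hF := HF y1 0 y2 0; have hG := HG (xi1 - y1) et1 (xi2 - y2) et2.
  rewrite -[leLHS]mulrA.
  apply: le_trans (ler_wpM2l (expR_ge0 X) (ler_pM (nc_ge0 _) (nc_ge0 _) hF hG)) _.
  have h3 := HK3 y1 y2; rewrite mul0r addr0 in h3.
  have AA0 : 0 <= A * expR (b * decay r1 r2 0 0) * A'.
    exact: (mulr_ge0 (mulr_ge0 (ltW A0) (expR_ge0 _)) (ltW A'0)).
  apply: (@le_trans _ _ (A * expR (b * decay r1 r2 0 0) * A' * D * expR (- (m / 4 * decay p1 p2 y1 y2)))); last first.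
    rewrite [leRHS](_ : _ = A * expR (b * decay r1 r2 0 0) * A' * D * (K3 * (ker y1 * ker y2))); last by rewrite /B; ring.
    exact: (ler_wpM2l (mulr_ge0 AA0 (ltW D0)) h3).
  rewrite [leLHS](_ : _ = A * expR (b * decay r1 r2 0 0) * A' *
     expR (X - a * decay p1 p2 y1 y2 - a' * decay p1 p2 (xi1 - y1) (xi2 - y2) + b' * decay r1 r2 et1 et2)); last first.
    by rewrite !expRD; ring.
  rewrite -[leRHS]mulrA; apply: (ler_wpM2l AA0).
  rewrite -expRD ler_expR XE.
  have e1 : q * (et2 * y1) <= m / 4 * `|y1| `^ p1 + K1 * (`|q| `^ r2 * `|et2| `^ r2).
    rewrite -powRM//; apply: le_trans (HK1 _ _ (normr_ge0 y1) (mulr_ge0 (normr_ge0 q) (normr_ge0 et2))).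
    by rewrite -!normrM (_ : q * (et2 * y1) = y1 * (q * et2)) ?ler_norm//; ring.
  have e2 : - (q * (et1 * y2)) <= m / 4 * `|y2| `^ p2 + K2 * (`|q| `^ r1 * `|et1| `^ r1).
    rewrite -powRM//; apply: le_trans (HK2 _ _ (normr_ge0 y2) (mulr_ge0 (normr_ge0 q) (normr_ge0 et1))).
    rewrite -!normrM (_ : q * (et1 * y2) = y2 * (q * et1)); last by ring.
    by rewrite -normrN ler_norm.
  have m20 : 0 < m / 2 by rewrite divr_gt0.
  have [e3|] := tri (m / 2) p1 xi1 y1 p1_gt0; last by lra.
  have [e4|] := tri (m / 2) p2 xi2 y2 p2_gt0; last by lra.
  rewrite -/c1 in e3; rewrite -/c2 in e4.
  have ma : m <= a by rewrite ge_min lexx.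
  have ma' : m <= a' by rewrite ge_min lexx orbT.
  have f1 : m * decay p1 p2 y1 y2 <= a * decay p1 p2 y1 y2 by rewrite ler_wpM2r ?decay_ge0.
  have f2 : m * decay p1 p2 (xi1 - y1) (xi2 - y2) <= a' * decay p1 p2 (xi1 - y1) (xi2 - y2).
    by rewrite ler_wpM2r ?decay_ge0.
  have g1 : Num.min c1 c2 * `|xi1| `^ p1 <= c1 * `|xi1| `^ p1.
    by rewrite ler_wpM2r ?powR_ge0// ge_min lexx.
  have g2 : Num.min c1 c2 * `|xi2| `^ p2 <= c2 * `|xi2| `^ p2.
    by rewrite ler_wpM2r ?powR_ge0// ge_min lexx orbT.
  have g3 : d1 * `|et1| `^ r1 <= Num.max d1 d2 * `|et1| `^ r1.
    by rewrite ler_wpM2r ?powR_ge0// le_max lexx.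
  have g4 : d2 * `|et2| `^ r2 <= Num.max d1 d2 * `|et2| `^ r2.
    by rewrite ler_wpM2r ?powR_ge0// le_max lexx orbT.
  have z1 : 0 <= `|xi1 - y1| `^ p1 := powR_ge0 _ _.
  have z2 : 0 <= `|xi2 - y2| `^ p2 := powR_ge0 _ _.
  have z3 := mulr_ge0 (ltW m20) z1; have z4 := mulr_ge0 (ltW m20) z2.
  move: f1 f2; rewrite /d1 /d2 in g3 g4; rewrite /decay; lra.
have iB : rint mu2 setT (fun p => (B * D) * (ker p.1 * ker p.2)).
  by apply: rintZ => //; exact: rint_ker2.
apply: le_trans (_ : \int[mu2]_p ((B * D) * (ker p.1 * ker p.2)) <= _).
  apply: (le_cI measurableT _ iB) => [|p _]; last exact: bnd.
  apply: (@tame_int _ (B * D) (fun y1 y2 => cxp ('i * q%:C * ((xi1 +i* et1) * y2%:C - (xi2 +i* et2) * y1%:C)) *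
    F y1%:C y2%:C * G ((xi1 +i* et1) - y1%:C) ((xi2 +i* et2) - y2%:C))); split=> // [y2|y1].
    apply: ccontM.
      apply: ccontM; last exact: (sephol_ccont1 0 y2%:C sF).
      apply: ccont_cxp; apply: ccontM; first exact: ccont_cst.
      apply: ccontD; first exact: ccont_cst.
      by apply: ccontN; apply: ccontM; [exact: ccont_cst|exact: ccont_id].
    have [s1 _] := sG; have := ccont_line (xi1 +i* et1) (-1) (s1 (xi2 +i* et2 - y2%:C)).
    by under eq_fun do rewrite mulrN1.
  apply: ccontM.
    apply: ccontM; last exact: (sephol_ccont2 0 y1%:C sF).
    apply: ccont_cxp; apply: ccontM; first exact: ccont_cst.
    apply: ccontD; last exact: ccont_cst.
    by apply: ccontM; [exact: ccont_cst|exact: ccont_id].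
  have [_ s2] := sG; have := ccont_line (xi2 +i* et2) (-1) (s2 (xi1 +i* et1 - y1%:C)).
  by under eq_fun do rewrite mulrN1.
rewrite RintegralZl//; last exact: rint_ker2.
rewrite -/I [leRHS]mulrAC ler_wpM2l ?lerDl//.
by rewrite mulr_ge0// ltW.
Qed.

End Twisted2.

Section PlaneMeasure.
Context {R : realType}.
Notation mu := (@lebesgue_measure R).

(* The product measure again, under a name that carries a sigma-finite instance, so that
   Fubini applies on R^2 x R^2. *)
Definition plane := (mu \x mu)%E.
HB.instance Definition _ := Measure.copy plane (mu \x mu)%E.
Lemma plane_sigma_finite : sigma_finite setT plane.
Proof.
have /sigma_finiteP[F [TF ndF Foo]] := sigma_finiteT mu.
exists (fun n => F n `*` F n).
  rewrite -setXTT {1 2}TF predeqE => -[x y]; split.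
    move=> [/= [n _ Fnx] [k _ Gky]]; exists (maxn n k) => //; split.
    - by move: x Fnx; exact/subsetPset/ndF/leq_maxl.
    - by move: y Gky; exact/subsetPset/ndF/leq_maxr.
  by move=> [n _ []/= ? ?]; split; exists n.
move=> k; have [? ?] := Foo k.
split; first exact: measurableX.
by rewrite [X in (X < _)%E]product_measure1E// lte_mul_pinfty// ge0_fin_numE.
Qed.
HB.instance Definition _ := Measure_isSigmaFinite.Build _ _ _ plane plane_sigma_finite.

End PlaneMeasure.

Section Twisted3.
Context {R : realType}.
Notation mu := (@lebesgue_measure R).
Notation mu2 := (mu \x mu)%E.
Implicit Types (F G H : R[i] -> R[i] -> R[i]) (f g h : R -> R -> R[i]) (K M x y : R).

(** One product bound supplies integrability on R^2 x R^2 and on all sections, the two requirements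
    of [cFubini1] and [cFubini2]. *)
Lemma cint_pair K M (W : (R * R) * (R * R) -> R[i]) :
  0 <= K -> 0 <= M -> cmeas setT W ->
  (forall s, nc (W s) <= (K * (ker s.1.1 * ker s.1.2)) * (M * (ker s.2.1 * ker s.2.2))) ->
  [/\ cint (plane \x plane)%E setT W, forall p, cint mu2 setT (fun t => W (p, t)) &
      forall t, cint mu2 setT (fun p => W (p, t))].
Proof.
move=> K0 M0 mW bW.
have k20 (p : R * R) : 0 <= ker p.1 * ker p.2 by rewrite mulr_ge0 ?ker_ge0.
have i2 N : rint mu2 setT (fun p : R * R => N * (ker p.1 * ker p.2)).
  by apply: rintZ => //; exact: rint_ker2.
split.
- apply: (@cint_dom _ _ _ (plane \x plane)%E setT measurableT W
    (fun s => (K * (ker s.1.1 * ker s.1.2)) * (M * (ker s.2.1 * ker s.2.2)))) => //.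
  apply: (@rint_prod _ _ _ _ _ plane plane (fun p => K * (ker p.1 * ker p.2))
    (fun p => M * (ker p.1 * ker p.2))) => // p; exact: mulr_ge0.
- move=> p; apply: (@cint_ker2 _ ((K * (ker p.1 * ker p.2)) * M)).
    by apply: (@cmeas_comp _ _ _ _ _ W (fun t => (p, t))) => //; exact: measurable_pair1.
  by move=> t; rewrite -mulrA; exact: bW.
- move=> t; apply: (@cint_ker2 _ (K * (M * (ker t.1 * ker t.2)))).
    by apply: (@cmeas_comp _ _ _ _ _ W (fun p => (p, t))) => //; exact: measurable_pair2.
  by move=> p; rewrite mulrAC; exact: bW.
Qed.

Section Measurability4.
Let T4 := ((R * R) * (R * R))%type.

Lemma meas11 : measurable_fun setT (fun s : T4 => s.1.1).
Proof. by apply: (@measurableT_comp _ _ _ _ _ _ fst) => //. Qed.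
Lemma meas12 : measurable_fun setT (fun s : T4 => s.1.2).
Proof. by apply: (@measurableT_comp _ _ _ _ _ _ snd) => //. Qed.
Lemma meas21 : measurable_fun setT (fun s : T4 => s.2.1).
Proof. by apply: (@measurableT_comp _ _ _ _ _ _ fst) => //. Qed.
Lemma meas22 : measurable_fun setT (fun s : T4 => s.2.2).
Proof. by apply: (@measurableT_comp _ _ _ _ _ _ snd) => //. Qed.

Lemma cmeas_phase4 (u : T4 -> R) : measurable_fun setT u ->
  cmeas setT (fun s => cxp ('i * (u s)%:C)).
Proof.
move=> mu'; apply: cmeas_cxp; apply: cmeasM; first exact: cmeas_cst.
exact: cmeas_real.
Qed.

End Measurability4.

(* Writing G as a Fourier integral turns [TC q F G] into an exponential integral over R^2 x R^2,
   hence an entire function. *)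
Lemma TC_quad_diff q F G (c : R[i]) :
  superexp (rr F) -> superexp (rr (FT (rr G))) ->
  (forall z1 z2, G z1 z2 = c * FT (rr (FT (rr G))) z1 z2) ->
  quad_diff (TC q F G).
Proof.
move=> eF eG Ginv w1 w2.
pose f := rr F; pose g := rr (FT (rr G)).
have [K1 tf] := superexp_tame eF; have [K2 tg] := superexp_tame eG.
(* With s = (p, t), p the convolution variable and t the frequency of G, [l1] and [l2] collect the
   coefficients of w1 and w2 in the twist and in the Fourier kernel; the phase between p and t goes
   into h. *)
pose l1 (s : (R * R) * (R * R)) : R[i] := 'i * (q * s.1.2 - s.2.2)%:C.
pose l2 (s : (R * R) * (R * R)) : R[i] := 'i * (s.2.1 - q * s.1.1)%:C.
pose h (s : (R * R) * (R * R)) : R[i] := c * (cxp ('i * (s.2.2 * s.1.1 - s.2.1 * s.1.2)%:C) *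
   (f s.1.1 s.1.2 * g s.2.1 s.2.2)).
have m11 := meas11; have m12 := meas12; have m21 := meas21; have m22 := meas22.
have mq (u : (R * R) * (R * R) -> R) : measurable_fun setT u -> measurable_fun setT (fun s => q * u s).
  by move=> ?; apply: measurable_funM => //; exact: measurable_cst.
have ml1 : cmeas setT l1.
  apply: cmeasM; first exact: cmeas_cst.
  by apply: cmeas_real; apply: measurable_funB => //; exact: mq.
have ml2 : cmeas setT l2.
  apply: cmeasM; first exact: cmeas_cst.
  by apply: cmeas_real; apply: measurable_funB => //; exact: mq.
have mh : cmeas setT h.
  apply: cmeasM; first exact: cmeas_cst.
  apply: cmeasM.
    by apply: cmeas_phase4; apply: measurable_funB; exact: measurable_funM.
  apply: cmeasM.
    by apply: (@cmeas_comp _ _ _ _ _ (fun p => f p.1 p.2) fst) => //; exact: tame_meas tf.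
  by apply: (@cmeas_comp _ _ _ _ _ (fun p => g p.1 p.2) snd) => //; exact: tame_meas tg.
have nh s : nc (h s) = nc c * (nc (f s.1.1 s.1.2) * nc (g s.2.1 s.2.2)).
  by rewrite /h ncM nc_phaseM ncM.
have nl s : nc (l1 s) + nc (l2 s) <=
    (1 + `|q|) * (`|s.1.1| + `|s.1.2|) + (1 + `|q|) * (`|s.2.1| + `|s.2.2|).
  rewrite /l1 /l2 !ncM !nc_i !nc_real !mul1r.
  have e1 := ler_normB (q * s.1.2) s.2.2; have e2 := ler_normB s.2.1 (q * s.1.1).
  rewrite !normrM in e1 e2.
  have := normr_ge0 q; have := normr_ge0 s.1.1; have := normr_ge0 s.1.2.
  by have := normr_ge0 s.2.1; have := normr_ge0 s.2.2; nra.
have ihM M : 0 <= M -> rint (plane \x plane)%E setT (fun s => expR (M * (nc (l1 s) + nc (l2 s))) * nc (h s)).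
  move=> M0; have M'0 : 0 <= M * (1 + `|q|) by rewrite mulr_ge0// addr_ge0.
  have [_ _ /(_ _ M'0)[C1 C10 HC1]] := eF; have [_ _ /(_ _ M'0)[C2 C20 HC2]] := eG.
  have k20 (p : R * R) : 0 <= ker p.1 * ker p.2 by rewrite mulr_ge0 ?ker_ge0.
  apply: (@rint_dom _ _ _ (plane \x plane)%E setT measurableT _
    (fun s => nc c * ((C1 * (ker s.1.1 * ker s.1.2)) * (C2 * (ker s.2.1 * ker s.2.2))))).
  - apply: measurable_funM; last exact: cmeas_nc.
    apply: measurableT_comp => //; apply: measurable_funM; first exact: measurable_cst.
    by apply: measurable_funD; exact: cmeas_nc.
  - apply: rintZ => //.
    apply: (@rint_prod _ _ _ _ _ plane plane (fun p => C1 * (ker p.1 * ker p.2))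
      (fun p => C2 * (ker p.1 * ker p.2))).
    + by move=> p; exact: mulr_ge0.
    + by move=> p; exact: mulr_ge0.
    + by apply: rintZ => //; exact: rint_ker2.
    + by apply: rintZ => //; exact: rint_ker2.
  move=> s _; rewrite ger0_norm; last by rewrite mulr_ge0 ?expR_ge0 ?nc_ge0.
  rewrite nh mulrCA ler_wpM2l ?nc_ge0//.
  have H1 := HC1 s.1.1 s.1.2; have H2 := HC2 s.2.1 s.2.2.
  apply: le_trans (ler_pM _ _ H1 H2); rewrite ?mulr_ge0 ?expR_ge0 ?nc_ge0//.
  rewrite mulrACA -expRD ler_wpM2r ?mulr_ge0 ?nc_ge0// ler_expR.
  by rewrite -!mulrA -mulrDr ler_wpM2l.
have TCE z1 z2 : TC q F G z1 z2 = EI (plane \x plane)%E l1 l2 h z1 z2.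
  pose W s := cxp (l1 s * z1 + l2 s * z2) * h s.
  have mW : cmeas setT W.
    apply: cmeasM => //; apply: cmeas_cxp.
    by apply: cmeasD; apply: cmeasM => //; exact: cmeas_cst.
  pose Z := nc z1 + nc z2.
  have Z0 : 0 <= Z by rewrite addr_ge0 ?nc_ge0.
  have M'0 : 0 <= Z * (1 + `|q|) by rewrite mulr_ge0// addr_ge0.
  have [_ _ /(_ _ M'0)[C1 C10 HC1]] := eF; have [_ _ /(_ _ M'0)[C2 C20 HC2]] := eG.
  have kc : 0 <= nc c * C1 by rewrite mulr_ge0 ?nc_ge0.
  have bW s : nc (W s) <= (nc c * C1 * (ker s.1.1 * ker s.1.2)) * (C2 * (ker s.2.1 * ker s.2.2)).
    rewrite /W ncM nc_cxp nh mulrCA -[nc c * C1 * _]mulrA -[leRHS]mulrA ler_wpM2l ?nc_ge0//.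
    have H1 := HC1 s.1.1 s.1.2; have H2 := HC2 s.2.1 s.2.2.
    apply: le_trans (ler_pM _ _ H1 H2); rewrite ?mulr_ge0 ?expR_ge0 ?nc_ge0//.
    rewrite mulrACA -expRD ler_wpM2r ?mulr_ge0 ?nc_ge0// ler_expR.
    have hRe : cRe (l1 s * z1 + l2 s * z2) <= (nc (l1 s) + nc (l2 s)) * Z.
      apply: le_trans (ler_norm _) _; apply: le_trans (nc_Re _) _.
      apply: le_trans (ncD _ _) _; rewrite (ncM (l1 s) z1) (ncM (l2 s) z2) /Z.
      have := nc_ge0 (l1 s); have := nc_ge0 (l2 s); have := nc_ge0 z1; have := nc_ge0 z2.
      by nra.
    apply: le_trans hRe _; rewrite -!(mulrA Z) -mulrDr mulrC.
    by rewrite ler_wpM2l.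
  have [i4 i2 _] := cint_pair kc C20 mW bW.
  rewrite /EI -/W (cFubini1 i4 i2); apply: eq_cI => p _.
  rewrite Ginv -/g /FT mulrA -cIZ//.
    apply: eq_cI => t _; rewrite /W /h /l1 /l2 /= -[F _ _]/(f p.1 p.2).
    transitivity (c * (f p.1 p.2 * g t.1 t.2) * (cxp ('i * q%:C * (z1 * p.2%:C - z2 * p.1%:C)) *
      cxp ('i * (t.1%:C * (z2 - p.2%:C) - t.2%:C * (z1 - p.1%:C))))); first by ring.
    rewrite -cxpD; transitivity (c * (f p.1 p.2 * g t.1 t.2) * (cxp ('i * (q * p.2 - t.2)%:C * z1 + 'i * (t.1 - q * p.1)%:C * z2) *
       cxp ('i * (t.2 * p.1 - t.1 * p.2)%:C))); last by ring.
    rewrite -cxpD; congr (_ * cxp _).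
    by rewrite !(rmorphB, rmorphM)/=; ring.
  have h1 := FT_integrand (z1 - p.1%:C) (z2 - p.2%:C) eG; exact h1.
have [C C0 HC] := @EI_complex_quad _ _ _ (plane \x plane)%E _ _ ml1 ml2 _ mh ihM w1 w2.
by do 2 eexists; exists C => // v1 v2 v; rewrite !TCE; exact: HC v.
Qed.

End Twisted3.

(** * Associativity of the twisted convolution *)

Section Associativity.
Context {R : realType}.
Notation mu := (@lebesgue_measure R).
Notation mu2 := (mu \x mu)%E.
Implicit Types (F G H : R[i] -> R[i] -> R[i]) (f g h : R -> R -> R[i]) (K M x y : R).

Definition TCr q f g (x1 x2 : R) : R[i] :=
  cI mu2 setT (fun p => cxp ('i * (q * (x1 * p.2 - x2 * p.1))%:C) *
    f p.1 p.2 * g (x1 - p.1) (x2 - p.2)).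

Lemma TC_real q F G (x1 x2 : R) : TC q F G x1%:C x2%:C = TCr q (rr F) (rr G) x1 x2.
Proof.
apply: eq_cI => p _; rewrite /rr !rmorphB/=; congr (cxp _ * _ * _).
by rewrite !(rmorphB, rmorphM)/=; ring.
Qed.

(** Peetre's inequality 1 + x^2 <= 2 (1 + t^2) (1 + (x - t)^2); the difference of the two sides is
    written as a sum of squares. *)
Lemma ker_shift (x t : R) : ker (x - t) <= 2 * (1 + t ^+ 2) * ker x.
Proof.
rewrite /ker ler_pdivlMr ?oneDsq_gt0// mulrC ler_pdivrMr ?oneDsq_gt0//.
have e : 2 * (1 + t ^+ 2) * (1 + (x - t) ^+ 2) - (1 + x ^+ 2) =
  1 + (x - 2 * t) ^+ 2 + 2 * t ^+ 2 * (x - t) ^+ 2 by ring.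
rewrite -subr_ge0 e.
have a := sqr_ge0 (x - 2 * t); have b := sqr_ge0 (t * (x - t)).
by rewrite exprMn in b; lra.
Qed.

Lemma ccont_shift (u : R -> R[i]) (t : R) : ccont u -> ccont (fun x => u (x - t)).
Proof.
move=> [u1 u2]; split=> x.
  apply: (@continuous_comp _ _ _ (fun x => x - t) (cRe \o u)); last exact: u1.
  by apply: cvgB => //; exact: cvg_cst.
apply: (@continuous_comp _ _ _ (fun x => x - t) (cIm \o u)); last exact: u2.
by apply: cvgB => //; exact: cvg_cst.
Qed.

Lemma ccont_reflect (u : R -> R[i]) (t : R) : ccont u -> ccont (fun x => u (t - x)).
Proof.
move=> [u1 u2]; split=> x.
  apply: (@continuous_comp _ _ _ (fun x => t - x) (cRe \o u)); last exact: u1.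
  by apply: cvgB => //; exact: cvg_cst.
apply: (@continuous_comp _ _ _ (fun x => t - x) (cIm \o u)); last exact: u2.
by apply: cvgB => //; exact: cvg_cst.
Qed.

Lemma tame_shift K f (t1 t2 : R) : tame K f ->
  tame (K * (2 * (1 + t1 ^+ 2) * (2 * (1 + t2 ^+ 2)))) (fun x1 x2 => f (x1 - t1) (x2 - t2)).
Proof.
move=> tf; have K0 := tame_ge0 tf; case: tf => f1 f2 fK.
split=> [x2|x1|x1 x2]; [exact: ccont_shift (f1 (x2 - t2)) |exact: ccont_shift (f2 (x1 - t1))|].
apply: le_trans (fK _ _) _; rewrite -mulrA ler_wpM2l//.
rewrite mulrACA; apply: ler_pM; rewrite ?ker_ge0 ?ker_shift//.
Qed.

Lemma tame_translate K f (t1 t2 : R) : tame K f ->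
  cI mu2 setT (fun p => f (p.1 - t1) (p.2 - t2)) = cI mu2 setT (fun p => f p.1 p.2).
Proof.
move=> tf; rewrite (tame_Fubini1 (tame_shift t1 t2 tf)).
transitivity (cI mu setT (fun x1 => cI mu setT (f (x1 - t1)))).
  apply: eq_cI => x1 _; apply: (@cI_shift _ (f (x1 - t1)) (- t2)).
    by case: tf.
  exact: tame_int2 tf.
rewrite (tame_Fubini1 tf).
have iF := cint_Fubini1 (m1 := mu) (m2 := mu) (tame_int tf) (fun x => tame_int2 x tf).
apply: (@cI_shift _ (fun x => cI mu setT (f x)) (- t1)); last exact: iF.
apply: (@ccont_cI _ _ _ mu (fun x t => f x t) (fun t => K * ker t)).
- by move=> x; case: tf => _ f2 _; exact/ccont_meas.
- by case: tf.
- by apply: rintZ => //; exact: rint_ker.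
- by move=> x t; exact: tame_le1 tf.
Qed.

(** Both sides are iterated integrals of one function W of (p, t). After the translation p -> p - t
    the phases agree because omega is bilinear and alternating: omega(x,p) + omega(p,t) = omega(x,t)
    + omega(x-t,p-t). *)
Lemma TCr_assoc q K1 K2 K3 f g h : tame K1 f -> tame K2 g -> tame K3 h ->
  forall x1 x2, TCr q (TCr q f g) h x1 x2 = TCr q f (TCr q g h) x1 x2.
Proof.
move=> tf tg th x1 x2.
have K10 := tame_ge0 tf; have K20 := tame_ge0 tg; have K30 := tame_ge0 th.
pose ph (a b c d : R) := cxp ('i * (q * (a * d - b * c))%:C).
pose W (s : (R * R) * (R * R)) : R[i] :=
  ph x1 x2 s.1.1 s.1.2 * ph s.1.1 s.1.2 s.2.1 s.2.2 *
  (f s.2.1 s.2.2 * g (s.1.1 - s.2.1) (s.1.2 - s.2.2) * h (x1 - s.1.1) (x2 - s.1.2)).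
have m11 := @meas11 R; have m12 := @meas12 R; have m21 := @meas21 R; have m22 := @meas22 R.
have mq (u : (R * R) * (R * R) -> R) : measurable_fun setT u -> measurable_fun setT (fun s => q * u s).
  by move=> ?; apply: measurable_funM => //; exact: measurable_cst.
have mW : cmeas setT W.
  apply: cmeasM.
    apply: cmeasM; apply: cmeas_phase4; apply: mq; apply: measurable_funB;
      apply: measurable_funM => //; exact: measurable_cst.
  apply: cmeasM; first apply: cmeasM.
  - by apply: (@cmeas_comp _ _ _ _ _ (fun p => f p.1 p.2) snd) => //; exact: tame_meas tf.
  - apply: (@cmeas_comp _ _ _ _ _ (fun p => g p.1 p.2)
      (fun s : (R * R) * (R * R) => (s.1.1 - s.2.1, s.1.2 - s.2.2))); first exact: tame_meas tg.
    by apply: measurable_fun_pair; exact: measurable_funB.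
  - apply: (@cmeas_comp _ _ _ _ _ (fun p => h p.1 p.2)
      (fun s : (R * R) * (R * R) => (x1 - s.1.1, x2 - s.1.2))); first exact: tame_meas th.
    by apply: measurable_fun_pair; apply: measurable_funB => //; exact: measurable_cst.
have nph a b c d : nc (ph a b c d) = 1 by exact: nc_phase.
have gle a b : nc (g a b) <= K2.
  by apply: le_trans (tame_le1 _ _ tg) _; rewrite ler_piMr ?ker_le1.
pose C3 := K3 * (2 * (1 + x1 ^+ 2) * (2 * (1 + x2 ^+ 2))).
have hle a b : nc (h (x1 - a) (x2 - b)) <= C3 * (ker a * ker b).
  have [_ _ /(_ (x1 - a) (x2 - b)) h3] := th; apply: le_trans h3 _.
  rewrite /C3 -mulrA ler_wpM2l// mulrACA.
  have kN u v : ker (u - v) = ker (v - u) :> R by rewrite /ker -sqrrN opprB.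
  by rewrite [ker (x1 - a)]kN [ker (x2 - b)]kN ler_pM ?ker_ge0 ?ker_shift.
have C30 : 0 <= C3 by rewrite !mulr_ge0// addr_ge0// sqr_ge0.
(* The factor h supplies the decay in p and f that in t; boundedness of g is enough. *)
have bW s : nc (W s) <= (C3 * (ker s.1.1 * ker s.1.2)) * (K2 * K1 * (ker s.2.1 * ker s.2.2)).
  rewrite /W ncM (ncM (ph _ _ _ _)) !nph mulr1 mul1r ncM (ncM (f _ _)) mulrC.
  apply: ler_pM; [exact: nc_ge0|by rewrite mulr_ge0 ?nc_ge0|exact: hle|].
  rewrite mulrC -mulrA; apply: ler_pM; rewrite ?nc_ge0//.
  by case: tf.
have [i4 i12 i21] := cint_pair C30 (mulr_ge0 K20 K10) mW bW.
have tph K u c d : tame K u -> tame K (fun a b => ph a b c d * u a b).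
  move=> tu; have := tame_phase (q * c) (q * d) tu; congr tame.
  by apply/funext => a; apply/funext => b; congr (cxp ('i * _%:C) * _); ring.
have tph' K u c d : tame K u -> tame K (fun a b => ph c d a b * u a b).
  move=> tu; have := tame_phase (- (q * c)) (- (q * d)) tu; congr tame.
  by apply/funext => a; apply/funext => b; congr (cxp ('i * _%:C) * _); ring.
transitivity (cI plane setT (fun p => cI plane setT (fun t => W (p, t)))).
  apply: eq_cI => p _; rewrite mulrAC -cIZ//.
    by apply: eq_cI => t _; rewrite /W /ph/=; ring.
  have := i12 p => {}i12.
  have tm : cmeas setT (fun t : R * R => f t.1 t.2 * g (p.1 - t.1) (p.2 - t.2)).
    apply: cmeasM; first exact: tame_meas tf.
    apply: (@cmeas_comp _ _ _ _ _ (fun p => g p.1 p.2)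
      (fun t : R * R => (p.1 - t.1, p.2 - t.2))); first exact: tame_meas tg.
    by apply: measurable_fun_pair; apply: measurable_funB => //; exact: measurable_cst.
  apply: (@cint_ker2 _ (K1 * K2)).
    under eq_fun do rewrite -mulrA.
    apply: cmeasM tm.
    apply: cmeas_cxp; apply: cmeasM; first exact: cmeas_cst.
    apply: cmeas_real; apply: measurable_funM; first exact: measurable_cst.
    by apply: measurable_funB; apply: measurable_funM => //; exact: measurable_cst.
  move=> t; rewrite -mulrA nc_phaseM ncM [leRHS]mulrAC; apply: ler_pM; rewrite ?nc_ge0//.
  by case: tf.
rewrite -(cFubini1 i4 i12) (cFubini2 i4 i21); apply: eq_cI => t _.
(* The inner integrand of the right-hand side, in the translated variable p - t. *)
pose v a b := ph x1 x2 t.1 t.2 * f t.1 t.2 * (ph (x1 - t.1) (x2 - t.2) a b * (g a b * h (x1 - t.1 - a) (x2 - t.2 - b))).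
have tu : tame (K3 * K2) (fun a b => ph (x1 - t.1) (x2 - t.2) a b *
    (g a b * h (x1 - t.1 - a) (x2 - t.2 - b))).
  apply: tph'.
  have -> : (fun a b => g a b * h (x1 - t.1 - a) (x2 - t.2 - b)) =
      (fun a b => h (x1 - t.1 - a) (x2 - t.2 - b) * g a b).
    by apply/funext => a; apply/funext => b; exact: mulrC.
  have [h1 h2 _] := th; apply: (tameM tg K30).
  - by move=> b; exact: ccont_reflect (h1 _).
  - by move=> a; exact: ccont_reflect (h2 _).
  - by move=> a b; apply: le_trans (tame_le1 _ _ th) _; rewrite ler_piMr ?ker_le1.
have tv : tame (nc (ph x1 x2 t.1 t.2 * f t.1 t.2) * (K3 * K2)) v.
  apply: (tameM tu); first exact: nc_ge0.
  - by move=> ?; exact: ccont_cst.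
  - by move=> ?; exact: ccont_cst.
  - by [].
transitivity (cI mu2 setT (fun p => v p.1 p.2)).
  rewrite -(tame_translate t.1 t.2 tv); apply: eq_cI => p _; rewrite /W /v/=.
  have -> : x1 - t.1 - (p.1 - t.1) = x1 - p.1 by ring.
  have -> : x2 - t.2 - (p.2 - t.2) = x2 - p.2 by ring.
  transitivity (ph x1 x2 p.1 p.2 * ph p.1 p.2 t.1 t.2 * (f t.1 t.2 * g (p.1 - t.1) (p.2 - t.2) * h (x1 - p.1) (x2 - p.2))) => //.
  transitivity (ph x1 x2 t.1 t.2 * ph (x1 - t.1) (x2 - t.2) (p.1 - t.1) (p.2 - t.2) * (f t.1 t.2 * g (p.1 - t.1) (p.2 - t.2) * h (x1 - p.1) (x2 - p.2))); last by ring.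
  rewrite /ph -!cxpD; congr (cxp _ * _).
  by apply: complex_eqP; rewrite !cE/=; ring.
rewrite /v cIZ//; last exact: tame_int tu.
by congr (_ * _); apply: eq_cI => s _; rewrite mulrA.
Qed.

End Associativity.

(** * The Weyl product on the space of type S *)

Section RowVectors.

Definition rvec2 (K : nzRingType) (a b : K) : 'rV[K]_2 := \row_(j < 2) if j == 0 then a else b.

Lemma rvec2_eta (K : nzRingType) (x : 'rV[K]_2) : rvec2 (x 0 0) (x 0 1) = x.
Proof.
apply/rowP => j; rewrite mxE; case: eqP => [->//|] j0; congr (x 0 _).
by apply/val_inj; case: j j0 => -[|[|]]//= h j0; case: j0; exact: val_inj.
Qed.

Lemma norm_rv2_coord (K : numFieldType) (h : 'rV[K]_2) j : `|h 0 j| <= `|h|.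
Proof.
have -> : `|h| = (\big[Num.max/0%:nng]_i `|h i.1 i.2|%:nng)%:num by exact: mx_normE.
have -> : `|h 0 j| = `|h 0 j|%:nng%:num by [].
rewrite num_le; exact: (le_bigmax _ (fun i : 'I_1 * 'I_2 => `|h i.1 i.2|%:nng) (0, j)).
Qed.

End RowVectors.

Section Bridge.
Context {R : realType}.
Notation mu := (@lebesgue_measure R).
Notation mu2 := (mu \x mu)%E.

Lemma quad_diff_entire (G : R[i] -> R[i] -> R[i]) : quad_diff G ->
  entire (fun z : 'rV[R[i]]_2 => G (z 0 0) (z 0 1) : R[i]^o).
Proof.
move=> qG z; have [a [b [C C0 HC]]] := qG (z 0 0) (z 0 1).
have half : (0 : R[i]) < 2^-1 by rewrite invr_gt0.
apply: (proj1 (B := 'd (fun z : 'rV[R[i]]_2 => G (z 0 0) (z 0 1) : R[i]^o) z = lin2 a b :> (_ -> _))).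
(* The norm of a row vector is the maximum over its coordinates: hence (|h1| + |h2|)^2 <= 4 |h|^2,
   and the radius 1/2 ensures |h1| + |h2| <= 1. *)
apply: (@quad_differentiable _ _ _ _ (lin2 a b) z (4 * C)%:C 2^-1) => //.
- by rewrite ler0c mulr_ge0.
- exact: continuous_lin2.
move=> h h1; rewrite /lin2 !mxE [h 0 0 + _]addrC [h 0 1 + _]addrC.
have hn j : (nc (h 0 j))%:C <= `|h| by have := norm_rv2_coord h j; rewrite [X in X <= _](norm_nc (h 0 j)).
have hre : `|h| = (cRe `|h|)%:C.
  have : 0 <= `|h| by [].
  by case: `|h| => p q; rewrite lecE/= => /andP[/eqP -> _].
have hn' j : nc (h 0 j) <= cRe `|h| by rewrite -lecR -hre.
have h2 : cRe `|h| < 2^-1.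
  rewrite -ltcR -hre fmorphV/= (_ : (2%:C) = 2) //.
  by rewrite rmorph_nat.
rewrite [leLHS]norm_nc hre -rmorphXn -rmorphM lecR.
have s1 : nc (h 0 0) + nc (h 0 1) <= 1 by have := hn' 0; have := hn' 1; lra.
apply: (le_trans (HC (h 0 0) (h 0 1) s1)).
have := hn' 0; have := hn' 1; have := nc_ge0 (h 0 0); have := nc_ge0 (h 0 1).
move: (nc (h 0 0)) (nc (h 0 1)) (cRe _) => p q t q0 p0 qt pt.
rewrite [4 * C]mulrC -mulrA ler_wpM2l//.
rewrite (_ : 4 * t ^+ 2 = (2 * t) ^+ 2); last by ring.
by rewrite ler_sqr ?nnegrE; lra.
Qed.

Lemma differentiable_cdiff_line (F : 'rV[R[i]]_2 -> R[i]^o) z (e : 'rV[R[i]]_2) :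
  differentiable F z -> exists l : R[i], forall eps : R, 0 < eps ->
  exists2 r : R, 0 < r & forall w : R[i], nc w < r ->
    nc (F (w *: e + z) - F z - l * w) <= eps * nc w.
Proof.
move=> dF; have := diff_locally dF => /eqaddoP H.
exists ('d F z e) => eps eps0.
pose k : R := cRe `|e| + 1.
have ere : `|e| = (cRe `|e|)%:C.
  have : 0 <= `|e| by [].
  by case: `|e| => p q; rewrite lecE/= => /andP[/eqP -> _].
have e0 : 0 <= cRe `|e| by rewrite -lecR -ere normr_ge0.
have k0 : 0 < k by rewrite /k; lra.
have ek : (0 : R[i]) < (eps / k)%:C by rewrite -[0]/(0%:C) ltcR divr_gt0.
have /nbhs_normP[r r0 Hr] := H _ ek.
have rre : r = (cRe r)%:C.
  by move: r0; case: r {Hr} => p q /=; rewrite ltcE/= => /andP[/eqP -> _].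
have r0' : 0 < cRe r by rewrite -ltcR -rre.
exists (cRe r / k); first exact: divr_gt0.
move=> w; rewrite ltr_pdivlMr// => wr.
have := Hr (w *: e); rewrite /ball_/= sub0r normrN normrZ => /(_ _).
have wle : `|w| * `|e| < r.
  rewrite rre norm_nc ere -rmorphM ltcR; apply: le_lt_trans wr.
  by rewrite ler_wpM2l ?nc_ge0// /k lerDl.
move=> /(_ wle); rewrite !fctE/=.
have -> : F (w *: e + z) - (F z + 'd F z (w *: e)) = F (w *: e + z) - F z - 'd F z e * w.
  by rewrite linearZ opprD addrA; congr (_ - _); exact: mulrC.
rewrite [X in X <= _]norm_nc ere norm_nc -!rmorphM lecR => /le_trans; apply.
rewrite mulrCA [_ * nc w]mulrC ler_wpM2l ?nc_ge0//.
by rewrite mulrAC ler_pdivrMr// ler_wpM2l ?(ltW eps0)// /k lerDl.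
Qed.

Lemma entire_sephol (F : 'rV[R[i]]_2 -> R[i]^o) : entire F ->
  sephol (fun z1 z2 => F (rvec2 z1 z2)).
Proof.
move=> eF; split=> [z2 z1|z1 z2].
  have [l Hl] := differentiable_cdiff_line (rvec2 1 0) (eF (rvec2 z1 z2)).
  exists l => eps /Hl[r r0 Hr]; exists r => // w /Hr.
  have -> : w *: rvec2 1 0 + rvec2 z1 z2 = rvec2 (z1 + w) z2 => //.
  apply/rowP => j; rewrite !mxE; case: ifP => _; first by rewrite mulr1 addrC.
  by rewrite mulr0 add0r.
have [l Hl] := differentiable_cdiff_line (rvec2 0 1) (eF (rvec2 z1 z2)).
exists l => eps /Hl[r r0 Hr]; exists r => // w /Hr.
have -> : w *: rvec2 0 1 + rvec2 z1 z2 = rvec2 z1 (z2 + w) => //.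
apply/rowP => j; rewrite !mxE; case: ifP => _; first by rewrite mulr0 add0r.
by rewrite mulr1 addrC.
Qed.

Definition cur (u : 'rV[R]_2 -> R[i]) (x1 x2 : R) : R[i] := u (row2 x1 x2).

Lemma row2_eta (x : 'rV[R]_2) : row2 (x 0 0) (x 0 1) = x.
Proof. exact: rvec2_eta. Qed.

Lemma omegaE (x y : 'rV[R]_2) : omega x y = x 0 0 * y 0 1 - x 0 1 * y 0 0.
Proof.
rewrite /omega mxE !big_ord_recl big_ord0 !mxE !big_ord_recl !big_ord0 !mxE/=.
have -> : lift ord0 ord0 = 1 :> 'I_2 by exact: val_inj.
by ring.
Qed.

Lemma SF_FT u (y : 'rV[R]_2) : SF u y = FT (cur u) (y 0 0)%:C (y 0 1)%:C.
Proof.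
rewrite /SF /integral2; apply: eq_cI => p _; rewrite omegaE !mxE/= -cxpE.
by congr (cxp ('i * _) * _); rewrite !(rmorphB, rmorphM).
Qed.

Lemma twisted_conv_TCr q u v (x : 'rV[R]_2) :
  twisted_conv q u v x = TCr q (cur u) (cur v) (x 0 0) (x 0 1).
Proof.
rewrite /twisted_conv /integral2; apply: eq_cI => p _; rewrite omegaE !mxE/= -cxpE /cur.
congr (_ * _ * v _); apply/rowP => j; rewrite !mxE.
by rewrite -{1}(row2_eta x) mxE; case: ifP.
Qed.

End Bridge.

Section RealWeyl.
Context {R : realType}.
Notation mu := (@lebesgue_measure R).
Notation mu2 := (mu \x mu)%E.
Implicit Types (F G H : R[i] -> R[i] -> R[i]) (f g h : R -> R -> R[i]) (q K M x y : R) (c : R[i]).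

Lemma cI0 d (T : measurableType d) (m : {measure set T -> \bar R}) D :
  cI m D (fun=> 0) = 0.
Proof. by rewrite /cI/= /Rintegral integral0. Qed.

Lemma two_pi_neq0 : (2 * pi)%:C != 0 :> R[i].
Proof. by rewrite -[0]/(0%:C) (inj_eq (@complexI _)) mulf_neq0// gt_eqF// pi_gt0. Qed.

Lemma quad_diff_lin c F G : quad_diff F -> quad_diff G ->
  quad_diff (fun z1 z2 => c * F z1 z2 + G z1 z2).
Proof.
move=> qF qG z1 z2; have [a [b [C C0 HC]]] := qF z1 z2.
have [a' [b' [C' C'0 HC']]] := qG z1 z2.
exists (c * a + a'), (c * b + b'); exists (nc c * C + C'); first by rewrite addr_ge0 ?mulr_ge0 ?nc_ge0.
move=> v1 v2 v; have := HC _ _ v; have := HC' _ _ v.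
set X := F _ _ - _ - _; set Y := G _ _ - _ - _ => hY hX.
rewrite (_ : _ - _ = c * X + Y); last by rewrite /X /Y; ring.
apply: le_trans (ncD _ _) _; rewrite ncM mulrDl lerD// -[leRHS]mulrA.
by rewrite ler_wpM2l ?nc_ge0.
Qed.

Lemma growth_lin p1 p2 r1 r2 c F G : growth p1 p2 r1 r2 F -> growth p1 p2 r1 r2 G ->
  growth p1 p2 r1 r2 (fun z1 z2 => c * F z1 z2 + G z1 z2).
Proof.
move=> [A [a [b [A0 a0 b0 HF]]]] [A' [a' [b' [A'0 a'0 b'0 HG]]]].
exists (nc c * A + A'), (Num.min a a'), (Num.max b b'); split.
- by rewrite ltr_wpDl ?mulr_ge0 ?nc_ge0 ?ltW.
- by rewrite lt_min a0.
- by rewrite lt_max b0.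
move=> x1 y1 x2 y2; apply: le_trans (ncD _ _) _.
have mon (s t : R) : Num.min a a' <= s -> t <= Num.max b b' ->
    expR (- (s * decay p1 p2 x1 x2) + t * decay r1 r2 y1 y2) <=
    expR (- (Num.min a a' * decay p1 p2 x1 x2) + Num.max b b' * decay r1 r2 y1 y2).
  by move=> hs ht; rewrite ler_expR lerD ?lerN2 ?ler_wpM2r ?decay_ge0.
rewrite ncM mulrDl lerD//.
  rewrite -[leRHS]mulrA ler_wpM2l ?nc_ge0//; apply: le_trans (HF _ _ _ _) _.
  by rewrite ler_wpM2l ?(ltW A0)// mon// ?ge_min ?le_max lexx.
apply: le_trans (HG _ _ _ _) _.
by rewrite ler_wpM2l ?(ltW A'0)// mon// ?ge_min ?le_max lexx orbT.
Qed.

Definition SFr f x1 x2 := FT f x1%:C x2%:C.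

Definition Wr q f g := SFr (TCr q (SFr f) (SFr g)).

Variables (p1 p2 r1 r2 : R).
Hypothesis (pr1 : conj_exp p1 r2) (pr2 : conj_exp p2 r1).

Definition gs F := quad_diff F /\ growth p1 p2 r1 r2 F.

(** The curried form of S_A, as [SA_gsr] shows, with the stronger [quad_diff] built into the
    extension. *)
Definition gsr f := exists2 F, gs F & f = rr F.

Let gs_superexp F : gs F -> superexp (rr F).
Proof. by move=> [qF gF]; exact: growth_superexp pr1 pr2 (quad_diff_sephol qF) gF. Qed.

Lemma gsr_superexp f : gsr f -> superexp f.
Proof. by move=> [F gF ->]; exact: gs_superexp. Qed.

Lemma gsr_tame f : gsr f -> exists K, tame K f.
Proof. by move=> [F gF ->]; exact/superexp_tame/gs_superexp. Qed.

Lemma gs_FT F : gs F -> gs (FT (rr F)).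
Proof.
move=> gF; split; first exact/FT_quad_diff/gs_superexp.
by case: gF => qF {}gF; have := FT_growth pr1 pr2 (quad_diff_sephol qF) gF.
Qed.

Lemma gs_TC q F G : gs F -> gs G -> gs (TC q F G).
Proof.
move=> gF gG; have [qF hF] := gF; have [qG hG] := gG; split.
  apply: (@TC_quad_diff _ _ _ _ (((2 * pi) ^+ 2)%:C^-1)).
  - exact: gs_superexp.
  - exact/gs_superexp/gs_FT.
  move=> z1 z2; rewrite (FT_inversion_complex pr1 pr2 (quad_diff_sephol qG) hG).
  by rewrite mulrA mulVf ?mul1r// rmorphXn expf_neq0// two_pi_neq0.
by apply: TC_growth => //; exact: quad_diff_sephol.
Qed.

Lemma gs_lin c F G : gs F -> gs G -> gs (fun z1 z2 => c * F z1 z2 + G z1 z2).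
Proof. by move=> [qF gF] [qG gG]; split; [exact: quad_diff_lin|exact: growth_lin]. Qed.

Lemma gs0 : gs (fun _ _ => 0).
Proof.
split; last by exists 1, 1, 1; split=> // *; rewrite nc0 mul1r; exact: expR_ge0.
by move=> z1 z2; exists 0, 0; exists 0 => // *; rewrite !mulr0 mul0r addr0 !subrr nc0.
Qed.

Lemma gsr_lin c f g : gsr f -> gsr g -> gsr (fun x1 x2 => c * f x1 x2 + g x1 x2).
Proof.
move=> [F gF ->] [G gG ->]; exists (fun z1 z2 => c * F z1 z2 + G z1 z2) => //.
exact: gs_lin.
Qed.

Lemma gsr_SFr f : gsr f -> gsr (SFr f).
Proof. by move=> [F gF ->]; exists (FT (rr F)) => //; exact: gs_FT. Qed.

Lemma gsr_TCr q f g : gsr f -> gsr g -> gsr (TCr q f g).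
Proof.
move=> [F gF ->] [G gG ->]; exists (TC q F G); first exact: gs_TC.
by apply/funext => x1; apply/funext => x2; rewrite /rr TC_real.
Qed.

Lemma gsr_Wr q f g : gsr f -> gsr g -> gsr (Wr q f g).
Proof. by move=> gf gg; apply: gsr_SFr; apply: gsr_TCr; exact: gsr_SFr. Qed.

Lemma SFrK f x1 x2 : gsr f -> SFr (SFr f) x1 x2 = ((2 * pi) ^+ 2)%:C * f x1 x2.
Proof.
move=> [F [qF gF] ->].
exact: (FT_inversion_complex pr1 pr2 (quad_diff_sephol qF) gF).
Qed.

Lemma SFr_lin c f g : gsr f -> gsr g ->
  SFr (fun x1 x2 => c * f x1 x2 + g x1 x2) = (fun x1 x2 => c * SFr f x1 x2 + SFr g x1 x2).
Proof.
move=> gf gg; apply/funext => x1; apply/funext => x2.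
have i1 := FT_integrand x1%:C x2%:C (gsr_superexp gf).
have i2 := FT_integrand x1%:C x2%:C (gsr_superexp gg).
rewrite /SFr /FT -cIZ// -cID//; last exact: cintZ.
by apply: eq_cI => p _; ring.
Qed.

Let tame_TCr q K M f g x1 x2 : tame K f -> tame M g ->
  cint mu2 setT (fun p => cxp ('i * (q * (x1 * p.2 - x2 * p.1))%:C) *
    f p.1 p.2 * g (x1 - p.1) (x2 - p.2)).
Proof.
move=> tf tg; have M0 := tame_ge0 tg; have [g1 g2 _] := tg.
have t1 : tame (M * K) (fun a b => g (x1 - a) (x2 - b) * f a b).
  apply: (tameM tf M0).
  - by move=> b; exact: ccont_reflect (g1 _).
  - by move=> a; exact: ccont_reflect (g2 _).
  - by move=> a b; apply: le_trans (tame_le1 _ _ tg) _; rewrite ler_piMr ?ker_le1.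
have := tame_int (tame_phase (- (q * x1)) (- (q * x2)) t1).
congr cint; apply/funext => p; rewrite /phase2 -mulrA [g _ _ * _]mulrC.
by congr (cxp ('i * _%:C) * _); ring.
Qed.

Lemma TCr_linl q c f g h : gsr f -> gsr g -> gsr h ->
  TCr q (fun x1 x2 => c * f x1 x2 + g x1 x2) h =
  (fun x1 x2 => c * TCr q f h x1 x2 + TCr q g h x1 x2).
Proof.
move=> /gsr_tame[K tf] /gsr_tame[M tg] /gsr_tame[N th].
apply/funext => x1; apply/funext => x2.
have i1 := tame_TCr q x1 x2 tf th; have i2 := tame_TCr q x1 x2 tg th.
rewrite /TCr -cIZ// -cID//; last exact: cintZ.
by apply: eq_cI => p _; ring.
Qed.

Lemma TCr_linr q c f g h : gsr f -> gsr g -> gsr h ->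
  TCr q h (fun x1 x2 => c * f x1 x2 + g x1 x2) =
  (fun x1 x2 => c * TCr q h f x1 x2 + TCr q h g x1 x2).
Proof.
move=> /gsr_tame[K tf] /gsr_tame[M tg] /gsr_tame[N th].
apply/funext => x1; apply/funext => x2.
have i1 := tame_TCr q x1 x2 th tf; have i2 := tame_TCr q x1 x2 th tg.
rewrite /TCr -cIZ// -cID//; last exact: cintZ.
by apply: eq_cI => p _; ring.
Qed.

Lemma Wr_linl q c f g h : gsr f -> gsr g -> gsr h ->
  Wr q (fun x1 x2 => c * f x1 x2 + g x1 x2) h =
  (fun x1 x2 => c * Wr q f h x1 x2 + Wr q g h x1 x2).
Proof.
move=> gf gg gh; rewrite /Wr SFr_lin// TCr_linl; try exact: gsr_SFr.
by rewrite SFr_lin//; apply: gsr_TCr; exact: gsr_SFr.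
Qed.

Lemma Wr_linr q c f g h : gsr f -> gsr g -> gsr h ->
  Wr q h (fun x1 x2 => c * f x1 x2 + g x1 x2) =
  (fun x1 x2 => c * Wr q h f x1 x2 + Wr q h g x1 x2).
Proof.
move=> gf gg gh; rewrite /Wr SFr_lin// TCr_linr; try exact: gsr_SFr.
by rewrite SFr_lin//; apply: gsr_TCr; exact: gsr_SFr.
Qed.

Lemma gsr0 : gsr (fun _ _ => 0).
Proof. by exists (fun _ _ => 0) => //; exact: gs0. Qed.

Lemma Wr_assoc q f g h : gsr f -> gsr g -> gsr h ->
  Wr q (Wr q f g) h = Wr q f (Wr q g h).
Proof.
move=> gf gg gh.
have [sf sg sh] : [/\ gsr (SFr f), gsr (SFr g) & gsr (SFr h)] by split; exact: gsr_SFr.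
pose C : R[i] := ((2 * pi) ^+ 2)%:C.
(* The summand 0 gives the identity the shape c f + g of [TCr_linl] and [TCr_linr], which then pull
   out the constant. *)
have E u v : gsr u -> gsr v -> SFr (Wr q u v) = fun x1 x2 => C * TCr q (SFr u) (SFr v) x1 x2 + 0.
  move=> gu gv; apply/funext => x1; apply/funext => x2; rewrite addr0 SFrK//.
  by apply: gsr_TCr; exact: gsr_SFr.
have gfg := gsr_TCr q sf sg; have ggh := gsr_TCr q sg sh.
have z1 : TCr q (fun _ _ => 0) (SFr h) = fun _ _ => 0.
  apply/funext => x1; apply/funext => x2.
  rewrite /TCr (@eq_cI _ _ _ _ _ _ (fun=> 0)); last by move=> p _; rewrite mulr0 mul0r.
  exact: cI0.
have z2 : TCr q (SFr f) (fun _ _ => 0) = fun _ _ => 0.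
  apply/funext => x1; apply/funext => x2.
  rewrite /TCr (@eq_cI _ _ _ _ _ _ (fun=> 0)); last by move=> p _; rewrite mulr0.
  exact: cI0.
have e1 : TCr q (SFr (Wr q f g)) (SFr h) = _ := congr1 (fun u => TCr q u (SFr h)) (E f g gf gg).
have e2 : TCr q (SFr f) (SFr (Wr q g h)) = _ := congr1 (TCr q (SFr f)) (E g h gg gh).
suff e : TCr q (SFr (Wr q f g)) (SFr h) = TCr q (SFr f) (SFr (Wr q g h)).
  by have := congr1 SFr e.
rewrite e1 e2 (TCr_linl q C gfg gsr0 sh) (TCr_linr q C ggh gsr0 sf) z1 z2; apply/funext => x1; apply/funext => x2.
have [Kf tf] := gsr_tame sf; have [Kg tg] := gsr_tame sg; have [Kh th] := gsr_tame sh.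
by rewrite (TCr_assoc q tf tg th).
Qed.

End RealWeyl.

Section TypeS.
Context {R : realType}.
Notation mu := (@lebesgue_measure R).
Notation mu2 := (mu \x mu)%E.
Implicit Types (u v : 'rV[R]_2 -> R[i]).

Lemma cur_inj : injective (@cur R).
Proof.
by move=> u v e; apply/funext => x; rewrite -(row2_eta x) -![_ (row2 _ _)]/(cur _ _ _) e.
Qed.

Lemma cur_SF u : cur (SF u) = SFr (cur u).
Proof.
by apply/funext => x1; apply/funext => x2; rewrite /cur SF_FT !mxE.
Qed.

Lemma cur_twisted_conv q u v : cur (twisted_conv q u v) = TCr q (cur u) (cur v).
Proof.
by apply/funext => x1; apply/funext => x2; rewrite {1}/cur twisted_conv_TCr !mxE.
Qed.

Lemma cur_weyl q u v : cur (weyl q u v) = Wr q (cur u) (cur v).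
Proof. by rewrite /weyl cur_SF cur_twisted_conv !cur_SF. Qed.

Lemma sum_row2 (f : 'I_2 -> R) : \sum_j f j = f 0 + f 1.
Proof. by rewrite !big_ord_recl big_ord0 addr0; congr (f _ + f _); exact: val_inj. Qed.

Variables (al1 al2 : R).
Hypothesis (h1 : 0 < al1 < 1) (h2 : 0 < al2 < 1).
Notation p1 := al1^-1.
Notation p2 := al2^-1.
Notation r1 := (1 - al2)^-1.
Notation r2 := (1 - al1)^-1.

Lemma conj_exp_alpha (a : R) : 0 < a < 1 -> conj_exp a^-1 (1 - a)^-1.
Proof.
by move=> /andP[a0 a1]; split; rewrite ?invf_gt1//; try lra.
Qed.

Let pr1 : conj_exp p1 r2. Proof. exact: conj_exp_alpha. Qed.
Let pr2 : conj_exp p2 r1. Proof. exact: conj_exp_alpha. Qed.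

(** Entirety directly gives only [sephol], enough for the contour shifts. Complex Fourier inversion
    then represents the extension as an exponential integral, which has [quad_diff]; the converse is
    [quad_diff_entire]. *)
Lemma SA_gsr u : SA al1 al2 u <-> gsr p1 p2 r1 r2 (cur u).
Proof.
split.
  move=> [F [eF uF [C [a [b [C0 a0 b0 HF]]]]]].
  pose G z1 z2 : R[i] := F (rvec2 z1 z2).
  have sG : sephol G by exact: entire_sephol.
  have gG : growth p1 p2 r1 r2 G.
    exists C, (Num.min (a 0 0) (a 0 1)), (Num.max (b 0 0) (b 0 1)); split=> //.
    - by rewrite lt_min !a0.
    - by rewrite lt_max !b0.
    move=> x1 y1 x2 y2; have := HF (row2 x1 x2) (row2 y1 y2).
    have -> : Defs.cpoint (row2 x1 x2) (row2 y1 y2) = rvec2 (x1 +i* y1) (x2 +i* y2).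
      by apply/rowP => j; rewrite !mxE; case: ifP.
    rewrite [X in X <= _]norm_nc lecR => /le_trans; apply.
    rewrite !sum_row2 !mxE/= ler_wpM2l ?(ltW C0)// ler_expR lerD//.
      by rewrite lerN2 mulrDr lerD// ler_wpM2r ?powR_ge0// ge_min lexx ?orbT.
    by rewrite mulrDr lerD// ler_wpM2r ?powR_ge0// le_max lexx ?orbT.
  (* Equal to G by inversion, but visibly a Fourier transform; the + 0 fits [gs_lin]. *)
  exists (fun z1 z2 => ((2 * pi) ^+ 2)%:C^-1 * FT (rr (FT (rr G))) z1 z2 + 0).
    apply: (gs_lin _ _ (gs0 _ _ _ _)); apply: gs_FT => //.
    split; first exact: (FT_quad_diff (growth_superexp pr1 pr2 sG gG)).
    by have := FT_growth pr1 pr2 sG gG.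
  apply/funext => x1; apply/funext => x2; rewrite /cur uF /rr addr0.
  rewrite (FT_inversion_complex pr1 pr2 sG gG) mulrA mulVf ?mul1r.
    by rewrite /G; congr F; apply/rowP => j; rewrite !mxE; case: ifP.
  by rewrite rmorphXn expf_neq0// two_pi_neq0.
move=> [F [qF [A [a [b [A0 a0 b0 HF]]]]] uF].
exists (fun z => F (z 0 0) (z 0 1)); split.
- exact: quad_diff_entire.
- by move=> x; rewrite -{1}(row2_eta x) -[u _]/(cur u _ _) uF !mxE.
exists A, (row2 a a), (row2 b b); split=> //.
- by move=> j; rewrite mxE; case: ifP.
- by move=> j; rewrite mxE; case: ifP.
move=> x y; rewrite [X in X <= _]norm_nc lecR !mxE; apply: le_trans (HF _ _ _ _) _.
by rewrite !sum_row2 !mxE/= !mulrDr.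
Qed.

Lemma SA_lin (c : R[i]) u v : SA al1 al2 u -> SA al1 al2 v ->
  SA al1 al2 (fun x => c * u x + v x).
Proof. by move=> /SA_gsr gu /SA_gsr gv; apply/SA_gsr; exact: gsr_lin. Qed.

Lemma SA0 : SA al1 al2 (fun=> 0).
Proof. by apply/SA_gsr; exact: gsr0. Qed.

Lemma SA_weyl q u v : SA al1 al2 u -> SA al1 al2 v -> SA al1 al2 (weyl q u v).
Proof. by move=> /SA_gsr gu /SA_gsr gv; apply/SA_gsr; rewrite cur_weyl; exact: gsr_Wr. Qed.

Lemma weyl_linl q (c : R[i]) u v w : SA al1 al2 u -> SA al1 al2 v -> SA al1 al2 w ->
  weyl q (fun x => c * u x + v x) w = (fun x => c * weyl q u w x + weyl q v w x).
Proof.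
move=> /SA_gsr gu /SA_gsr gv /SA_gsr gw; apply: cur_inj; rewrite cur_weyl.
by rewrite [LHS](Wr_linl pr1 pr2 q c gu gv gw) -!cur_weyl.
Qed.

Lemma weyl_linr q (c : R[i]) u v w : SA al1 al2 u -> SA al1 al2 v -> SA al1 al2 w ->
  weyl q w (fun x => c * u x + v x) = (fun x => c * weyl q w u x + weyl q w v x).
Proof.
move=> /SA_gsr gu /SA_gsr gv /SA_gsr gw; apply: cur_inj; rewrite cur_weyl.
by rewrite [LHS](Wr_linr pr1 pr2 q c gu gv gw) -!cur_weyl.
Qed.

Lemma weyl_assoc q u v w : SA al1 al2 u -> SA al1 al2 v -> SA al1 al2 w ->
  weyl q (weyl q u v) w = weyl q u (weyl q v w).
Proof.
move=> /SA_gsr gu /SA_gsr gv /SA_gsr gw; apply: cur_inj.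
have e1 := etrans (cur_weyl q (weyl q u v) w) (congr1 (fun z => Wr q z (cur w)) (cur_weyl q u v)).
have e2 := etrans (cur_weyl q u (weyl q v w)) (congr1 (Wr q (cur u)) (cur_weyl q v w)).
apply: (etrans e1); apply: (etrans _ (esym e2)).
exact (Wr_assoc pr1 pr2 q gu gv gw).
Qed.

End TypeS.

(** * The twisting map *)

Section EllipticCoordinates.
Context {R : realType}.
Implicit Types (u v t A B : R).

Definition snh u : R := (expR u - expR (- u)) / 2.
Definition csh u : R := (expR u + expR (- u)) / 2.
Definition ash t : R := ln (t + Num.sqrt (1 + t ^+ 2)).

Lemma csh_snh u : csh u ^+ 2 = 1 + snh u ^+ 2.
Proof.
have e : expR u * expR (- u) = 1 by rewrite -expRD subrr expR0.
rewrite /csh /snh; apply/eqP; rewrite -subr_eq0; apply/eqP.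
transitivity (expR u * expR (- u) - 1); last by rewrite e subrr.
by field.
Qed.

Lemma csh_gt0 u : 0 < csh u.
Proof. by rewrite divr_gt0// addr_gt0// expR_gt0. Qed.

Lemma csh_ge1 u : 1 <= csh u.
Proof.
rewrite -(@ler_sqr R) ?nnegrE ?(ltW (csh_gt0 u))// csh_snh expr1n lerDl.
exact: sqr_ge0.
Qed.

Lemma csh_le_exp u : csh u <= expR `|u|.
Proof.
have h1 : expR u <= expR `|u| by rewrite ler_expR ler_norm.
have h2 : expR (- u) <= expR `|u| by rewrite ler_expR -normrN ler_norm.
by rewrite /csh; lra.
Qed.

Lemma sqrt_csh u : Num.sqrt (1 + snh u ^+ 2) = csh u.
Proof. by rewrite -csh_snh sqrtr_sqr ger0_norm// ltW// csh_gt0. Qed.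

Lemma snhK : cancel snh ash.
Proof.
move=> u; rewrite /ash sqrt_csh (_ : snh u + csh u = expR u) ?expRK//.
by rewrite /snh /csh; field.
Qed.

Lemma ash_arg_gt0 t : 0 < t + Num.sqrt (1 + t ^+ 2).
Proof.
have t2 := sqr_ge0 t.
have s0 : 0 <= Num.sqrt (1 + t ^+ 2) by exact: sqrtr_ge0.
have s2 : Num.sqrt (1 + t ^+ 2) ^+ 2 = 1 + t ^+ 2 by rewrite sqr_sqrtr// addr_ge0.
by nra.
Qed.

Lemma ashK : cancel ash snh.
Proof.
move=> t; have e0 := ash_arg_gt0 t; rewrite /snh /ash expRN lnK//.
have s2 : Num.sqrt (1 + t ^+ 2) ^+ 2 = 1 + t ^+ 2 by rewrite sqr_sqrtr// addr_ge0// sqr_ge0.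
have -> : (t + Num.sqrt (1 + t ^+ 2))^-1 = Num.sqrt (1 + t ^+ 2) - t.
  apply: (mulfI (lt0r_neq0 e0)); rewrite mulfV ?lt0r_neq0//.
  by apply/esym; rewrite mulrC [t + _]addrC -subr_sqr s2 addrK.
by field.
Qed.

Lemma continuous_ash : continuous ash.
Proof.
move=> t; apply: (@continuous_comp _ _ _ (fun t : R => t + Num.sqrt (1 + t ^+ 2)) (@ln R)).
  apply: cvgD => //; apply: (@continuous_comp _ _ _ (fun t : R => 1 + t ^+ 2) Num.sqrt).
    by apply: cvgD; [exact: cvg_cst|exact: exprn_continuous].
  exact: sqrt_continuous.
by apply: continuous_ln; exact: ash_arg_gt0.
Qed.

Let rp A B := Num.sqrt (A ^+ 2 + (1 + B) ^+ 2).
Let rm A B := Num.sqrt (A ^+ 2 + (1 - B) ^+ 2).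

(* In elliptic coordinates sinh (u + i v) = A + i B, with [rp], [rm] the distances from A + i B to
   -i and i: cosh u = (rp + rm) / 2 and sin v = (rp - rm) / 2. *)
Definition ellD A B : R := (rp A B - rm A B) / 2.
Definition ellV A B : R := asin (ellD A B).
Definition ellU A B : R := ash (A / Num.sqrt (1 - ellD A B ^+ 2)).

(** The hypothesis says that A + i B avoids the slits +- i t, t >= 1. With S and D half the sum and
    half the difference of the focal distances, S >= 1; if |D| >= 1, the product formula forces A =
    0, and then |B| = S |D| >= 1, a point of a slit. *)
Lemma ellD_spec A B : (A != 0) || (`|B| < 1) ->
  [/\ -1 < ellD A B < 1, (rp A B + rm A B) / 2 * ellD A B = B &
   (((rp A B + rm A B) / 2) ^+ 2 - 1) * (1 - ellD A B ^+ 2) = A ^+ 2].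
Proof.
move=> adm; pose S := (rp A B + rm A B) / 2; rewrite -/S.
have p2 : rp A B ^+ 2 = A ^+ 2 + (1 + B) ^+ 2 by rewrite sqr_sqrtr// addr_ge0 ?sqr_ge0.
have m2 : rm A B ^+ 2 = A ^+ 2 + (1 - B) ^+ 2 by rewrite sqr_sqrtr// addr_ge0 ?sqr_ge0.
have p0 : 0 <= rp A B by exact: sqrtr_ge0.
have m0 : 0 <= rm A B by exact: sqrtr_ge0.
have SD : S * ellD A B = B.
  have : S * ellD A B = (rp A B ^+ 2 - rm A B ^+ 2) / 4 by rewrite /S /ellD; field.
  by rewrite p2 m2 => ->; field.
have SD2 : S ^+ 2 + ellD A B ^+ 2 = A ^+ 2 + 1 + B ^+ 2.
  have : S ^+ 2 + ellD A B ^+ 2 = (rp A B ^+ 2 + rm A B ^+ 2) / 2 by rewrite /S /ellD; field.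
  by rewrite p2 m2 => ->; field.
have prod : (S ^+ 2 - 1) * (1 - ellD A B ^+ 2) = A ^+ 2.
  have -> : (S ^+ 2 - 1) * (1 - ellD A B ^+ 2) = S ^+ 2 + ellD A B ^+ 2 - 1 - (S * ellD A B) ^+ 2 by ring.
  by rewrite SD2 SD; ring.
have S1 : 1 <= S.
  have hp : 1 + B <= rp A B.
    apply: le_trans (ler_norm _) _; rewrite -sqrtr_sqr ler_wsqrtr// lerDr sqr_ge0//.
  have hm : 1 - B <= rm A B.
    apply: le_trans (ler_norm _) _; rewrite -sqrtr_sqr ler_wsqrtr// lerDr sqr_ge0//.
  by rewrite /S; lra.
split=> //; rewrite -ltr_norml -(@ltr_sqr R) ?nnegrE// sqrn expr1n ltNge; apply/negP => D1.
have S21 : S ^+ 2 - 1 >= 0 by rewrite subr_ge0; nra.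
have A0 : A = 0.
  by apply/eqP; rewrite -sqrf_eq0 eq_le sqr_ge0 andbT -prod; nra.
move: adm; rewrite A0 eqxx/= => B1.
have : `|B| ^+ 2 < 1 by rewrite expr_lt1.
by rewrite sqrn -SD exprMn; nra.
Qed.

(** The last conclusion, |sinh w| <= cosh (Re w), is the source of the logarithmic growth of Im
    phi^-1. *)
Lemma ell_exist A B : (A != 0) || (`|B| < 1) ->
  [/\ - (pi / 2) < ellV A B < pi / 2, snh (ellU A B) * cos (ellV A B) = A,
      csh (ellU A B) * sin (ellV A B) = B & A ^+ 2 + B ^+ 2 <= csh (ellU A B) ^+ 2].
Proof.
move=> adm; have [/andP[D1 D2] SD prod] := ellD_spec adm.
set S := (rp A B + rm A B) / 2 in SD prod.
have S0 : 0 <= S by rewrite divr_ge0// addr_ge0// sqrtr_ge0.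
have D20 : 0 < 1 - ellD A B ^+ 2 by nra.
have DD : -1 <= ellD A B <= 1 by rewrite !ltW.
have cV : cos (ellV A B) = Num.sqrt (1 - ellD A B ^+ 2) by rewrite cos_asin.
have sV : sin (ellV A B) = ellD A B by rewrite asinK// in_itv.
have q0 : 0 < Num.sqrt (1 - ellD A B ^+ 2) by rewrite sqrtr_gt0.
have q2 : Num.sqrt (1 - ellD A B ^+ 2) ^+ 2 = 1 - ellD A B ^+ 2 by rewrite sqr_sqrtr// ltW.
have cU : csh (ellU A B) ^+ 2 = S ^+ 2.
  rewrite csh_snh /ellU ashK expr_div_n q2 -prod mulfK ?gt_eqF//; ring.
have cUS : csh (ellU A B) = S.
  by apply/eqP; rewrite -(@eqrXn2 _ 2)// ?cU// ltW// csh_gt0.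
split.
- by rewrite asin_gtNpi2 ?asin_ltpi2 ?D1 ?D2 ?ltW.
- by rewrite cV /ellU ashK divfK// gt_eqF.
- by rewrite cUS sV.
- rewrite cU (_ : A ^+ 2 + B ^+ 2 = S ^+ 2 - (1 - ellD A B ^+ 2)); first by lra.
  transitivity ((S ^+ 2 - 1) * (1 - ellD A B ^+ 2) + (S * ellD A B) ^+ 2); last by ring.
  by rewrite prod SD.
Qed.

(** The focal distances of sinh (u + i v) are cosh u + sin v and cosh u - sin v, so their difference
    determines v, and then A determines u. *)
Lemma ell_uniq u v A B : - (pi / 2) < v < pi / 2 -> snh u * cos v = A ->
  csh u * sin v = B -> u = ellU A B /\ v = ellV A B.
Proof.
move=> hv hA hB; have c0 := cos_gt0_pihalf hv.
have cs := cos2Dsin2 v; have cu := csh_snh u; have cu1 := csh_ge1 u.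
have c1 : cos v <= 1 by exact: cos_le1.
have s1 : -1 <= sin v by exact: sin_geN1.
have s2 : sin v <= 1 by exact: sin_le1.
have E1 : rp A B = csh u + sin v.
  rewrite /rp (_ : A ^+ 2 + _ = (csh u + sin v) ^+ 2); last first.
    have -> : A ^+ 2 = (csh u ^+ 2 - 1) * (1 - sin v ^+ 2).
      by rewrite cu -cs -hA; ring.
    by rewrite -hB; ring.
  by rewrite sqrtr_sqr ger0_norm//; lra.
have E2 : rm A B = csh u - sin v.
  rewrite /rm (_ : A ^+ 2 + _ = (csh u - sin v) ^+ 2); last first.
    have -> : A ^+ 2 = (csh u ^+ 2 - 1) * (1 - sin v ^+ 2).
      by rewrite cu -cs -hA; ring.
    by rewrite -hB; ring.
  by rewrite sqrtr_sqr ger0_norm//; lra.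
have ED : ellD A B = sin v by rewrite /ellD E1 E2; field.
have EV : ellV A B = v.
  by rewrite /ellV ED sinK// in_itv/=; case/andP: hv => *; rewrite !ltW.
split=> //; rewrite /ellU ED (_ : 1 - sin v ^+ 2 = cos v ^+ 2); last by rewrite -cs; ring.
by rewrite sqrtr_sqr gtr0_norm// -hA mulfK ?gt_eqF// snhK.
Qed.

Lemma continuous_ell (A B : R -> R) : continuous A -> continuous B ->
  (forall t, (A t != 0) || (`|B t| < 1)) ->
  continuous (fun t => ellU (A t) (B t)) /\ continuous (fun t => ellV (A t) (B t)).
Proof.
move=> cA cB adm.
have csq (f : R -> R) : continuous f -> continuous (fun t => f t ^+ 2).
  by move=> cf t; under eq_fun do rewrite expr2; apply: cvgM; exact: cf.
have csqrt (f : R -> R) : continuous f -> continuous (fun t => Num.sqrt (f t)).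
  by move=> cf t; apply: (@continuous_comp _ _ _ f Num.sqrt) (cf t) (@sqrt_continuous R _).
have cD : continuous (fun t => ellD (A t) (B t)).
  move=> t; apply: cvgM; last exact: cvg_cst.
  apply: cvgB.
    apply: (csqrt (fun t => A t ^+ 2 + (1 + B t) ^+ 2)) => {}t.
    apply: cvgD; first exact: csq.
    by apply: (csq (fun t => 1 + B t)) => {}t; apply: cvgD; [exact: cvg_cst|exact: cB].
  apply: (csqrt (fun t => A t ^+ 2 + (1 - B t) ^+ 2)) => {}t.
  apply: cvgD; first exact: csq.
  by apply: (csq (fun t => 1 - B t)) => {}t; apply: cvgB; [exact: cvg_cst|exact: cB].
split=> t; have [D1 _ _] := ellD_spec (adm t); last first.
  by apply: (@continuous_comp _ _ _ (fun t => ellD (A t) (B t)) (@asin R)) (cD t) _; exact: continuous_asin.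
apply: (@continuous_comp _ _ _ (fun t => A t / Num.sqrt (1 - ellD (A t) (B t) ^+ 2)) ash); last exact: continuous_ash.
apply: cvgM; first exact: cA.
apply: cvgV.
  by rewrite gt_eqF// sqrtr_gt0; case/andP: D1 => *; nra.
apply: (csqrt (fun t => 1 - ellD (A t) (B t) ^+ 2)) => x.
by apply: cvgB; [exact: cvg_cst|apply: (csq (fun t => ellD (A t) (B t)))].
Qed.

End EllipticCoordinates.

(** * The inverse twisting map along a vertical line *)

Section TwistingMap.
Context {R : realType}.
Implicit Types (q c eta : R) (k : 'I_2) (z : R[i]).

Lemma csinhE q z : csinh ('i * q%:C * z) =
  (snh (- (q * cIm z)) * cos (q * cRe z)) +i* (csh (- (q * cIm z)) * sin (q * cRe z)).
Proof.
rewrite /csinh -!cxpE (_ : 2^-1 = (2^-1)%:C); last by rewrite fmorphV/= rmorph_nat.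
rewrite mulrC; apply: complex_eqP; rewrite ?Re_realM ?Im_realM !cE ?Re_cxp ?Im_cxp !cE/=.
all: rewrite (_ : _ * cRe z - _ = - (q * cIm z)); try by ring.
all: rewrite (_ : _ * cIm z + _ = q * cRe z); try by ring.
  by rewrite cosN /snh; field.
by rewrite sinN /csh; field.
Qed.

(** Together with [lineB], the real and imaginary parts of q exp (- i theta) (c + i eta), the value
    that sinh (i q z) must take where phi z = c + i eta. *)
Definition lineA q k c eta : R := if k == 0 then q * c else q * eta.
Definition lineB q k c eta : R := if k == 0 then q * eta else - (q * c).

Lemma phi_line q k c eta z : q != 0 -> phi q (k%:R * (pi / 2)) z = c +i* eta <->
  snh (- (q * cIm z)) * cos (q * cRe z) = lineA q k c eta /\
  csh (- (q * cIm z)) * sin (q * cRe z) = lineB q k c eta.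
Proof.
move=> q0; rewrite /phi csinhE -cxpE.
set X := snh _ * _; set Y := csh _ * _.
have -> : cxp ('i * (k%:R * (pi / 2))%:C) = if k == 0 then 1 else 'i :> R[i].
  case: k => -[|[|//]] hk; rewrite -[_ == 0]/(_ == 0%N)/=.
    by rewrite mul0r mulr0 cxp0.
  rewrite mul1r; apply: complex_eqP; rewrite ?Re_cxp ?Im_cxp !cE/=.
    by rewrite (_ : 0 * 0 + _ = pi / 2) ?cos_pihalf ?mulr0//; ring.
  rewrite (_ : 0 * 0 + _ = pi / 2); last by ring.
  by rewrite (_ : 0 * _ - _ = 0) ?expR0 ?sin_pihalf ?mulr1//; ring.
have qq0 : q%:C != 0 :> R[i] by rewrite -[0]/(0%:C) (inj_eq (@complexI _)).
rewrite /lineA /lineB mulrAC; case: ifP => _.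
  rewrite mul1r; split=> [/(canRL (divfK qq0))|[-> ->]].
    by rewrite mulrC => e; have := congr1 cRe e; have := congr1 cIm e; rewrite Re_realM Im_realM.
  by apply: (canLR (mulfK qq0)); apply: complex_eqP; rewrite !cE/=; ring.
split=> [/(canRL (divfK qq0))|[-> ->]].
  rewrite [RHS]mulrC => e; have := congr1 cRe e; have := congr1 cIm e.
  by rewrite Re_realM Im_realM !cE/= !(mul0r, mul1r, add0r, sub0r) => -> <-; rewrite opprK.
by apply: (canLR (mulfK qq0)); apply: complex_eqP; rewrite !cE/=; ring.
Qed.

Lemma strip_bound q z : q != 0 -> strip q z <-> - (pi / 2) < q * cRe z < pi / 2.
Proof.
move=> q0; rewrite /strip/= -ltr_norml normrM.
have n0 : 0 < `|q| by rewrite normr_gt0.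
rewrite [_ * `|cRe z|]mulrC -ltr_pdivlMr//.
by rewrite (_ : pi / 2 / `|q| = pi / (2 * `|q|))//; field; rewrite gt_eqF.
Qed.

(** Admissibility of the interval keeps the vertical line off the slits: c is nonzero for k = 0, and
    |c| < 1/|q| for k = 1. *)
Lemma lineE q k (I : set R) c : q != 0 -> admissible q k I -> I c ->
  forall eta, (lineA q k c eta != 0) || (`|lineB q k c eta| < 1).
Proof.
move=> q0 [_ _ hI] Ic eta; rewrite /lineA /lineB; move: hI; case: ifP => _ hI.
  apply/orP; left; rewrite mulf_neq0//.
  by case: hI => /(_ _ Ic)/= h; [rewrite gt_eqF|rewrite lt_eqF].
apply/orP; right; rewrite normrN normrM.
have n0 : 0 < `|q| by rewrite normr_gt0.
by rewrite mulrC -ltr_pdivlMr// mul1r ltr_norml; exact: hI.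
Qed.

(** These four facts are all that the study of tau uses about phi^-1: continuity, injectivity,
    bounded real part, and at least logarithmic growth of the imaginary part. *)
Lemma phi_inv_line q k (I : set R) c : q != 0 -> admissible q k I -> I c ->
  let psi eta := phi_inv q (k%:R * (pi / 2)) (c +i* eta) in
  [/\ ccont psi, injective psi, forall eta, `|cRe (psi eta)| <= pi / (2 * `|q|) &
      forall eta, `|q| * `|eta| <= expR (`|q| * `|cIm (psi eta)|)].
Proof.
move=> q0 aI Ic psi.
pose A := lineA q k c; pose B := lineB q k c.
have adm := lineE q0 aI Ic.
have n0 : 0 < `|q| by rewrite normr_gt0.
(* The partial inverse behaves as an inverse only on the image, so each point of the line is first
   exhibited as a value on the strip. *)
have im eta : (phi q (k%:R * (pi / 2)) @` strip q) (c +i* eta).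
  exists ((ellV (A eta) (B eta) / q) +i* (- (ellU (A eta) (B eta) / q))).
    apply/strip_bound => //=; rewrite (mulrCA q _ q^-1) mulfV// mulr1.
    by have [] := ell_exist (adm eta).
  apply/phi_line => //=; rewrite mulrN opprK !(mulrCA q _ q^-1) mulfV// !mulr1.
  by have [] := ell_exist (adm eta).
have psiS eta : strip q (psi eta).
  have surj : set_surj (strip q) (phi q (k%:R * (pi / 2)) @` strip q) (phi q (k%:R * (pi / 2))) by [].
  by apply: (surjpinv_image_sub (dflt := fun=> 0) surj); exists (c +i* eta).
have psiK eta : phi q (k%:R * (pi / 2)) (psi eta) = c +i* eta.
  by rewrite /psi /phi_inv pinvK// inE.
have psiE eta : - (q * cIm (psi eta)) = ellU (A eta) (B eta) /\
    q * cRe (psi eta) = ellV (A eta) (B eta).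
  have [e1 e2] := (phi_line k c eta (psi eta) q0).1 (psiK eta).
  by apply: ell_uniq => //; exact/strip_bound.
have cid : continuous (fun t : R => t) by move=> t.
have cmul (s : R) : continuous (fun t : R => s * t).
  by move=> t; apply: cvgM; [exact: cvg_cst|exact: cid].
have ccst (s : R) : continuous (fun _ : R => s) by move=> t; exact: cvg_cst.
have [cU cV] : continuous (fun t => ellU (A t) (B t)) /\ continuous (fun t => ellV (A t) (B t)).
  by apply: continuous_ell => //; rewrite /A /B /lineA /lineB; case: (k == 0).
split.
- split.
    rewrite (_ : cRe \o psi = fun t => q^-1 * ellV (A t) (B t)).
      by move=> t; apply: cvgM; [exact: cvg_cst|exact: cV].
    by apply/funext => t/=; rewrite -(psiE t).2 mulKf.
  rewrite (_ : cIm \o psi = fun t => - q^-1 * ellU (A t) (B t)).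
    by move=> t; apply: cvgM; [exact: cvg_cst|exact: cU].
  by apply/funext => t/=; rewrite -(psiE t).1 mulrNN mulKf.
- by move=> s t e; have := psiK s; rewrite e psiK => -[].
- by move=> eta; apply: ltW; exact: psiS.
(* |q eta| <= |A + i B| <= cosh U <= exp |U|, with U = - q Im (psi eta). *)
move=> eta; rewrite -normrM -[`|q| * `|cIm _|]normrM -[`|q * cIm _|]normrN (psiE eta).1.
apply: le_trans (csh_le_exp _); have [_ _ _ h] := ell_exist (adm eta).
rewrite -(@ler_sqr R) ?nnegrE ?(ltW (csh_gt0 _))// sqrn; apply: le_trans h.
rewrite /A /B /lineA /lineB; case: ifP => _; first by rewrite lerDr sqr_ge0.
by rewrite lerDl sqr_ge0.
Qed.

End TwistingMap.

(** * Vanishing of the Laplace transform along a curve *)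

Section LaplaceUniqueness.
Context {R : realType}.
Notation mu := (@lebesgue_measure R).
Implicit Types (f g h : R -> R[i]) (psi : R -> R[i]) (t y : R) (z v : R[i]).

Lemma ccont_near h t (e : R) : ccont h -> 0 < e -> \forall s \near t, nc (h s - h t) < e.
Proof.
move=> [h1 h2] e0; have e20 : 0 < e / 2 by rewrite divr_gt0.
have /cvgrPdist_lt/(_ _ e20) n1 := h1 t; have /cvgrPdist_lt/(_ _ e20) n2 := h2 t.
near=> s; apply: le_lt_trans (nc_le _) _; rewrite !cE.
have : `|cRe (h t) - cRe (h s)| < e / 2 by near: s.
have : `|cIm (h t) - cIm (h s)| < e / 2 by near: s.
by rewrite distrC [X in _ -> X < _ -> _]distrC; lra.
Unshelve. all: by end_near. Qed.

Lemma ccont_of_near h : (forall t (e : R), 0 < e -> \forall s \near t, nc (h s - h t) < e) -> ccont h.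
Proof.
move=> H; split=> t; apply/cvgrPdist_lt => e e0; have := H t e e0; apply: filterS => s hs;
  apply: le_lt_trans hs; rewrite distrC /=.
  by rewrite -cReN -cReD nc_Re.
by rewrite -cImN -cImD nc_Im.
Qed.

Lemma ccont_cdiff_comp (F : R[i] -> R[i]) psi : (forall z, cdiff F z) -> ccont psi ->
  ccont (fun t => F (psi t)).
Proof.
move=> dF cpsi; apply: ccont_of_near => t e e0.
have [r r0 Hr] := cdiff_continuous (dF (psi t)) e0.
have := ccont_near t cpsi r0; apply: filterS => s hs.
by have := Hr _ hs; rewrite [psi t + _]addrC subrK.
Qed.

Definition superexp1 g := ccont g /\ forall N : R, 0 <= N -> exists2 K : R, 0 <= K &
  forall t, expR (N * `|t|) * nc (g t) <= K * ker t.

Lemma superexp1_int g : superexp1 g -> cint mu setT g.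
Proof.
move=> [cg gN]; have [K K0 HK] := gN 0 (lexx 0).
apply: (@cint_ker _ _ K); first exact: ccont_meas.
by move=> t; have := HK t; rewrite mul0r expR0 mul1r.
Qed.

Lemma superexp1M g h (M : R) : superexp1 g -> ccont h -> 0 <= M ->
  (forall t, nc (h t) <= expR (M * `|t|)) -> superexp1 (fun t => h t * g t).
Proof.
move=> [cg gN] ch M0 hM; split; first exact: ccontM.
move=> N N0; have [K K0 HK] := gN (N + M) (addr_ge0 N0 M0).
exists K => // t; apply: le_trans (HK t); rewrite ncM mulrA ler_wpM2r ?nc_ge0//.
by rewrite mulrDl expRD ler_wpM2l ?expR_ge0.
Qed.

Lemma superexp1_moment g : superexp1 g -> superexp1 (fun t => - t%:C * g t).
Proof.
move=> sg; apply: (superexp1M sg _ ler01).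
  by apply: ccontN; exact: ccont_id.
move=> t; rewrite ncN nc_real mul1r; apply: le_trans (expR_ge1Dx _).
by rewrite lerDr.
Qed.

Lemma superexp1_cxp g z : superexp1 g -> superexp1 (fun t => cxp (- z * t%:C) * g t).
Proof.
move=> sg; apply: (superexp1M sg _ (nc_ge0 z)).
  by apply: ccont_cxp; apply: ccontM; [exact: ccont_cst|exact: ccont_id].
move=> t; rewrite nc_cxp ler_expR; apply: le_trans (ler_norm _) _.
by apply: le_trans (nc_Re _) _; rewrite ncM ncN nc_real.
Qed.

Definition Lap g z := cI mu setT (fun t => cxp (- z * t%:C) * g t).

Lemma Lap_quad g z : superexp1 g -> exists2 C : R, 0 <= C & forall v, nc v <= 1 ->
  nc (Lap g (z + v) - Lap g z - v * Lap (fun t => - t%:C * g t) z) <= C * nc v ^+ 2.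
Proof.
move=> sg; have [cg gN] := sg.
have ml : cmeas setT (fun t : R => - t%:C : R[i]) by apply: ccont_meas; apply: ccontN; exact: ccont_id.
have [M M0|C C0 HC] := @EI_complex_quad _ _ _ mu (fun t : R => - t%:C) (fun=> 0) ml (cmeas_cst _ 0) g (ccont_meas cg) _ z 0.
  have [K K0 HK] := gN M M0.
  apply: (rint_dom measurableT _ (rintZ measurableT K (@rint_ker R))).
    apply: measurable_funM; last exact/cmeas_nc/ccont_meas.
    apply: measurableT_comp => //; apply: measurable_funM; first exact: measurable_cst.
    by apply: measurable_funD; apply: cmeas_nc => //; exact: cmeas_cst.
  move=> t _; rewrite ger0_norm ?mulr_ge0 ?expR_ge0 ?nc_ge0//.
  by rewrite nc0 addr0 ncN nc_real.
have EE h z' : EI mu (fun t : R => - t%:C) (fun=> 0) h z' 0 = Lap h z'.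
  by apply: eq_cI => t _; congr (cxp _ * _); ring.
exists C => // v v1; have := HC v 0; rewrite nc0 !addr0 mul0r addr0 !EE.
exact.
Qed.

(* The curve has no isolated points, so the derivative of [Lap g] vanishes along it too. *)
Lemma Lap_curve g psi : superexp1 g -> ccont psi -> injective psi ->
  (forall t, Lap g (psi t) = 0) -> forall t, Lap (fun s => - s%:C * g s) (psi t) = 0.
Proof.
move=> sg cpsi ipsi H t; set D := Lap _ _.
apply/eqP; rewrite -nc_eq0; apply/negPn/negP => D0.
have {}D0 : 0 < nc D by rewrite lt_neqAle eq_sym D0 nc_ge0.
have [C C0 HC] := Lap_quad (psi t) sg.
have C1 : 0 < C + 1 by lra.
have e0 : 0 < Num.min 1 (nc D / (C + 1)) by rewrite lt_min ltr01 divr_gt0.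
have /nbhs_ballP[r /= r0 Hr] := ccont_near t cpsi e0.
(* A nearby curve point differs from psi t by injectivity. At both points [Lap g] is 0, so the
   remainder bound gives |v| |D| <= C |v|^2, against (C + 1) |v| < |D|. *)
have := Hr (t + r / 2); rewrite /ball/= => /(_ _).
have hr : `|t - (t + r / 2)| < r by rewrite opprD addNKr normrN ger0_norm; lra.
move=> /(_ hr); set v := _ - _; rewrite lt_min => /andP[/ltW v1].
rewrite ltr_pdivlMr// => v2.
have v0 : 0 < nc v.
  rewrite lt_neqAle nc_ge0 andbT eq_sym nc_eq0 subr_eq0; apply/eqP => /ipsi.
  by lra.
have := HC v v1; rewrite [psi t + v]addrC {1}/v subrK !H subrr sub0r ncN ncM -/D -/v.
by nra.
Qed.

Lemma Fourier_zero g (K : R) : ccont g -> (forall t, nc (g t) <= K) -> cint mu setT g ->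
  (forall y, cI mu setT (fun t => cxp ('i * (t * y)%:C) * g t) = 0) -> forall t, g t = 0.
Proof.
move=> cg gK ig H t; have := @Fourier_inversion R 1 g K t (expr1n _ _) cg gK ig.
have -> : (fun xi => cI mu setT (fun t => cxp ('i * (1 * t * xi)%:C) * g t)) = fun=> 0.
  by apply/funext => y; rewrite -[RHS](H y); apply: eq_cI => x _; rewrite mul1r.
move=> /(_ _)-/(_ _)/esym/eqP.
have i0 : cint mu setT (fun _ : R => 0 : R[i]).
  by apply: (@cint_ker _ _ 0); [exact: cmeas_cst|move=> x; rewrite nc0 mul0r].
move=> /(_ i0); rewrite (@eq_cI _ _ _ _ _ _ (fun=> 0)); last by move=> x _; rewrite mulr0.
rewrite cI0 mulf_eq0 => /orP[|/eqP//].
by rewrite (negPf two_pi_neq0).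
Qed.

(* All moments of exp (- z0 t) g vanish at a point z0 of the curve; expanding exp (i y t), so does
   its Fourier transform. *)
Theorem Lap_uniq g psi : superexp1 g -> ccont psi -> injective psi ->
  (forall t, Lap g (psi t) = 0) -> forall t, g t = 0.
Proof.
move=> sg cpsi ipsi H.
pose gn n t := (- t%:C) ^+ n * g t.
have gnS n : gn n.+1 = fun t => - t%:C * gn n t.
  by apply/funext => t; rewrite /gn exprS mulrA.
have sn n : superexp1 (gn n).
  elim: n => [|n IH]; last by rewrite gnS; exact: superexp1_moment.
  by rewrite (_ : gn 0%N = g)//; apply/funext => t; rewrite /gn expr0 mul1r.
have mom n t : Lap (gn n) (psi t) = 0.
  elim: n t => [t|n IH t]; last by rewrite gnS; exact: (Lap_curve (sn n) cpsi ipsi IH).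
  by rewrite -[RHS](H t); apply: eq_cI => s _; rewrite /gn expr0 mul1r.
pose z0 := psi 0; pose k t := cxp (- z0 * t%:C) * g t.
have sk : superexp1 k by exact: superexp1_cxp.
suff k0 : forall t, k t = 0.
  by move=> t; have /eqP := k0 t; rewrite mulf_eq0 (negPf (cxp_neq0 _)) => /eqP.
have [ck kN] := sk; have [K K0 HK] := kN 0 (lexx 0).
have kK t' : nc (k t') <= K.
  have h1 : nc (k t') <= K * ker t'.
    by apply: le_trans (HK t'); rewrite ler_peMl ?nc_ge0// -expR0 ler_expR !mulr_ge0.
  by apply: le_trans h1 _; rewrite ler_piMr ?ker_le1.
apply: (Fourier_zero ck kK (superexp1_int sk)) => y.
(* The factor 2 makes the Taylor error geometric: |t y|^n / n! <= 2^-n exp (2 |t y|), and the decay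
   of k absorbs the exponential. *)
have {K K0 HK kK} [K K0 HK] := kN (2 * `|y|) (mulr_ge0 (ler0n R 2) (normr_ge0 y)).
have poly0 n : cI mu setT (fun t => cxp_poly n ('i * (t * y)%:C) * k t) = 0 /\
    cint mu setT (fun t => cxp_poly n ('i * (t * y)%:C) * k t).
  elim: n => [|n [IH iIH]].
    rewrite (_ : (fun t => _) = fun=> 0).
      split; first exact: cI0.
      by apply: (@cint_ker _ _ 0); [exact: cmeas_cst|move=> x; rewrite nc0 mul0r].
    by apply/funext => t; rewrite /cxp_poly big_ord0 mul0r.
  have jn : cint mu setT (fun t => cxp (- z0 * t%:C) * gn n t).
    exact: superexp1_int (superexp1_cxp z0 (sn n)).
  (* The signs come from i t y = (- i y) (- t), since [gn] carries powers of - t. *)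
  pose cn : R[i] := (n`!%:R^-1)%:C * (- 'i * y%:C) ^+ n.
  rewrite (_ : (fun t => _) = fun t => cxp_poly n ('i * (t * y)%:C) * k t + cn * (cxp (- z0 * t%:C) * gn n t)).
    split; last by apply: cintD => //; exact: cintZ.
    by rewrite cID//; [rewrite IH cIZ// [cI _ _ _]mom mulr0 addr0|exact: cintZ].
  apply/funext => t; rewrite /cxp_poly big_ord_recr/= mulrDl; congr (_ + _).
  rewrite /k /cn /gn rmorphM/= (_ : 'i * (t%:C * y%:C) = (- 'i * y%:C) * (- t%:C)); last by ring.
  by rewrite exprMn; ring.
set Z := cI _ _ _; apply/eqP; rewrite -nc_eq0; apply/negPn/negP => Z0.
have {}Z0 : 0 < nc Z by rewrite lt_neqAle eq_sym Z0 nc_ge0.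
pose I0 := \int[mu]_t (K * ker t).
have bn n : nc Z <= 2^-1 ^+ n * I0.
  have [p0 pi0] := poly0 n.
  have iZ : cint mu setT (fun t => cxp ('i * (t * y)%:C) * k t).
    apply: (@cint_ker _ _ K).
      apply: cmeasM; last exact: ccont_meas.
      apply/ccont_meas/ccont_cxp/ccontM; first exact: ccont_cst.
      apply: ccont_real => x; apply: cvgM => //; exact: cvg_cst.
    move=> t; rewrite nc_phaseM; apply: le_trans (HK t).
    by rewrite ler_peMl ?nc_ge0// -expR0 ler_expR !mulr_ge0.
  rewrite -[Z]subr0 -[X in _ - X]p0 -cIB//.
  rewrite -RintegralZl//; last by apply: rintZ => //; exact: rint_ker.
  apply: le_cI; [by []|exact: cintB|by apply: rintZ => //; apply: rintZ => //; exact: rint_ker|].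
  move=> t _; rewrite -mulrBl ncM.
  apply: le_trans (ler_wpM2r (nc_ge0 _) (cxp_poly_bound _ _)) _.
  have -> : cRe ('i * (t * y)%:C) = 0 by rewrite cE/=; ring.
  rewrite normr0 expR0 mulr1 ncM nc_i mul1r nc_real.
  apply: le_trans (ler_wpM2l _ (HK t)); last by rewrite exprn_ge0.
  rewrite mulrA ler_wpM2r ?nc_ge0//.
  have -> : `|t * y| ^+ n / n`!%:R = 2^-1 ^+ n * ((2 * `|t * y|) ^+ n / n`!%:R).
    by rewrite [(2 * _) ^+ n]exprMn !mulrA -exprMn mulVf ?pnatr_eq0// expr1n mul1r.
  rewrite ler_wpM2l ?exprn_ge0 ?invr_ge0//.
  have x0 : 0 <= 2 * `|t * y| by rewrite mulr_ge0.
  rewrite (_ : 2 * `|y| * `|t| = 2 * `|t * y|); last by rewrite normrM; ring.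
  case: n {p0 pi0} => [|n]; first by rewrite expr0 mul1r fact0 invr1 -expR0 ler_expR.
  by apply: le_trans (expR_ge1Dxn n x0); rewrite lerDr.
have I00 : 0 <= I0 by have := le_trans (ltW Z0) (bn 0%N); rewrite expr0 mul1r.
have : \forall n \near \oo, 2^-1 ^+ n * I0 < nc Z.
  have c0 : (fun n => 2^-1 ^+ n * I0) @ \oo --> (0 : R).
    rewrite -[X in _ --> X](mul0r I0); apply: cvgM; last exact: cvg_cst.
    by apply: cvg_expr; rewrite ger0_norm ?invr_ge0// invf_lt1 ?ltr1n.
  have /cvgrPdist_lt/(_ _ Z0) := c0; apply: filterS => n; rewrite sub0r normrN ger0_norm//.
  by rewrite mulr_ge0// exprn_ge0// invr_ge0.
move=> [n _ /(_ n (leqnn n))/= h].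
by have := le_lt_trans (bn n) h; rewrite ltxx.
Qed.

End LaplaceUniqueness.

(** * The transformation tau *)

Section TauIntegral.
Context {R : realType}.
Notation mu := (@lebesgue_measure R).
Notation mu2 := (mu \x mu)%E.
Implicit Types (f g : R -> R -> R[i]) (s t x y eta : R) (z w : R[i]).

Variables (p1 p2 r1 r2 : R).
Hypothesis (pr1 : conj_exp p1 r2) (pr2 : conj_exp p2 r1).
Variables (psi : R -> R[i]) (c B kap : R).
Hypothesis (kap0 : 0 < kap) (cpsi : ccont psi) (psiB : forall eta, `|cRe (psi eta)| <= B).
Hypothesis (psi_log : forall eta, kap * `|eta| <= expR (kap * `|cIm (psi eta)|)).

Notation gsr := (gsr p1 p2 r1 r2).

Lemma superexp_slice f x : superexp f -> superexp1 (f x).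
Proof.
move=> [f1 f2 fN]; split=> // N N0; have [K K0 HK] := fN N N0; exists K => // t.
apply: le_trans (_ : K * (ker x * ker t) <= _).
  apply: le_trans (HK x t); rewrite ler_wpM2r ?nc_ge0// ler_expR ler_wpM2l//.
  by rewrite lerDr.
by rewrite ler_wpM2l// ler_piMl ?ker_ge0 ?ker_le1.
Qed.

(** At p = (s, eta), [l1] is the coefficient of x1 in the inverse Fourier kernel and [l2] that of x2
    in the inverse Laplace kernel. *)
Definition l1 (p : R * R) : R[i] := - 'i * p.1%:C.
Definition l2 (p : R * R) : R[i] := c +i* p.2.

(* The Fourier transform in x1 of the Laplace transform in x2, evaluated at [psi eta]. *)
Definition FT_psi f (s eta : R) : R[i] := FT f (- 'i * psi eta) s%:C.

(* |Im (psi eta)| grows at least like log |eta|, and the exponent p1 of the decay of [FT f] exceeds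
   1; hence [FT_psi f] decays faster than any power of eta. *)
Lemma FT_psi_bound f n : gsr f -> exists2 K : R, 0 <= K & forall s eta,
  (1 + (nc (l1 (s, eta)) + nc (l2 (s, eta)))) ^+ n * nc (FT_psi f s eta) <= K * (ker s * ker eta).
Proof.
move=> [F gF ->]; have [qFh gFh] := gs_FT pr1 pr2 gF.
(* The polynomial weight costs n factors exp |s| and n factors exp (kap |I|); two more of the latter
   produce [ker eta]. *)
pose N := n%:R + n.+2%:R * kap.
have N0 : 0 <= N by rewrite addr_ge0 ?mulr_ge0 ?ler0n// ltW.
have [K [b [K0 b0 HK]]] := growth_ker pr1 pr2 gFh N0.
pose E := expR (b * (B `^ r1 + `|0 : R| `^ r2)).
pose D := 1 + `|c| + kap^-1.
have D1 : 1 <= D by rewrite /D -addrA lerDl addr_ge0// invr_ge0 ltW.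
have D0 : 0 <= D by exact: le_trans D1.
exists (D ^+ n.+2 * (K * E)).
  exact: (mulr_ge0 (exprn_ge0 _ D0) (mulr_ge0 (ltW K0) (expR_ge0 _))).
move=> s eta; rewrite /FT_psi.
(* Multiplication by - i moves the large Im psi to the real part, along which FT f decays, and the
   bounded Re psi to the imaginary part. *)
have -> : - 'i * psi eta = cIm (psi eta) +i* (- cRe (psi eta)).
  by apply: complex_eqP; rewrite !cE/=; ring.
set I := cIm _; set X := expR `|s|; set Y := expR (kap * `|I|).
have X1 : 1 <= X by rewrite -expR0 ler_expR.
have Y1 : 1 <= Y by rewrite -expR0 ler_expR mulr_ge0// ltW.
have eY : `|eta| <= kap^-1 * Y by rewrite ler_pdivlMl//; exact: psi_log.
have DY : 1 + `|c| + `|eta| <= D * Y.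
  have c0 := normr_ge0 c; rewrite /D !mulrDl; apply: lerD => //.
  by apply: lerD; [rewrite mul1r|rewrite ler_peMr].
have DY0 : 0 <= D * Y by rewrite mulr_ge0// expR_ge0.
have LE : 1 + (nc (l1 (s, eta)) + nc (l2 (s, eta))) <= X * (D * Y).
  have a1 : nc (l1 (s, eta)) = `|s| by rewrite ncM ncN nc_i mul1r nc_real.
  have a2 : nc (l2 (s, eta)) <= `|c| + `|eta| by exact: nc_le.
  have a3 : 1 + `|s| <= X by exact: expR_ge1Dx.
  have := normr_ge0 s; have := normr_ge0 c; have := normr_ge0 eta.
  move=> e0 c0 s0; apply: le_trans (_ : (1 + `|s|) * (1 + `|c| + `|eta|) <= _).
    by rewrite a1; nra.
  by apply: ler_pM; rewrite ?addr_ge0.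
have L0 : 0 <= 1 + (nc (l1 (s, eta)) + nc (l2 (s, eta))) by rewrite !addr_ge0 ?nc_ge0.
have kereta : 1 <= ker eta * (D * Y) ^+ 2.
  rewrite /ker ler_pdivlMl ?oneDsq_gt0// mulr1.
  apply: le_trans (_ : (1 + `|c| + `|eta|) ^+ 2 <= _).
    have := normr_ge0 c; have := normr_ge0 eta; have <- : `|eta| ^+ 2 = eta ^+ 2 by exact: sqrn.
    by nra.
  by rewrite ler_sqr ?nnegrE ?addr_ge0.
have hb : nc (FT (rr F) (I +i* - cRe (psi eta)) s%:C) * expR (N * (`|I| + `|s|)) <= K * E * ker s.
  have := HK I (- cRe (psi eta)) s 0; rewrite -/(s%:C) => /le_trans; apply.
  rewrite mulrA; apply: ler_wpM2r; first exact: ker_ge0.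
  rewrite -[leRHS]mulr1; apply: ler_pM; rewrite ?ker_ge0 ?ker_le1//.
    by rewrite mulr_ge0 ?expR_ge0// ltW.
  rewrite ler_wpM2l ?(ltW K0)// ler_expR ler_wpM2l ?(ltW b0)//.
  have r10 : 0 <= r1 by case: pr2 => _ r11 _; lra.
  rewrite /decay normrN lerD2r; apply: ge0_ler_powR => //.
  by rewrite nnegrE (le_trans _ (psiB 0)).
set nh := nc _ in hb *; have nh0 : 0 <= nh by exact: nc_ge0.
apply: le_trans (_ : (X * (D * Y)) ^+ n * nh * (ker eta * (D * Y) ^+ 2) <= _).
  rewrite -[leLHS]mulr1; apply: ler_pM => //; first by rewrite mulr_ge0 ?exprn_ge0.
  rewrite ler_wpM2r//; apply: lerXn2r; rewrite ?nnegrE//.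
  by rewrite mulr_ge0// expR_ge0.
have XY : X ^+ n * Y ^+ n.+2 <= expR (N * (`|I| + `|s|)).
  rewrite -!expRM_natl -expRD ler_expR /N.
  have := normr_ge0 s; have := normr_ge0 I; have k0 := ltW kap0.
  have n0 := ler0n R n; have n20 := ler0n R n.+2.
  have e1 : 0 <= n%:R * `|I| by rewrite mulr_ge0.
  have e2 : 0 <= n.+2%:R * kap * `|s| by rewrite !mulr_ge0.
  move=> _ _; rewrite -subr_ge0.
  rewrite (_ : _ - _ = n%:R * `|I| + n.+2%:R * kap * `|s|); first exact: addr_ge0.
  by ring.
rewrite (_ : _ * _ * _ = D ^+ n.+2 * ker eta * (nh * (X ^+ n * Y ^+ n.+2))); last first.
  by rewrite !exprMn !exprS; ring.
apply: le_trans (_ : D ^+ n.+2 * ker eta * (K * E * ker s) <= _); last first.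
  by rewrite le_eqVlt; apply/orP; left; apply/eqP; ring.
rewrite ler_wpM2l//; first by rewrite mulr_ge0 ?exprn_ge0 ?ker_ge0.
by apply: le_trans hb; rewrite ler_wpM2l.
Qed.

Lemma FT_psi_tame f : gsr f -> exists K, tame K (FT_psi f).
Proof.
move=> gf; have [K K0 HK] := FT_psi_bound 0 gf; exists K.
have sf : sephol (FT f) by exact/quad_diff_sephol/FT_quad_diff/(gsr_superexp pr1 pr2 gf).
split=> [eta|s|s eta].
- exact: (sephol_ccont2 0 (- 'i * psi eta) sf).
- apply: (@ccont_cdiff_comp _ (fun z => FT f (- 'i * z) s%:C)) => // z.
  apply: (@cdiff_comp _ (fun z => FT f z s%:C) (fun z => - 'i * z)).
    exact: sf.1.
  have := @cdiff_affine R 0 (- 'i) z; congr cdiff.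
  by apply/funext => w; rewrite add0r.
- by have := HK s eta; rewrite expr0 mul1r.
Qed.

Let tame_exp f z : superexp f -> exists K, tame K (fun x1 x2 => cxp (- z * x2%:C) * f x1 x2).
Proof.
move=> [f1 f2 fN]; have [K K0 HK] := fN (nc z) (nc_ge0 z); exists K; split=> [x2|x1|x1 x2].
- by apply: ccontM => //; exact: ccont_cst.
- by apply: ccontM => //; apply: ccont_cxp; apply: ccontM; [exact: ccont_cst|exact: ccont_id].
apply: le_trans (HK x1 x2); rewrite ncM ler_wpM2r ?nc_ge0// nc_cxp ler_expR.
apply: le_trans (ler_norm _) _; apply: le_trans (nc_Re _) _; rewrite ncM ncN nc_real.
by rewrite ler_wpM2l ?nc_ge0// lerDr.
Qed.

(** Fourier inversion in x1 at fixed eta: the dependence on x1, so far hidden in f, becomes a pure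
    exponential. *)
Lemma Lap_FT_psi f x eta : gsr f -> Lap (f x) (psi eta) =
  (2 * pi)%:C^-1 * cI mu setT (fun s => cxp ('i * (- 1 * x * s)%:C) * FT_psi f s eta).
Proof.
move=> gf; have sf := gsr_superexp pr1 pr2 gf.
pose z := psi eta; have [K tz] := tame_exp z sf; have K0 := tame_ge0 tz.
pose u t := Lap (f t) z.
have cu : ccont u.
  apply: (@ccont_cI _ _ _ mu (fun t y => cxp (- z * y%:C) * f t y) (fun y => K * ker y)).
  - by move=> t; case: tz => _ c2 _; exact: ccont_meas.
  - by case: tz.
  - by apply: rintZ => //; exact: rint_ker.
  - by move=> t y; exact: tame_le1 tz.
have iu : cint mu setT u.
  exact: (cint_Fubini1 (m1 := mu) (m2 := mu) (tame_int tz) (fun x => tame_int2 x tz)).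
have bu t : nc (u t) <= \int[mu]_y (K * ker y).
  apply: le_cI => //; [exact: tame_int2 tz|by apply: rintZ => //; exact: rint_ker|].
  by move=> y _; exact: tame_le1 tz.
have EF : (fun xi => cI mu setT (fun t => cxp ('i * (1 * t * xi)%:C) * u t)) =
    (fun s => FT_psi f s eta).
  apply/funext => s; rewrite /FT_psi /FT.
  have tp := tame_phase 0 s tz.
  transitivity (cI mu2 setT (fun p => phase2 p.1 p.2 0 s * (cxp (- z * p.2%:C) * f p.1 p.2))); last first.
    apply: eq_cI => p _; rewrite mulrA /phase2 -cxpD; congr (cxp _ * _).
    by rewrite rmorphB !rmorphM/= mulr0 subr0 /z; apply: complex_eqP; rewrite !cE/=; ring.
  rewrite (tame_Fubini1 tp); apply: eq_cI => t _.
  rewrite /u /Lap -cIZ//; last exact: tame_int2 tz.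
  by apply: eq_cI => y _; rewrite /phase2 mulr0 subr0 mul1r.
have [Kh th] := FT_psi_tame gf.
have iF : cint mu setT (fun s => FT_psi f s eta) by exact: tame_int1 th.
have := @Fourier_inversion R 1 u _ x (expr1n _ _) cu bu iu; rewrite EF => /(_ iF) ->.
rewrite mulrA mulVf ?mul1r//.
exact: two_pi_neq0.
Qed.

Lemma tame_tau f x1 x2 : gsr f ->
  exists K, tame K (fun s eta => cxp (l1 (s, eta) * x1%:C + l2 (s, eta) * x2%:C) * FT_psi f s eta).
Proof.
move=> /FT_psi_tame[K th]; exists (expR (c * x2) * K).
apply: (@tameM _ _ _ (fun s eta => cxp (l1 (s, eta) * x1%:C + l2 (s, eta) * x2%:C)) _ th); first exact: expR_ge0.
- move=> eta; rewrite /l1 /l2/=; apply: ccont_cxp; apply: ccontD; last exact: ccont_cst.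
  apply: ccontM; last exact: ccont_cst.
  by apply: ccontM; [exact: ccont_cst|exact: ccont_id].
- move=> s; rewrite /l1 /l2/=; apply: ccont_cxp; apply: ccontD; first exact: ccont_cst.
  apply: ccontM; last exact: ccont_cst.
  rewrite (_ : Complex c = fun eta => c%:C + 'i * eta%:C).
    by apply: ccontD; [exact: ccont_cst|apply: ccontM; [exact: ccont_cst|exact: ccont_id]].
  by apply/funext => eta; apply: complex_eqP; rewrite !cE/=; ring.
move=> s eta; rewrite nc_cxp ler_expR le_eqVlt; apply/orP; left; apply/eqP.
by rewrite !cE/=; ring.
Qed.

Definition tauf f x1 x2 := (2 * pi)%:C^-1 *
  cI mu setT (fun eta => cxp ((c +i* eta) * x2%:C) * Lap (f x1) (psi eta)).

(** Inserting [Lap_FT_psi] into the inverse Laplace integral gives a double integral, linear in f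
    and smooth in x1 and x2 jointly. One (2 pi)^-1 comes from each inversion. *)
Lemma tauf_EI f x1 x2 : gsr f ->
  tauf f x1 x2 = EI mu2 l1 l2 (fun p => (2 * pi)%:C^-1 ^+ 2 * FT_psi f p.1 p.2) x1%:C x2%:C.
Proof.
move=> gf; have [K tt] := tame_tau x1 x2 gf; have [Kh th] := FT_psi_tame gf.
transitivity ((2 * pi)%:C^-1 ^+ 2 * cI mu2 setT
  (fun p => cxp (l1 (p.1, p.2) * x1%:C + l2 (p.1, p.2) * x2%:C) * FT_psi f p.1 p.2)); last first.
  by rewrite -cIZ//; [apply: eq_cI; case=> s eta _ /=; ring|exact: tame_int tt].
pose V eta := cI mu setT (fun s => cxp (l1 (s, eta) * x1%:C + l2 (s, eta) * x2%:C) * FT_psi f s eta).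
have iV : cint mu setT V.
  apply: (@cint_ker _ _ (K * \int[mu]_s ker s)).
    apply/ccont_meas; apply: (@ccont_cI _ _ _ mu (fun eta s => cxp (l1 (s, eta) * x1%:C + l2 (s, eta) * x2%:C) * FT_psi f s eta) (fun s => K * ker s)).
    - by move=> eta; case: tt => c1 _ _; exact: ccont_meas (c1 eta).
    - by case: tt.
    - by apply: rintZ => //; exact: rint_ker.
    - by move=> eta s; exact: tame_le2 tt.
  move=> eta; rewrite mulrAC -RintegralZl//; last exact: rint_ker.
  apply: le_cI => //; [exact: tame_int1 tt|by apply: rintZ => //; exact: rint_ker|].
  by move=> s _; rewrite -[leRHS]mulrA [ker eta * _]mulrC; case: tt.
rewrite (tame_Fubini2 tt) expr2 -mulrA /tauf; congr (_ * _).
apply: (etrans _ (cIZ measurableT (2 * pi)%:C^-1 iV)).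
apply: eq_cI => eta _; rewrite Lap_FT_psi// mulrCA; congr (_ * _); rewrite /V -cIZ//.
  apply: eq_cI => s _; rewrite mulrA -cxpD; congr (cxp _ * _).
  by rewrite /l1 /l2/= addrC; congr (_ + _); apply: complex_eqP; rewrite !cE/=; ring.
have := tame_int1 eta (tame_phase 0 (- x1) th).
by congr cint; apply/funext => s; rewrite /phase2; congr (cxp ('i * _%:C) * _); ring.
Qed.

End TauIntegral.

(** * Linearity and injectivity of tau *)

Section TauProperties.
Context {R : realType}.
Notation mu := (@lebesgue_measure R).
Notation mu2 := (mu \x mu)%E.
Implicit Types (f g : R -> R -> R[i]) (s t x y eta : R) (z w a : R[i]).

Variables (p1 p2 r1 r2 : R).
Hypothesis (pr1 : conj_exp p1 r2) (pr2 : conj_exp p2 r1).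
Variables (psi : R -> R[i]) (c B kap : R).
Hypothesis (kap0 : 0 < kap) (cpsi : ccont psi) (psiB : forall eta, `|cRe (psi eta)| <= B).
Hypothesis (psi_log : forall eta, kap * `|eta| <= expR (kap * `|cIm (psi eta)|)).

Notation gsr := (gsr p1 p2 r1 r2).

Let hatT f : gsr f -> exists K, tame K (FT_psi psi f) :=
  @FT_psi_tame _ _ _ _ _ pr1 pr2 _ c _ _ kap0 cpsi psiB psi_log f.

Let tauT f x1 x2 : gsr f -> exists K, tame K
    (fun s eta => cxp (l1 (s, eta) * x1%:C + l2 c (s, eta) * x2%:C) * FT_psi psi f s eta) :=
  @tame_tau _ _ _ _ _ pr1 pr2 _ c _ _ kap0 cpsi psiB psi_log f x1 x2.

Let tauE f x1 x2 : gsr f -> tauf psi c f x1 x2 =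
    EI mu2 l1 (l2 c) (fun p => (2 * pi)%:C^-1 ^+ 2 * FT_psi psi f p.1 p.2) x1%:C x2%:C :=
  @tauf_EI _ _ _ _ _ pr1 pr2 _ c _ _ kap0 cpsi psiB psi_log f x1 x2.

Lemma FT_psi_lin a f g s eta : gsr f -> gsr g ->
  FT_psi psi (fun x1 x2 => a * f x1 x2 + g x1 x2) s eta = a * FT_psi psi f s eta + FT_psi psi g s eta.
Proof.
move=> gf gg.
have i1 := FT_integrand (- 'i * psi eta) s%:C (gsr_superexp pr1 pr2 gf).
have i2 := FT_integrand (- 'i * psi eta) s%:C (gsr_superexp pr1 pr2 gg).
rewrite /FT_psi /FT -cIZ// -cID//; last exact: cintZ.
by apply: eq_cI => p _; ring.
Qed.

Lemma tauf_int f x1 x2 : gsr f -> cint mu2 setT (fun p =>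
  cxp (l1 p * x1%:C + l2 c p * x2%:C) * ((2 * pi)%:C^-1 ^+ 2 * FT_psi psi f p.1 p.2)).
Proof.
move=> /(tauT x1 x2)[K /tame_int tt].
have := cintZ measurableT ((2 * pi)%:C^-1 ^+ 2) tt.
by congr cint; apply/funext => -[s eta]/=; ring.
Qed.

Lemma tauf_lin a f g x1 x2 : gsr f -> gsr g ->
  tauf psi c (fun x1 x2 => a * f x1 x2 + g x1 x2) x1 x2 = a * tauf psi c f x1 x2 + tauf psi c g x1 x2.
Proof.
move=> gf gg; rewrite !tauE//; last exact: gsr_lin.
have i1 := tauf_int x1 x2 gf; have i2 := tauf_int x1 x2 gg.
rewrite /EI -cIZ// -cID//; last exact: cintZ.
by apply: eq_cI => p _; rewrite FT_psi_lin//; ring.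
Qed.

Lemma Lap_psi_ccont f x : gsr f -> ccont (fun eta => Lap (f x) (psi eta)).
Proof.
move=> gf; apply: (@ccont_cdiff_comp _ (Lap (f x))) => // z.
have [C C0 HC] := Lap_quad z (superexp_slice x (gsr_superexp pr1 pr2 gf)).
exact: quad_cdiff C0 HC.
Qed.

Lemma Lap_psi_bound f x : gsr f -> exists K : R, forall eta, nc (Lap (f x) (psi eta)) <= K * ker eta.
Proof.
move=> gf; have [K th] := hatT gf.
exists ((2 * pi)^-1 * (K * \int[mu]_s ker s)) => eta.
rewrite (Lap_FT_psi pr1 pr2 c kap0 cpsi psiB psi_log)// -fmorphV/= nc_realM ger0_norm; last first.
  by rewrite invr_ge0 mulr_ge0// pi_ge0.
rewrite -[leRHS]mulrA ler_wpM2l//.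
  by rewrite invr_ge0 mulr_ge0// pi_ge0.
rewrite mulrAC -RintegralZl//; last exact: rint_ker.
have tp := tame_phase 0 (- x) th.
apply: le_cI => //.
- have := tame_int1 eta tp; congr cint; apply/funext => s; rewrite /phase2.
  by congr (cxp ('i * _%:C) * _); ring.
- by apply: rintZ => //; exact: rint_ker.
move=> s _; rewrite nc_phaseM -[leRHS]mulrA [ker eta * _]mulrC.
by case: th.
Qed.

Hypothesis ipsi : injective psi.

Theorem tauf_inj f : gsr f -> (forall x1 x2, tauf psi c f x1 x2 = 0) -> forall x1 x2, f x1 x2 = 0.
Proof.
move=> gf H x1; pose G eta := Lap (f x1) (psi eta).
have cG : ccont G by exact: Lap_psi_ccont.
have [K GK] := Lap_psi_bound x1 gf.
have K0 : 0 <= K.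
  have := le_trans (nc_ge0 _) (GK 0); by rewrite pmulr_lge0// ker_gt0.
have GK' t : nc (G t) <= K by apply: le_trans (GK t) _; rewrite ler_piMr ?ker_le1.
have iG : cint mu setT G by apply: (@cint_ker _ _ K) => //; exact: ccont_meas.
apply: (Lap_uniq (superexp_slice x1 (gsr_superexp pr1 pr2 gf)) cpsi ipsi).
apply: (Fourier_zero cG GK' iG) => y.
have iph : cint mu setT (fun t => cxp ('i * (t * y)%:C) * G t).
  apply: (@cint_ker _ _ K).
    apply: cmeasM; last exact: ccont_meas.
    apply/ccont_meas/ccont_cxp/ccontM; first exact: ccont_cst.
    by apply: ccont_real => t; apply: cvgM => //; exact: cvg_cst.
  by move=> t; rewrite nc_phaseM; exact: GK.
have /eqP := H x1 y; rewrite /tauf mulf_eq0 invr_eq0 (negPf two_pi_neq0)/=.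
have -> : cI mu setT (fun eta => cxp ((c +i* eta) * y%:C) * Lap (f x1) (psi eta)) =
    (expR (c * y))%:C * cI mu setT (fun t => cxp ('i * (t * y)%:C) * G t).
  rewrite -cIZ//; apply: eq_cI => t _; rewrite mulrA -cxp_real -cxpD; congr (cxp _ * _).
  by apply: complex_eqP; rewrite !cE/=; ring.
rewrite mulf_eq0 => /orP[|/eqP//].
by rewrite -[0]/(0%:C) (inj_eq (@complexI _)) gt_eqF// expR_gt0.
Qed.

End TauProperties.

(** * Smoothness of exponential integrals *)

Section Smoothness.
Context {R : realType}.
Notation mu := (@lebesgue_measure R).
Notation mu2 := (mu \x mu)%E.
Variables (l1 l2 : R * R -> R[i]) (A : R).
Hypothesis (ml1 : cmeas setT l1) (ml2 : cmeas setT l2).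
Hypothesis (A1 : forall p, `|cRe (l1 p)| <= A) (A2 : forall p, `|cRe (l2 p)| <= A).
Implicit Types (h : R * R -> R[i]).

Let L (p : R * R) : R := nc (l1 p) + nc (l2 p).
Let L0 p : 0 <= L p. Proof. by rewrite addr_ge0 ?nc_ge0. Qed.

(* Differentiating [EI h] multiplies h by a linear combination of l1 and l2; this class is closed
   under that operation. *)
Definition rapid h := cmeas setT h /\ forall n, exists2 K : R, 0 <= K &
  forall p, (1 + L p) ^+ n * nc (h p) <= K * (ker p.1 * ker p.2).

Lemma rapidM h (l : R * R -> R[i]) (M : R) : rapid h -> cmeas setT l -> 0 <= M ->
  (forall p, nc (l p) <= M * (1 + L p)) -> rapid (fun p => l p * h p).
Proof.
move=> [mh hn] ml M0 lM; split=> [|n]; first exact: cmeasM.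
have [K K0 HK] := hn n.+1; exists (M * K); first exact: mulr_ge0.
move=> p; rewrite -mulrA; apply: le_trans (ler_wpM2l M0 (HK p)).
have p0 : 0 <= (1 + L p) ^+ n by rewrite exprn_ge0// addr_ge0.
rewrite ncM exprS; apply: le_trans (_ : (1 + L p) ^+ n * (M * (1 + L p) * nc (h p)) <= _).
  by rewrite ler_wpM2l// ler_wpM2r ?nc_ge0.
by rewrite le_eqVlt; apply/orP; left; apply/eqP; ring.
Qed.

Lemma rapid_lin (v1 v2 : R) h : rapid h -> rapid (fun p => (v1%:C * l1 p + v2%:C * l2 p) * h p).
Proof.
move=> rh; apply: (@rapidM h _ (`|v1| + `|v2|)) => //.
- by apply: cmeasD; apply: cmeasM => //; exact: cmeas_cst.
move=> p; apply: le_trans (ncD _ _) _; rewrite !nc_realM /L.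
have := nc_ge0 (l1 p); have := nc_ge0 (l2 p); have := normr_ge0 v1; have := normr_ge0 v2.
by nra.
Qed.

Lemma rapid_l1 h : rapid h -> rapid (fun p => l1 p * h p).
Proof.
move=> rh; have := rapid_lin 1 0 rh.
by under eq_fun do rewrite mul1r mul0r addr0.
Qed.

Lemma rapid_l2 h : rapid h -> rapid (fun p => l2 p * h p).
Proof.
move=> rh; have := rapid_lin 0 1 rh.
by under eq_fun do rewrite mul0r add0r mul1r.
Qed.

Lemma rapid_int h (x1 x2 : R) : rapid h ->
  cint mu2 setT (fun p => cxp (l1 p * x1%:C + l2 p * x2%:C) * h p).
Proof.
move=> [mh hn]; have [K K0 HK] := hn 0%N.
have A0 : 0 <= A := le_trans (normr_ge0 _) (A1 (0, 0)).
apply: (@cint_ker2 _ (expR (A * (`|x1| + `|x2|)) * K)).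
  apply: cmeasM => //; apply: cmeas_cxp.
  by apply: cmeasD; apply: cmeasM => //; exact: cmeas_cst.
move=> p; rewrite ncM nc_cxp -[leRHS]mulrA; apply: ler_pM; rewrite ?expR_ge0 ?nc_ge0//.
  rewrite ler_expR !cE/= !mulr0 !subr0; apply: le_trans (ler_norm _) _.
  by apply: le_trans (ler_normD _ _) _; rewrite !normrM mulrDr lerD// ler_wpM2r.
by have := HK p; rewrite expr0 mul1r.
Qed.

Variable pr : R[i] -> R.
Hypothesis (prD : forall z w, pr (z + w) = pr z + pr w) (prN : forall z, pr (- z) = - pr z)
  (prM : forall (a : R) z, pr (a%:C * z) = a * pr z) (prn : forall z, `|pr z| <= nc z).

(** [pr] stands for the real or the imaginary part, so one argument covers both halves of
    [Cinfty]. *)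
Definition EIv h (x : 'rV[R]_2) : R := pr (EI mu2 l1 l2 h (x 0 0)%:C (x 0 1)%:C).

Lemma EIv_diff h x : rapid h -> differentiable (EIv h) x /\
  'd (EIv h) x = lin2 (EIv (fun p => l1 p * h p) x) (EIv (fun p => l2 p * h p) x) :> (_ -> _).
Proof.
move=> rh; have [mh hn] := rh; have [K K0 HK] := hn 2%N.
have ih : rint mu2 setT (fun p => (1 + L p) ^+ 2 * nc (h p)).
  apply: (rint_dom measurableT _ (rintZ measurableT K (@rint_ker2 R))).
    apply: measurable_funM; last exact: cmeas_nc.
    apply: measurable_funX; apply: measurable_funD; first exact: measurable_cst.
    by apply: measurable_funD; exact: cmeas_nc.
  move=> p _; rewrite ger0_norm//.
  by apply: mulr_ge0; [exact: sqr_ge0|exact: nc_ge0].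
have [C C0 HC] := @EI_real_quad _ _ _ mu2 _ _ ml1 ml2 h A mh A1 A2 ih (x 0 0) (x 0 1).
have C40 : 0 <= 4 * C by rewrite mulr_ge0.
apply: (@quad_differentiable _ _ _ _ (lin2 _ _) x (4 * C) 2^-1) => //.
- exact: continuous_lin2.
move=> v v1; have n0 := norm_rv2_coord v 0; have n1 := norm_rv2_coord v 1.
have s1 : `|v 0 0| + `|v 0 1| <= 1 by lra.
have := HC _ _ s1; set Z := _ - _ => hZ.
have -> : EIv h (v + x) - EIv h x - lin2 (EIv (fun p => l1 p * h p) x) (EIv (fun p => l2 p * h p) x) v = pr Z.
  rewrite /Z !(prD, prN) !prM /EIv /lin2 !mxE [v 0 0 + _]addrC [v 0 1 + _]addrC.
  by rewrite opprD.
apply: le_trans (prn _) _; apply: le_trans hZ _.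
rewrite [4 * C]mulrC -[leRHS]mulrA ler_wpM2l//.
rewrite (_ : 4 * `|v| ^+ 2 = (2 * `|v|) ^+ 2); last by ring.
have := normr_ge0 (v 0 0); have := normr_ge0 (v 0 1); have := normr_ge0 v => *.
by rewrite ler_sqr ?nnegrE; lra.
Qed.

Lemma EIv_Ck n h : rapid h -> Ck n (EIv h).
Proof.
elim: n h => [|n IH] h rh /=.
  by move=> x; apply: differentiable_continuous; have [] := EIv_diff x rh.
split=> [x|v]; first by have [] := EIv_diff x rh.
rewrite (_ : (fun x => _) = EIv (fun p => ((v 0 0)%:C * l1 p + (v 0 1)%:C * l2 p) * h p)).
  exact/IH/rapid_lin.
apply/funext => x; have [dx ex] := EIv_diff x rh.
rewrite deriveE// ex /lin2 /EIv -!prM -prD; congr pr.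
have j1 := rapid_int (x 0 0) (x 0 1) (rapid_l1 rh).
have j2 := rapid_int (x 0 0) (x 0 1) (rapid_l2 rh).
rewrite /EI -cIZ// -cIZ// -cID//; [|exact: cintZ..].
by apply: eq_cI => p _; ring.
Qed.

End Smoothness.

Section TwistingProperties.
Context {R : realType}.
Notation mu := (@lebesgue_measure R).
Notation mu2 := (mu \x mu)%E.
Variables (q : R) (k : 'I_2) (al1 al2 : R) (I : set R) (c : R).
Hypothesis (hq : q != 0) (h1 : 0 < al1 < 1) (h2 : 0 < al2 < 1).
Hypothesis (hI : admissible q k I) (hc : I c).
Implicit Types u v w : 'rV[R]_2 -> R[i].

Notation p1 := al1^-1.
Notation p2 := al2^-1.
Notation r1 := (1 - al2)^-1.
Notation r2 := (1 - al1)^-1.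
Let psi (eta : R) := phi_inv q (k%:R * (pi / 2)) (c +i* eta).
Let pr1 : conj_exp p1 r2 := conj_exp_alpha h1.
Let pr2 : conj_exp p2 r1 := conj_exp_alpha h2.
Let kap0 : 0 < `|q|. Proof. by rewrite normr_gt0. Qed.
Let cpsi : ccont psi. Proof. by have [] := phi_inv_line hq hI hc. Qed.
Let ipsi : injective psi. Proof. by have [] := phi_inv_line hq hI hc. Qed.
Let psiB : forall eta, `|cRe (psi eta)| <= pi / (2 * `|q|).
Proof. by have [] := phi_inv_line hq hI hc. Qed.
Let psi_log : forall eta, `|q| * `|eta| <= expR (`|q| * `|cIm (psi eta)|).
Proof. by have [] := phi_inv_line hq hI hc. Qed.

Lemma tau_tauf u x : SA al1 al2 u -> tau q k c u x = tauf psi c (cur u) (x 0 0) (x 0 1).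
Proof.
move=> /(SA_gsr h1 h2) gu.
have [K HK] := Lap_psi_bound pr1 pr2 c kap0 cpsi psiB psi_log (x 0 0) gu.
have cG := Lap_psi_ccont pr1 pr2 cpsi (x 0 0) gu.
pose G eta := cxp ((c +i* eta) * (x 0 1)%:C) * Lap (cur u (x 0 0)) (psi eta).
have iG : cint mu setT G.
  apply: (@cint_ker _ _ (expR (c * x 0 1) * K)).
    apply/ccont_meas/ccontM => //; apply: ccont_cxp; apply: ccontM; last exact: ccont_cst.
    rewrite (_ : Complex c = fun eta => c%:C + 'i * eta%:C).
      by apply: ccontD; [exact: ccont_cst|apply: ccontM; [exact: ccont_cst|exact: ccont_id]].
    by apply/funext => eta; apply: complex_eqP; rewrite !cE/=; ring.
  move=> eta; rewrite ncM nc_cxp -mulrA; apply: ler_pM; rewrite ?expR_ge0 ?nc_ge0//.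
  by rewrite ler_expR le_eqVlt; apply/orP; left; apply/eqP; rewrite !cE/=; ring.
have LE z : laplace (fun x2 => u (row2 (x 0 0) x2)) z = Lap (cur u (x 0 0)) z.
  by apply: eq_cI => t _; rewrite -cxpE.
rewrite /tau /inv_laplace /integral1 /tauf.
(* The factor i of dz = i d(eta) is taken out so as to cancel the one in (2 pi i)^-1. *)
transitivity ((2 * pi%:C * 'i)^-1 * (cI mu setT G * 'i)).
  congr (_ * _); apply: (etrans _ (cIZr measurableT 'i iG)).
  by apply: eq_cI => eta _; rewrite -cxpE /= LE.
have i0 : 'i != 0 :> R[i] by rewrite -nc_eq0 nc_i oner_eq0.
rewrite invfM [cI _ _ _ * 'i]mulrC mulrA mulfVK//.
by rewrite rmorphM/= rmorph_nat.
Qed.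

Lemma tau_lin (a : R[i]) u v : SA al1 al2 u -> SA al1 al2 v ->
  tau q k c (fun x => a * u x + v x) = (fun x => a * tau q k c u x + tau q k c v x).
Proof.
move=> su sv; apply/funext => x; rewrite !tau_tauf//; last exact: SA_lin.
exact (tauf_lin pr1 pr2 c kap0 cpsi psiB psi_log a _ _ ((SA_gsr h1 h2 _).1 su) ((SA_gsr h1 h2 _).1 sv)).
Qed.

Lemma tau_inj : set_inj (SA al1 al2) (tau q k c).
Proof.
move=> u v; rewrite !inE => su sv e.
pose d x := (-1) * v x + u x.
have sd : SA al1 al2 d by exact: SA_lin.
have d0 : forall x1 x2, cur d x1 x2 = 0.
  apply: (tauf_inj pr1 pr2 (c := c) kap0 cpsi psiB psi_log ipsi ((SA_gsr h1 h2 _).1 sd)) => x1 x2.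
  have := tau_tauf (row2 x1 x2) sd; rewrite !mxE/= => <-.
  have Z (a b : R[i]) : a = b -> -1 * b + a = 0 by move=> ->; rewrite mulN1r addNr.
  apply: (etrans (congr1 (fun g => g (row2 x1 x2)) (tau_lin (-1) sv su))).
  exact: (Z _ _ (congr1 (fun g => g (row2 x1 x2)) e)).
apply/funext => x; have := d0 (x 0 0) (x 0 1); rewrite /cur row2_eta /d mulN1r addrC.
by move=> /eqP; rewrite subr_eq0 => /eqP.
Qed.

Lemma tau_smooth u : SA al1 al2 u -> Cinfty (tau q k c u).
Proof.
move=> su n; have gu := (SA_gsr h1 h2 _).1 su.
pose h (p : R * R) : R[i] := (2 * pi)%:C^-1 ^+ 2 * FT_psi psi (cur u) p.1 p.2.
have ml1 : cmeas setT (@l1 R).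
  apply: cmeasM; first exact: cmeas_cst.
  exact: cmeas_real.
have ml2 : cmeas setT (@l2 R c).
  by split => /=; [exact: measurable_cst|exact: measurable_snd].
have A1 p : `|cRe (@l1 R p)| <= `|c|.
  by rewrite /l1 !cE/= (_ : _ - _ = 0) ?normr0//; ring.
have A2 p : `|cRe (@l2 R c p)| <= `|c| by [].
have rh : rapid (@l1 R) (l2 c) h.
  have rhat : rapid (@l1 R) (l2 c) (fun p => FT_psi psi (cur u) p.1 p.2).
    split=> [|m].
      have [K th] := FT_psi_tame pr1 pr2 c kap0 cpsi psiB psi_log gu.
      exact: tame_meas th.
    have [K K0 HK] := FT_psi_bound pr1 pr2 c kap0 psiB psi_log m gu.
    by exists K => // -[s eta]; exact: HK.
  apply: (@rapidM _ _ _ _ _ (nc ((2 * pi)%:C^-1 ^+ 2)) rhat); first exact: cmeas_cst.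
    exact: nc_ge0.
  by move=> p; rewrite ler_peMr ?nc_ge0// lerDl addr_ge0 ?nc_ge0.
have E x : tau q k c u x = EI mu2 (@l1 R) (l2 c) h (x 0 0)%:C (x 0 1)%:C.
  rewrite tau_tauf//.
  exact (tauf_EI pr1 pr2 c kap0 cpsi psiB psi_log _ _ gu).
split.
  rewrite (_ : (fun x => _) = EIv (@l1 R) (l2 c) (@complex.Re R) h); last by apply/funext => x; rewrite E.
  apply: (@EIv_Ck _ _ _ `|c|) => // *; [exact: cReD|exact: cReN|exact: Re_realM|exact: nc_Re].
rewrite (_ : (fun x => _) = EIv (@l1 R) (l2 c) (@complex.Im R) h); last by apply/funext => x; rewrite E.
apply: (@EIv_Ck _ _ _ `|c|) => // *; [exact: cImD|exact: cImN|exact: Im_realM|exact: nc_Im].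
Qed.

Lemma tau_invK w : SA al1 al2 w -> invT q k c al1 al2 (tau q k c w) = w.
Proof. by move=> sw; rewrite /invT (pinvKV _ tau_inj)// inE. Qed.

End TwistingProperties.

(** * Transport of the algebra structure *)

Lemma Rcomplex_lin (R : realType) (a : R) (u v : 'rV[R]_2 -> Rcomplex R) :
  a *: u + v = (fun x => a%:C * u x + v x) :> ('rV[R]_2 -> R[i]).
Proof.
apply/funext => x; apply: complex_eqP; rewrite ?cReD ?cImD ?Re_realM ?Im_realM.
  by congr (_ + _); rewrite -[(a *: u) x]/(scalec a (u x)); case: (u x).
by congr (_ + _); rewrite -[(a *: u) x]/(scalec a (u x)); case: (u x).
Qed.

Lemma SA_assoc_algebra (R : realType) (q al1 al2 : R) : 0 < al1 < 1 -> 0 < al2 < 1 ->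
  @assoc_algebra_on R ('rV[R]_2 -> Rcomplex R) (SA al1 al2) (weyl q).
Proof.
move=> h1 h2; split.
- split; first exact: SA0.
  by move=> a u v su sv; rewrite Rcomplex_lin; exact: SA_lin.
- by move=> u v; exact: SA_weyl.
- move=> a u v w su sv sw; rewrite [a *: u + v]Rcomplex_lin.
  exact (etrans (weyl_linl h1 h2 q a%:C su sv sw) (esym (Rcomplex_lin _ _ _))).
- move=> a u v w su sv sw; rewrite [a *: v + w]Rcomplex_lin.
  exact (etrans (weyl_linr h1 h2 q a%:C sv sw su) (esym (Rcomplex_lin _ _ _))).
by move=> u v w su sv sw; exact (weyl_assoc h1 h2 q su sv sw).
Qed.

(** Isolates the algebra from the analysis: of T only linearity on S and a left inverse T' there are
    used. *)
Lemma transport_assoc_algebra (K : pzRingType) (U V : lmodType K) (S : set U)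
    (T : U -> V) (T' : V -> U) (mul : U -> U -> U) :
  assoc_algebra_on S mul ->
  (forall a u v, S u -> S v -> T (a *: u + v) = a *: T u + T v) ->
  (forall u, S u -> T' (T u) = u) ->
  assoc_algebra_on (T @` S) (fun u v => T (mul (T' u) (T' v))).
Proof.
move=> [[S0 Slin] Smul linl linr assoc] Tlin TK.
have T0 : T 0 = 0.
  by have := Tlin (-1) _ _ S0 S0; rewrite scaler0 addr0 scaleN1r addNr.
split.
- split; first by exists 0.
  by move=> a _ _ [u su <-] [v sv <-]; exists (a *: u + v); [exact: Slin|exact: Tlin].
- by move=> _ _ [u su <-] [v sv <-]; rewrite !TK//; exists (mul u v) => //; exact: Smul.
- move=> a _ _ _ [u su <-] [v sv <-] [w sw <-].
  by rewrite -Tlin// !TK//; [rewrite linl// Tlin//; exact: Smul|exact: Slin].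
- move=> a _ _ _ [u su <-] [v sv <-] [w sw <-].
  by rewrite -Tlin// !TK//; [rewrite linr// Tlin//; exact: Smul|exact: Slin].
move=> _ _ _ [u su <-] [v sv <-] [w sw <-].
by rewrite !TK ?assoc//; exact: Smul.
Qed.

(* Rcomplex R is R[i] as a vector space over R; functions into it form an
   lmodType R for the pointwise operations. *)
Theorem proposition6p2 (R : realType) (q : R) (k : 'I_2) (alpha1 alpha2 : R)
    (I : set R) (c : R)
    (hq : q != 0)
    (h1 : 0 < alpha1 < 1) (h2 : 0 < alpha2 < 1) (h12 : 1 <= alpha1 + alpha2)
    (hI : admissible q k I) (hc : I c) :
  [/\ set_fun (SA alpha1 alpha2) (@Cinfty R 2) (tau q k c),
      set_inj (SA alpha1 alpha2) (tau q k c),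
      forall u v, rangeE q k c alpha1 alpha2 u -> rangeE q k c alpha1 alpha2 v ->
        SA alpha1 alpha2
          (weyl q (invT q k c alpha1 alpha2 u) (invT q k c alpha1 alpha2 v)) &
      @assoc_algebra_on R ('rV[R]_2 -> Rcomplex R)
        (rangeE q k c alpha1 alpha2) (star q k c alpha1 alpha2)].
Proof.
split.
- by move=> u su; exact (tau_smooth hq h1 h2 hI hc su).
- exact (tau_inj hq h1 h2 hI hc).
- move=> _ _ [u su <-] [v sv <-].
  have e := f_equal2 (weyl q) (tau_invK hq h1 h2 hI hc su) (tau_invK hq h1 h2 hI hc sv).
  by rewrite e; exact: SA_weyl.
(* [rangeE] and [star] unfold to the image of S_A under tau and the Weyl product transported along
   it. *)
apply: (@transport_assoc_algebra R ('rV[R]_2 -> Rcomplex R) ('rV[R]_2 -> Rcomplex R)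
  (SA alpha1 alpha2) (tau q k c) (invT q k c alpha1 alpha2) (weyl q)).
- exact: SA_assoc_algebra.
- move=> a u v su sv; rewrite [a *: u + v]Rcomplex_lin.
  exact (etrans (tau_lin hq h1 h2 hI hc a%:C su sv) (esym (Rcomplex_lin _ _ _))).
- by move=> u su; exact (tau_invK hq h1 h2 hI hc su).
Qed.
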